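(* Let $p\in(1,\infty)$. Let $\Phi$ be a $\mathbf{\Phi}$-function such that $\Phi\in(\mathrm{aInc})_p\cap(\mathrm{Dec})$. There exists a constant $C_{\Phi,p}>0$, depending only on $p$ and $\Phi$, such that for every compact $\Omega\subset\mathbb{R}^d$ and Borel probability measure $\mu$ on $\Omega$, for every $N\ge1$, $H\ge1$, for every $N$-dimensional subspace $X_N\subset C(\Omega)$ with $X_N\in NI_{2,\infty}(H)$, for every $\varepsilon\in(0,1/2]$, and for every positive integer $$m\ge C_{\Phi,p}\,\varepsilon^{-2}(\log\varepsilon^{-1})^{\frac{\min\{p,2\}}{2}}\,\Phi\bigl(H^{\frac{2}{\min\{p,2\}}}\bigr)(\log2N)^2\log2H^2,$$ there are points $\mathbf{x}=\{x_1,\dots,x_m\}\subset\Omega$ (not necessarily distinct) such that $$a_\Phi(1)^{-1}(1-\varepsilon)\|f\|_\Phi\le\|f\|_{\Phi,\mathbf{x}}\le a_\Phi(1)(1+\varepsilon)\|f\|_\Phi\quad\forall f\in X_N.$$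
   Context: $\log$ is the logarithm to base 2. ''Increasing'' and ''decreasing'' are non-strict. A $\mathbf{\Phi}$-function is an increasing $\Phi:[0,\infty)\to[0,\infty)$ with $\Phi(0)=0$, $\lim_{t\to0+}\Phi(t)=0$, $\lim_{t\to\infty}\Phi(t)=\infty$ and $\Phi\in(\mathrm{aInc})_1$. Here $\Phi\in(\mathrm{aInc})_p$ means that $t\mapsto\Phi(t)t^{-p}$ is almost increasing on $(0,\infty)$: there is a constant $a_\Phi(p)\ge1$ with $\Phi(s)s^{-p}\le a_\Phi(p)\Phi(t)t^{-p}$ for all $0<s<t$. In particular $a_\Phi(1)$ is such a constant for $p=1$. $\Phi\in(\mathrm{Dec})$ means that there is $q\ge1$ such that $t\mapsto\Phi(t)t^{-q}$ is decreasing on $(0,\infty)$. $C(\Omega)$ is the space of continuous (real- or complex-valued) functions on $\Omega$. $X_N\in NI_{2,\infty}(H)$ means $\max_{x\in\Omega}|f(x)|\le H(\int_\Omega|f|^2d\mu)^{1/2}$ for all $f\in X_N$. For a probability measure $\nu$, $\|f\|_{L^\Phi(\nu)}:=\inf\{\lambda>0:\int\Phi(|f|/\lambda)\,d\nu\le1\}$; $\|f\|_\Phi:=\|f\|_{L^\Phi(\mu)}$ and $\|f\|_{\Phi,\mathbf{x}}:=\|f\|_{L^\Phi(\nu)}$ with $\nu=\frac1m\sum_{j=1}^m\delta_{x_j}$. *)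

(* Defs.v *)
From HB Require Import structures.
From mathcomp Require Import all_boot all_order all_algebra.
From mathcomp Require Import complex.
From mathcomp Require Import all_classical all_reals all_analysis.

Set Implicit Arguments.
Unset Strict Implicit.
Unset Printing Implicit Defensive.

Import Order.TTheory GRing.Theory Num.Theory.
Import numFieldNormedType.Exports.

Local Open Scope classical_set_scope.
Local Open Scope ring_scope.

Definition log2 (R : realType) (x : R) : R := ln x / ln 2.

(* Phi : [0, oo) -> [0, oo) is represented by a function R -> R; only its
   values on [0, oo) are constrained or used. *)

Definition aInc_const (R : realType) (Phi : R -> R) (p a : R) : Prop :=
  1 <= a /\
  forall s t : R, 0 < s -> s < t ->
    Phi s * s `^ (- p) <= a * (Phi t * t `^ (- p)).

Definition aInc (R : realType) (p : R) (Phi : R -> R) : Prop :=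
  exists a : R, aInc_const Phi p a.

Definition Dec (R : realType) (Phi : R -> R) : Prop :=
  exists q : R, 1 <= q /\
  forall s t : R, 0 < s -> s < t ->
    Phi t * t `^ (- q) <= Phi s * s `^ (- q).

Record Phi_function (R : realType) (Phi : R -> R) : Prop := {
  Phi_ge0 : forall t : R, 0 <= t -> 0 <= Phi t ;
  Phi_increasing : forall s t : R, 0 <= s -> s <= t -> Phi s <= Phi t ;
  Phi_at0 : Phi 0 = 0 ;
  Phi_cvg0 : Phi t @[t --> 0^'+] --> (0 : R) ;
  Phi_cvgy : Phi t @[t --> +oo] --> +oo ;
  Phi_aInc1 : aInc 1 Phi
}.

(* The two fields of scalars, with their modulus taking values in R. *)
Variant scalar_modulus (R : realType) : forall K : numFieldType, (K -> R) -> Prop :=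
  | real_modulus : @scalar_modulus R R (fun x : R => `|x|)
  | complex_modulus : @scalar_modulus R R[i] (@Normc.normc R).

(* Measurable types have to be pointed: [pointed_subset x0] is the subset A, with the
   subspace topology, pointed by an arbitrary x0 : A.  The point plays no other
   role, and it exists as soon as A carries a probability measure. *)
Definition pointed_subset (T : topologicalType) (A : set T) (x0 : A) : Type := set_type A.

HB.instance Definition _ (T : topologicalType) (A : set T) (x0 : A) :=
  Topological.copy (pointed_subset x0) (set_type A).
HB.instance Definition _ (T : topologicalType) (A : set T) (x0 : A) :=
  isPointed.Build (pointed_subset x0) x0.

Definition borel (T : topologicalType) (A : set T) (x0 : A) :=
  g_sigma_algebraType (@open (pointed_subset x0)).

Definition fin_dim_subspace (T : topologicalType) (K : numFieldType) (N : nat)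
    (X : set (T -> K)) : Prop :=
  (forall f, X f -> continuous f) /\
  exists e : 'I_N -> T -> K,
    (forall c : 'I_N -> K,
      (forall x, \sum_(i < N) c i * e i x = 0) -> forall i, c i = 0) /\
    X = [set f | exists c : 'I_N -> K, forall x, f x = \sum_(i < N) c i * e i x].

Definition NI_2_infty (R : realType) (d : measure_display)
    (T : measurableType d) (mu : probability T R) (K : numFieldType)
    (modulus : K -> R) (H : R) (X : set (T -> K)) : Prop :=
  forall f, X f ->
  forall x, modulus (f x) <= H * Num.sqrt (\int[mu]_y (modulus (f y) ^+ 2)).

Definition luxemburg (R : realType) (d : measure_display)
    (T : measurableType d) (nu : {measure set T -> \bar R}) (Phi : R -> R)
    (K : numFieldType) (modulus : K -> R) (f : T -> K) : R :=
  inf [set l : R | 0 < l /\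
                   (\int[nu]_x (Phi (modulus (f x) / l))%:E <= 1)%E].

Section empirical.
Context (R : realType) (d : measure_display) (T : measurableType d).
Context (m : nat) (x : 'I_m -> T).

Definition empirical (A : set T) : \bar R :=
  ((m%:R^-1)%:E * \sum_(j < m) \d_(x j) A)%E.

Let seqm (k : nat) : {measure set T -> \bar R} :=
  if insub k is Some j then \d_(x j) else mzero.

Let empiricalE :
  empirical = mscale (m%:R^-1)%:nng (msum seqm m).
Proof.
apply/funext => A; rewrite /empirical /mscale /msum /=; congr (_ * _)%E.
by apply: eq_bigr => j _; rewrite /seqm valK.
Qed.

Let empirical0 : empirical set0 = 0%E.
Proof. by rewrite empiricalE measure0. Qed.

Let empirical_ge0 A : (0 <= empirical A)%E.
Proof. by rewrite empiricalE measure_ge0. Qed.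

Let empirical_sigma_additive : semi_sigma_additive empirical.
Proof. by rewrite empiricalE; exact: measure_semi_sigma_additive. Qed.

HB.instance Definition _ := isMeasure.Build _ _ _ empirical
  empirical0 empirical_ge0 empirical_sigma_additive.

End empirical.

(* Main.v *)
Require Import Defs.
From mathcomp Require Import all_boot all_order all_algebra.
From mathcomp Require Import all_classical all_reals all_analysis measurable_realfun.
From mathcomp Require Import ring lra.

Set Implicit Arguments.
Unset Strict Implicit.
Unset Printing Implicit Defensive.

Import Order.TTheory GRing.Theory Num.Theory.
Import numFieldNormedType.Exports.
From mathcomp Require Import complex.

Local Open Scope classical_set_scope.
Local Open Scope ring_scope.

(** The heart of the proof is an estimate for the modular, the integral of [Phi |f|]:
    there are points such that, whenever the modular of [f] is at most 1, the mean of
    [Phi |f|] over the points differs from it by at most [eps / 2] (lemma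
    [modular_sampling]).  Applied to all the quotients [f / l] it yields the comparison
    of the Luxemburg norms ([inf_ratio_bounds]).  The factor [a_Phi(1)] is lost there:
    that [Phi t / t] is almost increasing says how fast the mean over the points
    decreases in [l] only up to this factor.

    The points are found without probability, by halving.  The measure is first
    replaced by finitely many weighted points ([discretization]) and these by a huge
    sample with equal weights ([avg_approx]).  Then one point of each pair is kept,
    again and again, until [m] points are left.  Keeping one point of each pair amounts
    to choosing signs, and the error is a signed sum of the differences of [Phi |f|]
    over the pairs ([avg_halve]).  Signs that are good for finitely many vectors are
    found by decreasing a potential ([exists_signs]), and signs that are good for the
    whole class of functions of bounded modular by chaining ([chaining]).  The errors
    of the successive halvings form a geometric sum ([finite_sampling]).

    Chaining needs entropy bounds for that class.  Put [r = min(p, 2)].  The lower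
    growth of [Phi] bounds the moments of order [r] of the class, and with the inequality
    between the uniform and the quadratic norm this gives a uniform bound [B] with
    [B ^ r] of order [H ^ 2] ([unit_class_sup]), so that [Phi B] is of order
    [Phi (H ^ (2 / r))].  By both growth conditions the squared increments of [Phi] are
    at most [(|s - t| / B) ^ r * Phi B * Phi t] up to a constant ([Phi_sqr_dist]), so
    that only the supremum of the difference of two functions over the sample matters.
    In this seminorm the class is covered as follows.

    A function [g] of quadratic norm at most [rho] is known up to [tau] on a finite set
    after at most [(rho * H / tau) ^ 2] corrections, each of which adds a multiple of the
    kernel at a point where the error exceeds [tau]: a correction decreases the squared
    norm by [(tau / H) ^ 2] ([perceptron_word]).  This bounds the entropy by that number
    of corrections times the logarithm of the size of the set.  For [r < 2] the norm
    [rho] is first improved on a coarse set of points, whose size is a power of [H],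
    where the quadratic norm is comparable to the mean over the set ([coarse_points]):
    functions which are at most [u] there have squared norm of order [u ^ (2 - r)].
    Thus the coarse approximation costs [log H] per correction and only the last step
    costs [log m], and the balance of the two ([codable_sample]) gives the geometric
    mean of these logarithms with weights [1 - r / 2] and [r / 2].  This is the
    origin of the exponent of [log (1 / eps)]: the logarithm of [m] is at most of the
    order of [log (1 / eps) * log (2 * H ^ 2)], up to a factor that the constant absorbs
    ([sample_size_suffices]).

    At scales below the inverse of the dimension a grid is cheaper, so that the number
    of levels with a significant contribution is of the order of [log (2 * N)].  Each of
    them contributes equally to the error ([chaining_sum_le]), whence the square of this
    logarithm in the sample size. *)

(** * Signs from a greedy potential argument *)

Section Signs.
Variable R : realType.
Implicit Types x : R.

(** The constant 2 in the exponent, in place of the optimal 1/2, allows a proof from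
    [1 + x <= expR x] alone: for [x >= 1/2] because then [x <= 2 * x ^+ 2], and for
    smaller [x] because the mean of [(1 - x)^-1] and [(1 + x)^-1] is
    [(1 - x ^+ 2)^-1]. *)
Lemma cosh_le_expR x : (expR x + expR (- x)) / 2 <= expR (2 * x ^+ 2).
Proof.
wlog x0 : x / 0 <= x.
  move=> h; have [/h//|/ltW x0] := leP 0 x.
  by have := h (- x); rewrite oppr_ge0 opprK addrC sqrrN; apply.
have [xh|xh] := leP 2^-1 x.
  have -> : expR (2 * x ^+ 2) = (expR (2 * x ^+ 2) + expR (2 * x ^+ 2)) / 2 by field.
  rewrite ler_pM2r// lerD// ler_expR; first by nra.
  by nra.
have e1 : expR x <= (1 - x)^-1.
  rewrite -[x in expR x]opprK expRN lef_pV2 ?posrE ?expR_gt0//; last by lra.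
  exact: expR_ge1Dx.
have e2 : expR (- x) <= (1 + x)^-1.
  rewrite expRN lef_pV2 ?posrE ?expR_gt0//; last by lra.
  exact: expR_ge1Dx.
have e3 : 1 + 2 * x ^+ 2 <= expR (2 * x ^+ 2) by exact: expR_ge1Dx.
apply: le_trans e3.
apply: (@le_trans _ _ (((1 - x)^-1 + (1 + x)^-1) / 2)); first by lra.
have -> : ((1 - x)^-1 + (1 + x)^-1) / 2 = (1 - x ^+ 2)^-1.
  by field; apply/and3P; split; apply: lt0r_neq0; nra.
rewrite -[leLHS]mul1r ler_pdivrMr; last by nra.
have xx : x ^+ 2 <= 1 / 2 by nra.
by nra.
Qed.

Definition signed_sum (s : nat -> bool) (n : nat) (a : nat -> R) : R :=
  \sum_(k < n) (-1) ^+ s k * a k.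

Let cosh x := (expR x + expR (- x)) / 2.

(** When one more term is added, [cosh (S + c) + cosh (S - c) = 2 * cosh S * cosh c],
    and [cosh c] is compensated by the new exponential factor.  Hence the potential
    does not increase on average over the two signs, and one of them can be chosen
    for which it does not increase: this is the sub-Gaussian moment bound with the
    expectation replaced by a greedy choice. *)
Lemma sign_potential (I : finType) (w lam : I -> R) (a : I -> nat -> R) n :
  (forall i, 0 <= w i) ->
  exists s : nat -> bool,
    \sum_i w i * (cosh (lam i * signed_sum s n (a i))
                  * expR (- (2 * lam i ^+ 2 * \sum_(k < n) a i k ^+ 2)))
    <= \sum_i w i.
Proof.
move=> w0; elim: n => [|n [s IH]].
  exists xpredT; apply: ler_sum => i _.
  by rewrite /signed_sum !big_ord0 /cosh !mulr0 oppr0 expR0 -[1 + 1]/(2) divff// !mulr1.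
pose P (b : bool) := \sum_i w i * (cosh (lam i * (signed_sum s n (a i) + (-1) ^+ b * a i n))
     * expR (- (2 * lam i ^+ 2 * \sum_(k < n.+1) a i k ^+ 2))).
have key : P false + P true <= 2 * \sum_i w i.
  apply: le_trans (ler_wpM2l _ IH) => //.
  rewrite /P -big_split /= mulr_sumr; apply: ler_sum => i _.
  rewrite -mulrDr [leRHS]mulrCA ler_wpM2l//.
  rewrite -mulrDl big_ord_recr /= [X in expR (- X)]mulrDr opprD expRD.
  set S := signed_sum _ _ _; set E := expR (- (_ * \sum_(_ < _) _)); set c := a i n.
  have -> : cosh (lam i * (S + (-1) ^+ false * c)) + cosh (lam i * (S + (-1) ^+ true * c))
    = 2 * (cosh (lam i * S) * cosh (lam i * c)).
    rewrite /cosh expr0 expr1 mul1r mulN1r !mulrDr !opprD !mulrN !opprK !expRD.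
    by field.
  have := cosh_le_expR (lam i * c); rewrite -/(cosh _).
  have : 0 <= cosh (lam i * S) by rewrite /cosh divr_ge0// addr_ge0// expR_ge0.
  move: (cosh _) (cosh _) => C' C C0 hC.
  set X := expR _.
  have X1 : C' * X <= 1.
    rewrite /X expRN ler_pdivrMr ?expR_gt0// mul1r (le_trans hC)// ler_expR.
    by rewrite exprMn mulrA.
  have -> : 2 * (C * C') * (E * X) = 2 * (C * E) * (C' * X) by ring.
  by rewrite ler_piMr// mulr_ge0// mulr_ge0// expR_ge0.
have [b hb] : exists b, P b <= \sum_i w i.
  have [h|h] := leP (P false) (\sum_i w i); first by exists false.
  by exists true; lra.
exists (fun k => if (k < n)%N then s k else b).
apply: le_trans hb; rewrite /P; apply: ler_sum => i _.
rewrite /signed_sum big_ord_recr /= ltnn.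
by under eq_bigr => k _ do rewrite ltn_ord.
Qed.

(** A sum exceeding its threshold [th i] would alone contribute at least 1/2 to the
    potential, for the optimal choice [lam i = th i / (4 * sg i ^+ 2)]; the last
    hypothesis, which is the union bound, says that the potential starts below 1/2. *)
Lemma exists_signs (I : finType) (n : nat) (a : I -> nat -> R) (sg th : I -> R) :
  (forall i, 0 < sg i) -> (forall i, 0 <= th i) ->
  (forall i, \sum_(k < n) a i k ^+ 2 <= sg i ^+ 2) ->
  \sum_i expR (- (th i ^+ 2 / (8 * sg i ^+ 2))) < 2^-1 ->
  exists s, forall i, `|signed_sum s n (a i)| <= th i.
Proof.
move=> sg0 th0 asg tot.
pose w i := expR (- (th i ^+ 2 / (8 * sg i ^+ 2))).
pose lam i := th i / (4 * sg i ^+ 2).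
have w0 i : 0 <= w i by exact: expR_ge0.
have [s hs] := @sign_potential I w lam a n w0.
exists s => i; rewrite leNgt; apply/negP => hi.
have : 2^-1 <= \sum_i w i.
  apply: le_trans hs; rewrite (bigD1 i)//= -[leLHS]addr0 lerD//; last first.
    apply: sumr_ge0 => j _; rewrite mulr_ge0// mulr_ge0 ?expR_ge0//.
    by rewrite /cosh divr_ge0// addr_ge0 ?expR_ge0.
  set S := signed_sum _ _ _ in hi *; set V := \sum_(_ < _) _.
  have lam0 : 0 <= lam i by rewrite divr_ge0// mulr_ge0// sqr_ge0.
  have c1 : expR (lam i * th i) / 2 <= cosh (lam i * S).
    rewrite ler_pM2r//.
    have [S0|S0] := leP 0 S.
      rewrite -[leLHS]addr0 lerD ?expR_ge0// ler_expR ler_wpM2l//.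
      by rewrite ltW// (lt_le_trans hi)// ger0_norm.
    rewrite -[leLHS]add0r lerD ?expR_ge0// ler_expR -mulrN ler_wpM2l//.
    by rewrite ltW// (lt_le_trans hi)// ltr0_norm.
  have c2 : expR (- (2 * lam i ^+ 2 * sg i ^+ 2)) <= expR (- (2 * lam i ^+ 2 * V)).
    by rewrite ler_expR lerN2 ler_wpM2l// ?asg// mulr_ge0// sqr_ge0.
  apply: (@le_trans _ _ (w i * (expR (lam i * th i) / 2
     * expR (- (2 * lam i ^+ 2 * sg i ^+ 2))))); last first.
    by rewrite ler_wpM2l// ler_pM// ?expR_ge0// divr_ge0// expR_ge0.
  rewrite mulrAC mulrA -expRD -expRD.
  have s0 : sg i != 0 by rewrite gt_eqF.
  rewrite [X in expR X](_ : _ = 0) ?expR0 ?mul1r//.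
  by rewrite /lam; field.
by rewrite leNgt => /negP; apply.
Qed.

End Signs.

(** * Chaining *)

Section Chaining.
Variable R : realType.

Lemma sqr_triangle (n : nat) (u v : nat -> R) (d e : R) : 0 < d -> 0 < e ->
  \sum_(i < n) u i ^+ 2 <= d ^+ 2 -> \sum_(i < n) v i ^+ 2 <= e ^+ 2 ->
  \sum_(i < n) (u i + v i) ^+ 2 <= (d + e) ^+ 2.
Proof.
move=> d0 e0 hu hv.
have -> : (d + e) ^+ 2 = (1 + e / d) * d ^+ 2 + (1 + d / e) * e ^+ 2.
  by field; rewrite !gt_eqF.
apply: (@le_trans _ _ (\sum_(i < n) ((1 + e / d) * u i ^+ 2 + (1 + d / e) * v i ^+ 2))).
  apply: ler_sum => i _; rewrite -subr_ge0.
  rewrite (_ : _ - _ = (e * u i - d * v i) ^+ 2 / (d * e)); last first.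
    by field; rewrite !gt_eqF.
  by rewrite divr_ge0 ?sqr_ge0// mulr_ge0// ltW.
rewrite big_split /= -!mulr_sumr lerD// ler_wpM2l// addr_ge0// divr_ge0// ltW//.
Qed.

Lemma signed_sum_le (s : nat -> bool) n (u : nat -> R) d : 0 < d ->
  \sum_(i < n) u i ^+ 2 <= d ^+ 2 -> `|signed_sum s n u| <= Num.sqrt n%:R * d.
Proof.
move=> d0 hu; have [->|n0] := posnP n.
  by rewrite /signed_sum big_ord0 normr0 mulr_ge0// ltW.
have sn : 0 < Num.sqrt n%:R :> R by rewrite sqrtr_gt0 ltr0n.
apply: le_trans (ler_norm_sum _ _ _) _.
(* Cauchy-Schwarz through |u| <= (u^2 / t + t) / 2, with t the quadratic mean bound. *)
set t := d / Num.sqrt n%:R; have t0 : 0 < t by rewrite divr_gt0.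
apply: (@le_trans _ _ (\sum_(i < n) ((u i ^+ 2 / t + t) / 2))).
  apply: ler_sum => i _; rewrite normrM normr_sign mul1r.
  rewrite -subr_ge0 (_ : _ - _ = (`|u i| - t) ^+ 2 / (2 * t)); last first.
    by rewrite -(real_normK (num_real (u i))); field; rewrite gt_eqF.
  by rewrite divr_ge0 ?sqr_ge0// mulr_ge0// ltW.
rewrite -mulr_suml big_split /= -mulr_suml sumr_const card_ord -[t *+ n]mulr_natr.
have nE : n%:R = Num.sqrt n%:R ^+ 2 :> R by rewrite sqr_sqrtr.
rewrite [X in t * X]nE ler_pdivrMr//.
have -> : Num.sqrt n%:R * d * 2 = d ^+ 2 / t + t * Num.sqrt n%:R ^+ 2.
  by rewrite /t; field; rewrite !gt_eqF.
by rewrite lerD2r ler_pM2r// invr_gt0.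
Qed.

Lemma signed_sumB (s : nat -> bool) n (u v : nat -> R) :
  signed_sum s n (fun i => u i - v i) = signed_sum s n u - signed_sum s n v.
Proof.
by rewrite /signed_sum -sumrB; apply: eq_bigr => i _; rewrite mulrBr.
Qed.

Lemma expR1_gt2 : 2 < expR 1 :> R.
Proof. by have := @expR_gt1Dx R 1 (oner_neq0 R). Qed.

Lemma sum_expRN_lt k1 : \sum_(k < k1) expR (- (k%:R + 2)) < 2^-1 :> R.
Proof.
have h k : expR (- (k%:R + 2)) <= 4^-1 * 2^-1 ^+ k :> R.
  have -> : - (k%:R + 2) = - (k.+2%:R * 1) :> R by rewrite mulr1 -natr1 -natr1; ring.
  rewrite expRN expRM_natl.
  have -> : 4^-1 * 2^-1 ^+ k = (2 ^+ k.+2)^-1 :> R.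
    by rewrite !exprS exprVn; field; rewrite expf_neq0.
  rewrite lef_pV2 ?posrE ?exprn_gt0 ?expR_gt0//.
  by rewrite lerXn2r ?nnegrE ?expR_ge0// ltW// expR1_gt2.
apply: (@le_lt_trans _ _ (2^-1 - 2^-1 * 2^-1 ^+ k1)); last first.
  by rewrite ltrBlDr ltrDl mulr_gt0// ?exprn_gt0// invr_gt0.
elim: k1 => [|k1 IH]; first by rewrite big_ord0 expr0 mulr1 subrr.
rewrite big_ord_recr /= (le_trans (lerD IH (h k1)))//.
by rewrite exprS; set x := _ ^+ k1; lra.
Qed.

(** Chaining along the representatives of a class [S] at the levels [0], ..., [k1]:
    a single choice of signs controls all the links between consecutive levels.  A
    pair of codes is a link only if some [c] in the class has both of them (the
    predicate [joint]), and then its increments have size at most [d k + d k.+1]; the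
    number of links at level [k] is at most [expR (b k + b k.+1)], and the additional
    [k + 2] under the square root makes the union bound summable over the levels.
    Below the last level, signs are estimated by the Cauchy-Schwarz inequality. *)
Lemma chaining (V : Type) (S : V -> Prop) (n k1 : nat) (A : V -> nat -> R)
    (J : nat -> finType) (code : forall k, V -> J k) (rep : forall k, J k -> V)
    (d b : nat -> R) :
  (forall k, 0 < d k) -> (forall k, 0 <= b k) ->
  (forall k c, (k <= k1)%N -> S c ->
     \sum_(i < n) (A c i - A (rep k (code k c)) i) ^+ 2 <= d k ^+ 2) ->
  (forall k, (k <= k1)%N -> #|J k|%:R <= expR (b k)) ->
  exists s, forall c, S c ->
    `|signed_sum s n (A c) - signed_sum s n (A (rep 0%N (code 0%N c)))| <=
      \sum_(k < k1) (d k + d k.+1) * Num.sqrt (8 * (b k + b k.+1 + (k%:R + 2)))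
      + Num.sqrt n%:R * d k1.
Proof.
move=> d0 b0 hd hb.
pose I : finType := {k : 'I_k1 & (J k * J k.+1)%type}.
pose joint (i : I) := `[< exists c, [/\ S c, code _ c = (tagged i).1
                                     & code _ c = (tagged i).2] >].
pose a (i : I) (l : nat) : R := if joint i then
   A (rep _ (tagged i).2) l - A (rep _ (tagged i).1) l else 0.
pose sg (i : I) : R := d (tag i) + d (tag i).+1.
pose bb k : R := b k + b k.+1 + (k%:R + 2).
have bb0 k : 0 <= bb k by rewrite !addr_ge0.
pose th (i : I) : R := sg i * Num.sqrt (8 * bb (tag i)).
have [||||s hs] := @exists_signs R I n a sg th.
- by move=> i; rewrite addr_gt0.
- by move=> i; rewrite mulr_ge0// addr_ge0// ltW.
- move=> i; have [ji|nji] := boolP (joint i); last first.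
    by rewrite big1 ?sqr_ge0// => l _; rewrite /a (negbTE nji) expr0n.
  under eq_bigr => l _ do rewrite /a ji.
  have /asboolP[c [Sc e1 e2]] := ji.
  rewrite -e1 -e2 /sg.
  pose u l := A c l - A (rep (tag i) (code (tag i) c)) l.
  pose v l := A (rep (tag i).+1 (code (tag i).+1 c)) l - A c l.
  rewrite (eq_bigr (fun l : 'I_n => (u l + v l) ^+ 2)); last first.
    by move=> l _; rewrite /u /v; congr (_ ^+ 2); ring.
  apply: sqr_triangle => //; first by apply: hd => //; exact: ltnW.
  rewrite (eq_bigr (fun l : 'I_n => (A c l - A (rep (tag i).+1 (code (tag i).+1 c)) l) ^+ 2)).
    by apply: hd => //; exact: ltn_ord.
  by move=> l _; rewrite /v -sqrrN opprB.
- have -> : \sum_i expR (- (th i ^+ 2 / (8 * sg i ^+ 2)))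
      = \sum_(k < k1) \sum_(p : J k * J k.+1) expR (- bb k).
    transitivity (\sum_(p : I) expR (- bb (tag p))); last first.
      by apply/esym; exact: (@sig_big_dep _ _ _ _ (fun k : 'I_k1 => (J k * J k.+1)%type)
        (fun=> true) (fun k => fun=> true) (fun k _ => expR (- bb k))).
    apply: eq_bigr => i _; congr (expR (- _)).
    rewrite /th exprMn sqr_sqrtr ?mulr_ge0//.
    have : sg i != 0 by rewrite gt_eqF// addr_gt0.
    by move=> ?; field.
  apply: le_lt_trans (sum_expRN_lt k1); apply: ler_sum => k _.
  rewrite sumr_const card_prod -[leLHS]mulr_natr natrM /bb opprD addrC expRD -mulrA ler_piMr ?expR_ge0//.
  rewrite expRN ler_pdivrMl ?expR_gt0// mulr1 expRD.
  by rewrite ler_pM ?ler0n// hb// ltnW.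
exists s => c Sc.
have tel : forall k, (k <= k1)%N ->
   `|signed_sum s n (A (rep k (code k c))) - signed_sum s n (A (rep 0%N (code 0%N c)))|
   <= \sum_(j < k) (d j + d j.+1) * Num.sqrt (8 * bb j).
  elim=> [|k IH] kk; first by rewrite subrr normr0 big_ord0.
  rewrite big_ord_recr /= addrC.
  rewrite -(subrKA (signed_sum s n (A (rep k (code k c))))).
  apply: le_trans (ler_normD _ _) _; rewrite lerD ?IH// 1?ltnW//.
  pose i : I := Tagged (fun k : 'I_k1 => (J k * J k.+1)%type)
                   (i := Ordinal kk) (code k c, code k.+1 c).
  have ji : joint i by apply/asboolP; exists c.
  by have := hs i; rewrite /a ji signed_sumB.
rewrite -(subrKA (signed_sum s n (A (rep k1 (code k1 c))))) addrC.
apply: le_trans (ler_normD _ _) _; rewrite lerD ?tel//.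
by rewrite -signed_sumB signed_sum_le// hd.
Qed.

End Chaining.

(** * Entropy bounds by explicit codes *)

Section Codes.
Variable R : realType.

Section Dot.
Variable D : nat.
Implicit Types u v w : 'rV[R]_D.

Definition dot u v : R := \sum_i u 0 i * v 0 i.

Lemma dotC u v : dot u v = dot v u.
Proof. by apply: eq_bigr => i _; rewrite mulrC. Qed.

Lemma dotDl u v w : dot (u + v) w = dot u w + dot v w.
Proof. by rewrite -big_split; apply: eq_bigr => i _; rewrite !mxE mulrDl. Qed.

Lemma dotZl (a : R) u w : dot (a *: u) w = a * dot u w.
Proof. by rewrite mulr_sumr; apply: eq_bigr => i _; rewrite !mxE mulrA. Qed.

Lemma dotNl u w : dot (- u) w = - dot u w.
Proof. by rewrite -scaleN1r dotZl mulN1r. Qed.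

Lemma dotBl u v w : dot (u - v) w = dot u w - dot v w.
Proof. by rewrite dotDl dotNl. Qed.

Lemma dot0l w : dot 0 w = 0.
Proof. by rewrite -(scale0r (0 : 'rV_D)) dotZl mul0r. Qed.

Lemma dotDr u v w : dot w (u + v) = dot w u + dot w v.
Proof. by rewrite dotC dotDl !(dotC w). Qed.

Lemma dotZr (a : R) u w : dot w (a *: u) = a * dot w u.
Proof. by rewrite dotC dotZl (dotC w). Qed.

Lemma dotNr u w : dot w (- u) = - dot w u.
Proof. by rewrite dotC dotNl (dotC w). Qed.

Lemma dotBr u v w : dot w (u - v) = dot w u - dot w v.
Proof. by rewrite dotDr dotNr. Qed.

Lemma dot_ge0 u : 0 <= dot u u.
Proof. by apply: sumr_ge0 => i _; rewrite -expr2 sqr_ge0. Qed.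

Lemma dot_CauchySchwarz u v : dot u v ^+ 2 <= dot u u * dot v v.
Proof.
have [v0|v0] := eqVneq (dot v v) 0.
  have -> : v = 0.
    apply/rowP => i; rewrite mxE; apply/eqP; rewrite -sqrf_eq0 expr2.
    move/eqP: v0; rewrite /dot psumr_eq0; last by move=> j _; rewrite -expr2 sqr_ge0.
    by move=> /allP/(_ i); rewrite mem_index_enum => /(_ isT).
  by rewrite dotC !dot0l mulr0 expr0n.
have vv : 0 < dot v v by rewrite lt0r v0 dot_ge0.
have := dot_ge0 (dot v v *: u - dot u v *: v).
rewrite dotBl !dotBr !dotZl !dotZr (dotC v u) => h.
rewrite -subr_ge0 -(pmulr_rge0 _ vv); apply: le_trans h _.
by rewrite le_eqVlt; apply/orP; left; apply/eqP; ring.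
Qed.

End Dot.

Lemma dot_mulmx (m n : nat) (P : 'M[R]_(m, n)) (c : 'rV_m) (v : 'rV_n) :
  dot c (v *m P^T) = dot (c *m P) v.
Proof.
have dotE k (u u' : 'rV[R]_k) : dot u u' = (u *m u'^T) 0 0.
  by rewrite mxE; apply: eq_bigr => i _; rewrite mxE.
by rewrite !dotE trmx_mul trmxK mulmxA.
Qed.

Lemma dot_delta (n : nat) (v : 'rV[R]_n) i : dot (delta_mx 0 i) v = v 0 i.
Proof.
rewrite /dot (bigD1 i)//= mxE !eqxx mul1r big1 ?addr0// => j ji.
by rewrite mxE (negbTE ji) andbF mul0r.
Qed.

(** An entropy bound in which a covering is given by the classes of a code, [b]
    bounds the natural logarithm of their number, and small diameter is expressed by a
    property [P] of the differences.  The centres of the covering need not be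
    mentioned, so that codes compose well. *)
Definition codable (V : zmodType) (S P : V -> Prop) (b : R) : Prop :=
  exists (J : finType) (code : V -> J), #|J|%:R <= expR b /\
    forall c c', S c -> S c' -> code c = code c' -> P (c - c').

Lemma codableW (V : zmodType) (S S' P P' : V -> Prop) b b' :
  (forall c, S' c -> S c) -> (forall c, P c -> P' c) -> b <= b' ->
  codable S P b -> codable S' P' b'.
Proof.
move=> SS PP bb [J [code [hJ hc]]]; exists J, code; split.
  by rewrite (le_trans hJ)// ler_expR.
by move=> c c' /SS Sc /SS Sc' e; apply: PP; apply: hc.
Qed.

Lemma codable_trivial (V : zmodType) (S P : V -> Prop) b : 0 <= b ->
  (forall c c', S c -> S c' -> P (c - c')) -> codable S P b.
Proof.
move=> b0 h; exists unit, (fun=> tt); split; last by move=> *; exact: h.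
by rewrite card_unit -expR0 ler_expR.
Qed.

(** The refined code of [c] consists of its code and of the code of the difference
    between [c] and a representative of its class. *)
Lemma codable_refine (V : zmodType) (S P S' P' : V -> Prop) b b' :
  codable S P b -> (forall c c', S c -> S c' -> P (c - c') -> S' (c - c')) ->
  codable S' P' b' -> codable S P' (b + b').
Proof.
move=> [J [f [hJ hf]]] h [J' [f' [hJ' hf']]].
have /choice[rep hrep] : forall j, exists r, (exists2 c, S c & f c = j) -> S r /\ f r = j.
  move=> j; have [[c Sc e]|no] := pselect (exists2 c, S c & f c = j).
    by exists c.
  by exists 0 => /no.
exists (J * J')%type, (fun c => (f c, f' (c - rep (f c)))); split.
  by rewrite card_prod natrM expRD ler_pM.
move=> c c' Sc Sc' [e]; rewrite -e => e'.
have [Sr fr] : S (rep (f c)) /\ f (rep (f c)) = f c by apply: hrep; exists c.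
rewrite (_ : c - c' = (c - rep (f c)) - (c' - rep (f c))); last first.
  by rewrite opprB subrKA.
have Sd x : S x -> f x = f c -> S' (x - rep (f c)).
  by move=> Sx ex; apply: (h _ _ Sx Sr); apply: (hf _ _ Sx Sr); rewrite fr.
by apply: hf'; [exact: Sd | exact: Sd | rewrite e'].
Qed.

Section Perceptron.
Variables (D : nat) (J : finType) (v : J -> 'rV[R]_D) (H tau : R).
Hypotheses (H0 : 0 < H) (tau0 : 0 < tau) (vH : forall j, dot (v j) (v j) <= H ^+ 2).

Let move (o : option (J * bool)) : 'rV[R]_D :=
  if o is Some (j, s) then ((-1) ^+ s * (tau / H ^+ 2)) *: v j else 0.

(** The perceptron argument.  As long as some inner product of the remainder [g] with
    some [v j] exceeds [tau], a step of length [tau / H ^+ 2] along [v j], with the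
    appropriate sign, decreases [dot g g * H ^+ 2] by at least [tau ^+ 2].  So the
    values [dot g (v j)] are known up to [tau] from a word of bounded length; letters
    [None] are idle steps. *)
Lemma perceptron_word k g : dot g g * H ^+ 2 < k.+1%:R * tau ^+ 2 ->
  exists w : k.-tuple (option (J * bool)),
    forall j, `|dot (g - \sum_(o <- w) move o) (v j)| <= tau.
Proof.
have H2 : 0 < H ^+ 2 by rewrite exprn_gt0.
elim: k g => [|k IH] g hg.
  exists [tuple] => j; rewrite big_nil subr0.
  rewrite -ler_sqr ?nnegrE ?(ltW tau0)// real_normK ?num_real//.
  rewrite (le_trans (dot_CauchySchwarz _ _))//.
  move: hg; rewrite mul1r => /ltW; apply: le_trans.
  by rewrite ler_wpM2l// dot_ge0.
have [ok|] := pselect (forall j, `|dot g (v j)| <= tau).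
  exists (nseq_tuple k.+1 None) => j.
  rewrite big1_seq ?subr0// => o /andP[_].
  by rewrite mem_nseq => /andP[_ /eqP ->].
move=> /existsNP[j /negP]; rewrite -ltNge => hj.
pose s := dot g (v j) < 0.
have hs : tau < (-1) ^+ s * dot g (v j).
  by move: hj; rewrite normrEsign.
have [|w hw] := IH (g - move (Some (j, s))).
  rewrite dotBl !dotBr /= !dotZl !dotZr (dotC (v j) g).
  set x := dot g (v j) in hs *; set e := (-1) ^+ s in hs *.
  have e2 : e ^+ 2 = 1 by rewrite /e sqrr_sign.
  have -> : dot g g - e * (tau / H ^+ 2) * x -
      (e * (tau / H ^+ 2) * x - e * (tau / H ^+ 2) * (e * (tau / H ^+ 2) * dot (v j) (v j)))
    = dot g g - 2 * (e * x) * (tau / H ^+ 2) + e ^+ 2 * (tau / H ^+ 2) ^+ 2 * dot (v j) (v j).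
    by ring.
  rewrite e2 mul1r.
  have -> : (dot g g - 2 * (e * x) * (tau / H ^+ 2)
      + (tau / H ^+ 2) ^+ 2 * dot (v j) (v j)) * H ^+ 2 =
    dot g g * H ^+ 2 - 2 * (e * x) * tau + tau ^+ 2 * (dot (v j) (v j) / H ^+ 2).
    by field; rewrite gt_eqF.
  have h1 : dot (v j) (v j) / H ^+ 2 <= 1 by rewrite ler_pdivrMr// mul1r.
  have h2 : tau ^+ 2 * (dot (v j) (v j) / H ^+ 2) <= tau ^+ 2.
    by rewrite ler_piMr// sqr_ge0.
  have h3 : tau * tau <= e * x * tau by rewrite ler_pM2r// ltW.
  move: hg; rewrite -natr1 mulrDl mul1r expr2 => hg.
  by move: h2; rewrite -natr1 mulrDl mul1r !expr2 -!mulrA => h2; lra.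
exists [tuple of Some (j, s) :: w] => i.
by rewrite big_cons opprD addrA hw.
Qed.

(** The alphabet has [2 * #|J| + 1] letters, whence an entropy which is logarithmic in
    the number of functionals and independent of the dimension. *)
Lemma codable_perceptron k : codable (fun g => dot g g * H ^+ 2 < k.+1%:R * tau ^+ 2)
  (fun h => forall j, `|dot h (v j)| <= 2 * tau) (k%:R * ln (2 * #|J|%:R + 1)).
Proof.
have /choice[f hf] : forall g, exists w : k.-tuple (option (J * bool)),
   dot g g * H ^+ 2 < k.+1%:R * tau ^+ 2 ->
   forall j, `|dot (g - \sum_(o <- w) move o) (v j)| <= tau.
  move=> g; have [h|h] := pselect (dot g g * H ^+ 2 < k.+1%:R * tau ^+ 2).
    by have [w hw] := perceptron_word h; exists w.
  by exists (nseq_tuple k None) => /h.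
exists (k.-tuple (option (J * bool))), f; split.
  rewrite card_tuple card_option card_prod card_bool expRM_natl lnK ?posrE.
    by rewrite -natr1 natrX -natr1 natrM mulrC.
  by rewrite ltr_wpDl// mulr_ge0.
move=> c c' hc hc' e j.
rewrite (_ : c - c' = (c - \sum_(o <- f c) move o) - (c' - \sum_(o <- f c') move o)).
  rewrite dotBl (le_trans (ler_normB _ _))//.
  by have := hf _ hc j; have := hf _ hc' j; lra.
by rewrite e opprB subrKA.
Qed.

End Perceptron.

(** The volume bound: coordinates are rounded to a multiple of [t * rho / D0].  Here
    [D0] is any positive bound of the dimension, which may itself be 0. *)
Lemma codable_grid (D D0 : nat) (t rho : R) : (D <= D0)%N -> (0 < D0)%N ->
  0 < t -> t <= 1 -> 0 < rho ->
  codable (fun c : 'rV[R]_D => dot c c <= rho ^+ 2)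
    (fun h => dot h h <= (t * rho) ^+ 2) (D0%:R * ln (5 * D0%:R / t)).
Proof.
move=> DD D00 t0 t1 r0.
have D0R : 1 <= D0%:R :> R by rewrite ler1n.
have D0p : 0 < D0%:R :> R by rewrite ltr0n.
have [h hE] : exists h, h = t * rho / D0%:R by exists (t * rho / D0%:R).
have h0 : 0 < h by rewrite hE divr_gt0// mulr_gt0.
pose M := Num.truncn (5 * D0%:R / t).
have Dt : 1 <= D0%:R / t by rewrite ler_pdivlMr// mul1r (le_trans t1).
have M5 : M%:R <= 5 * D0%:R / t by rewrite truncn_le// !mulr_ge0// invr_ge0 ltW.
have M5' : 5 * D0%:R / t < M.+1%:R by exact: truncnS_gt.
have M0 : (0 < M)%N.
  by rewrite -(ltr_nat R); move: M5'; rewrite -natr1 -mulrA; lra.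
pose f (c : 'rV[R]_D) : {ffun 'I_D -> 'I_M.-1.+1} :=
  [ffun i => inord (Num.truncn ((c 0 i + rho) / h))].
exists {ffun 'I_D -> 'I_M.-1.+1}, f; split.
  rewrite card_ffun !card_ord prednK// natrX.
  rewrite expRM_natl lnK ?posrE; last by rewrite divr_gt0// mulr_gt0.
  rewrite (@le_trans _ _ ((5 * D0%:R / t) ^+ D))//.
    by rewrite lerXn2r ?nnegrE ?ler0n// (le_trans _ M5).
  rewrite ler_weXn2l//; lra.
move=> c c' hc hc' e.
have coord (x : 'rV[R]_D) i : dot x x <= rho ^+ 2 -> `|x 0 i| <= rho.
  move=> hx; rewrite -ler_sqr ?nnegrE ?(ltW r0)// real_normK ?num_real// (le_trans _ hx)//.
  rewrite /dot (bigD1 i)//= -expr2 lerDl sumr_ge0// => j _.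
  by rewrite -expr2 sqr_ge0.
have small i : `|c 0 i - c' 0 i| <= h.
  have /ffunP/(_ i) := e; rewrite !ffunE => /(congr1 (@nat_of_ord _)).
  have bd (x : 'rV[R]_D) : dot x x <= rho ^+ 2 ->
     0 <= (x 0 i + rho) / h /\ (Num.truncn ((x 0 i + rho)%R / h)%R < M.-1.+1)%N.
    move=> hx; have := coord x i hx; rewrite ler_norml => /andP[x1 x2].
    have x0 : 0 <= (x 0 i + rho) / h by rewrite divr_ge0 ?(ltW h0)//; lra.
    split => //; rewrite prednK// -(ltr_nat R) (@le_lt_trans _ _ ((x 0 i + rho) / h)) ?truncn_le//.
    rewrite (@le_lt_trans _ _ (2 * D0%:R / t))//.
      rewrite ler_pdivrMr//; have -> : 2 * D0%:R / t * h = 2 * rho.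
        by rewrite hE; field; rewrite !gt_eqF.
      lra.
    by move: M5'; rewrite -natr1 -!mulrA; lra.
  have [c0 cM] := bd _ hc; have [c0' cM'] := bd _ hc'.
  rewrite !inordK// => ee.
  have /andP[a1 a2] := truncn_itv c0; have /andP[b1 b2] := truncn_itv c0'.
  rewrite -ee in b1 b2.
  move: a1 a2 b1 b2; move: (Num.truncn _) => n.
  rewrite !ler_pdivlMr// !ltr_pdivrMr// -(natr1 n) mulrDl mul1r.
  by move: (n%:R * h) => z *; rewrite ler_norml; lra.
have -> : t * rho = D0%:R * h by rewrite hE mulrCA divff ?mulr1// gt_eqF.
apply: (@le_trans _ _ (\sum_(i < D) h ^+ 2)).
  apply: ler_sum => i _; rewrite !mxE -expr2 -real_normK ?num_real//.
  by rewrite lerXn2r ?nnegrE// ltW.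
rewrite sumr_const card_ord -[leLHS]mulr_natl exprMn ler_wpM2r ?sqr_ge0//.
rewrite (@le_trans _ _ D0%:R) ?ler_nat//.
by rewrite expr2 ler_peMl.
Qed.

End Codes.

(** * Halving a sample *)

Section Halving.
Variable R : realType.

Definition avg (T : Type) (n : nat) (x : nat -> T) (g : T -> R) : R :=
  n%:R^-1 * \sum_(i < n) g (x i).

Lemma sum_double (f : nat -> R) n :
  \sum_(i < n.*2) f i = \sum_(i < n) (f i.*2 + f i.*2.+1).
Proof.
elim: n => [|n IH]; first by rewrite !big_ord0.
by rewrite doubleS !big_ord_recr /= IH addrA.
Qed.

Lemma avg_halve (T : Type) n (x : nat -> T) (s : nat -> bool) g : (0 < n)%N ->
  avg n (fun i => x (i.*2 + s i)%N) g =
  avg n.*2 x g + (2 * n%:R)^-1 *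
    signed_sum s n (fun i => g (x i.*2) - g (x i.*2.+1)).
Proof.
move=> n0; have nn : n%:R != 0 :> R by rewrite pnatr_eq0 -lt0n.
rewrite /avg (sum_double (fun i => g (x i))) /signed_sum -muln2 natrM mulrC.
rewrite (mulrC 2) -mulrDr -big_split /= mulr_suml mulr_sumr.
apply: eq_bigr => i _; case: (s i); rewrite ?addn1 ?addn0 ?expr1 ?expr0; by field.
Qed.

(** Iterated halving of a sample of size [m * 2 ^ s].  By [avg_halve], keeping one
    point of each pair changes the averages by a signed sum of differences.  The signs
    for [m * 2 ^ k] points need to be supplied only for samples whose averages are
    within 1 of the reference values, an a priori bound that the errors made so far
    preserve. *)
Lemma halving (T : Type) (G : (T -> R) -> Prop) (ref : (T -> R) -> R) (m : nat)
    (e : nat -> R) : (0 < m)%N -> (forall k, 0 <= e k) ->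
  (forall k (x : nat -> T),
     (forall g, G g -> `|avg (m * 2 ^ k).*2 x g - ref g| <= 1) ->
     exists s, forall g, G g ->
      `|signed_sum s (m * 2 ^ k) (fun i => g (x i.*2) - g (x i.*2.+1))|
         <= 2 * (m * 2 ^ k)%:R * e k) ->
  forall s (x : nat -> T) eta,
   (forall g, G g -> `|avg (m * 2 ^ s) x g - ref g| <= eta) ->
   eta + \sum_(k < s) e k <= 1 ->
   exists y, forall g, G g -> `|avg m y g - ref g| <= eta + \sum_(k < s) e k.
Proof.
move=> m0 e0 step; elim=> [|s IH] x eta hx h1.
  exists x => g Gg; rewrite big_ord0 addr0.
  by have := hx g Gg; rewrite expn0 muln1.
move: h1 hx; rewrite big_ord_recr /= expnS mulnCA mul2n => h1 hx.
have n0 : (0 < m * 2 ^ s)%N by rewrite muln_gt0 m0 expn_gt0.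
have n0R : 0 < (m * 2 ^ s)%:R :> R by rewrite ltr0n.
have [|sg hsg] := step s x.
  move=> g Gg; apply: le_trans (hx g Gg) (le_trans _ h1).
  by rewrite lerDl addr_ge0// sumr_ge0.
have [||y hy] := IH (fun i => x (i.*2 + sg i)%N) (eta + e s).
- move=> g Gg; rewrite avg_halve// addrAC (le_trans (ler_normD _ _))// lerD ?hx//.
  rewrite normrM gtr0_norm ?invr_gt0 ?mulr_gt0// ler_pdivrMl ?mulr_gt0//.
  exact: hsg.
- by rewrite addrAC -addrA.
- exists y => g Gg; rewrite (le_trans (hy g Gg))//.
  by rewrite [leLHS]addrAC addrA.
Qed.

Lemma sum_truncn_approx (T : finType) (w : T -> R) (n : nat) :
  (forall t, 0 <= w t) -> \sum_t w t = 1 ->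
  (\sum_t Num.truncn (w t * n%:R) <= n)%N /\
  n%:R - (\sum_t Num.truncn (w t * n%:R))%N%:R <= #|T|%:R :> R.
Proof.
move=> w0 w1.
have h t : (Num.truncn (w t * n%:R))%:R <= w t * n%:R < (Num.truncn (w t * n%:R))%:R + 1.
  by rewrite natr1 truncn_itv// mulr_ge0.
have nE : n%:R = \sum_t w t * n%:R :> R by rewrite -mulr_suml w1 mul1r.
split.
  rewrite -(ler_nat R) natr_sum [leRHS]nE; apply: ler_sum => t _.
  by have /andP[] := h t.
rewrite natr_sum [X in X - _]nE -sumrB -sum1_card natr_sum; apply: ler_sum => t _.
by have /andP[_] := h t; lra.
Qed.

(** The point [t] is repeated [Num.truncn (w t * n)] times, and the sample is completed
    by copies of [t0]. *)
Lemma avg_approx (T : finType) (t0 : T) (w : T -> R) (G : (T -> R) -> Prop)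
    (Gb eta : R) (m : nat) :
  (forall t, 0 <= w t) -> \sum_t w t = 1 ->
  (forall g, G g -> forall t, `|g t| <= Gb) -> 0 < eta -> (0 < m)%N ->
  exists s x, forall g, G g -> `|avg (m * 2 ^ s) x g - \sum_t w t * g t| <= eta.
Proof.
move=> w0 w1 hG eta0 m0.
have [[g0 Gg0]|noG] := pselect (exists g, G g); last first.
  by exists 0%N, (fun=> t0) => g Gg; case: noG; exists g.
have Gb0 : 0 <= Gb by apply: le_trans (hG _ Gg0 t0).
pose B := 2 * #|T|%:R * Gb / eta.
have B0 : 0 <= B by rewrite divr_ge0 ?(ltW eta0)// !mulr_ge0.
pose s := (Num.truncn B).+1.
pose n := (m * 2 ^ s)%N.
have n0 : (0 < n)%N by rewrite muln_gt0 m0 expn_gt0.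
have nB : B <= n%:R.
  apply/ltW; apply: (lt_le_trans (truncnS_gt B)); rewrite ler_nat -/s /n.
  by rewrite (leq_trans (ltnW (ltn_expl s (ltnSn 1))))// leq_pmull.
pose c t := Num.truncn (w t * n%:R).
have [hc1 hc2] := sum_truncn_approx n w0 w1.
pose L := flatten [seq nseq (c t) t | t <- enum T].
have szL : size L = (\sum_t c t)%N.
  rewrite size_flatten /shape -map_comp sumnE big_map big_enum.
  by apply: eq_bigr => t _; rewrite /= size_nseq.
exists s, (nth t0 L) => g Gg; rewrite -/n /avg.
have nR : 0 < n%:R :> R by rewrite ltr0n.
have -> : \sum_(i < n) g (nth t0 L i) =
   \sum_t (c t)%:R * g t + (n%:R - (\sum_t c t)%N%:R) * g t0.
  rewrite -(big_mkord predT (fun i => g (nth t0 L i))).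
  rewrite (@big_cat_nat _ _ _ (size L))//=; last by rewrite szL.
  congr (_ + _).
    rewrite -(big_nth t0 predT g) big_flatten /= big_map big_enum /=.
    by apply: eq_bigr => t _; rewrite big_nseq iter_addr_0 mulr_natl.
  rewrite (eq_big_nat _ _ (F2 := fun=> g t0)); last first.
    by move=> i /andP[hi _]; rewrite nth_default.
  by rewrite sumr_const_nat szL -[LHS]mulr_natl natrB.
have nE : \sum_t w t * g t = n%:R^-1 * \sum_t (w t * n%:R) * g t.
  by rewrite mulr_sumr; apply: eq_bigr => t _; field; rewrite gt_eqF.
rewrite nE -mulrBr normrM gtr0_norm ?invr_gt0// ler_pdivrMl//.
rewrite addrAC -sumrB.
apply: (@le_trans _ _ (2 * #|T|%:R * Gb)); last first.
  by rewrite -ler_pdivrMr.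
rewrite -mulrA mulr_natl mulr2n (le_trans (ler_normD _ _))// lerD//.
  rewrite (le_trans (ler_norm_sum _ _ _))//.
  rewrite -sum1_card natr_sum mulr_suml; apply: ler_sum => t _.
  rewrite -mulrBl normrM ler_pM// ?hG//.
  have /andP[] : (c t)%:R <= w t * n%:R < (c t)%:R + 1.
    by rewrite natr1 truncn_itv// mulr_ge0.
  by move=> *; rewrite ler_norml; lra.
rewrite normrM ler_pM// ?hG// ger0_norm//.
by rewrite subr_ge0 ler_nat.
Qed.

End Halving.

(** * Powers, averages and moduli *)

Section Powers.
Variable R : realType.
Implicit Types x y r s : R.

Lemma powR_le_base r x y : 0 <= r -> 0 <= x -> x <= y -> x `^ r <= y `^ r.
Proof. by move=> r0 x0 xy; apply: ge0_ler_powR => //; rewrite nnegrE ?(le_trans x0). Qed.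

(** Young's inequality for [x * 1] with the exponents [s] and [s / (s - 1)]. *)
Lemma powR_Bernoulli s x : 1 <= s -> 0 <= x -> 1 - s * (1 - x) <= x `^ s.
Proof.
rewrite le_eqVlt => /orP[/eqP <-|s1] x0; first by rewrite powRr1// mul1r subKr.
have := @conjugate_powR R x 1 s (s / (s - 1)) x0 ler01.
have s10 : 0 < s - 1 by rewrite subr_gt0.
have s0 : 0 < s by rewrite (lt_trans _ s1).
rewrite s0 divr_gt0// => /(_ isT isT).
rewrite mulr1 powR1 invf_div mul1r => h.
have {}h : x <= x `^ s / s + (s - 1) / s by apply: h; field; rewrite gt_eqF.
move: h; rewrite -mulrDl ler_pdivlMr// => h; lra.
Qed.

(** The mean value estimate [y ^ s - x ^ s <= s * (y - x) * y ^ (s - 1)], multiplied by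
    [y] to include [y = 0]. *)
Lemma powR_sub_le s x y : 1 <= s -> 0 <= x -> x <= y ->
  y * (y `^ s - x `^ s) <= s * (y - x) * y `^ s.
Proof.
move=> s1 x0 xy; have [y0|y0] := leP y 0.
  have -> : y = 0 by apply/eqP; rewrite eq_le y0 (le_trans x0).
  have -> : x = 0 by apply/eqP; rewrite eq_le x0 (le_trans xy).
  by rewrite !subrr mul0r mulr0 mul0r.
have yr : y != 0 by rewrite gt_eqF.
have := powR_Bernoulli s1 (divr_ge0 x0 (ltW y0)).
rewrite -(ler_pM2r (powR_gt0 s y0)) -powRM ?divr_ge0 ?(ltW y0)// divfK//.
rewrite -(ler_pM2l y0) => h; rewrite -subr_ge0; move: h; rewrite -subr_ge0 => h.
apply: le_trans h _; rewrite le_eqVlt; apply/orP; left; apply/eqP.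
by field.
Qed.

Lemma powR_lipschitz s H x y : 1 <= s -> s <= 2 -> 1 <= H ->
  0 <= x -> x <= H -> 0 <= y -> y <= H -> `|y `^ s - x `^ s| <= 2 * H * `|y - x|.
Proof.
move=> s1 s2 H1; wlog xy : x y / x <= y.
  move=> h x0 xH y0 yH; have [/h|/ltW /h] := leP x y; first exact.
  by rewrite distrC (distrC x); exact.
move=> x0 xH y0 yH; have s0 : 0 <= s by lra.
rewrite !ger0_norm ?subr_ge0 ?powR_le_base//.
move: y0; rewrite le_eqVlt => /orP[/eqP y0|y0].
  have -> : x = 0 by apply/eqP; rewrite eq_le x0 (le_trans xy)// -y0.
  by rewrite -y0 !subrr mulr0.
have h := powR_sub_le s1 x0 xy.
have ys : y `^ s <= H * y.
  have -> : y `^ s = y * y `^ (s - 1) by rewrite mulr_powRB1 ?(ltW y0)//; lra.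
  rewrite mulrC ler_pM2r//.
  apply: (@le_trans _ _ (H `^ (s - 1))); first by rewrite powR_le_base// ?(ltW y0)//; lra.
  by apply: ler1_powR => //; lra.
rewrite -(ler_pM2l y0) (le_trans h)//.
apply: (@le_trans _ _ (2 * (y - x) * (H * y))); last by rewrite le_eqVlt; apply/orP; left; apply/eqP; ring.
by rewrite ler_pM ?powR_ge0 ?ler_pM ?mulr_ge0 ?subr_ge0//; lra.
Qed.

Lemma sqr_le_powR H r x : 1 <= r -> r <= 2 -> 0 <= x -> x <= H ->
  x ^+ 2 <= H `^ (2 - r) * x `^ r.
Proof.
move=> r1 r2; rewrite le_eqVlt => /orP[/eqP <- _|x0 xH].
  by rewrite expr0n mulr_ge0 ?powR_ge0.
have -> : x ^+ 2 = x `^ (2 - r) * x `^ r.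
  by rewrite -powRD ?subrK ?powR_mulrn ?(ltW x0)// (gt_eqF x0) implybT.
by rewrite ler_wpM2r ?powR_ge0// powR_le_base ?(ltW x0)//; lra.
Qed.

Lemma sqrt_le_of_sqr (x y : R) : 0 <= y -> x <= y ^+ 2 -> Num.sqrt x <= y.
Proof.
by move=> y0 h; apply: (le_trans (ler_wsqrtr h)); rewrite sqrtr_sqr ger0_norm.
Qed.

Lemma sum_geometric_le4 n : \sum_(k < n) (3 / 4) ^+ k <= 4 :> R.
Proof.
have -> : \sum_(k < n) (3 / 4) ^+ k = 4 - 4 * (3 / 4) ^+ n :> R.
  elim: n => [|n IH]; first by rewrite big_ord0 expr0; lra.
  by rewrite big_ord_recr /= IH exprS; lra.
by rewrite gerBl mulr_ge0// exprn_ge0//; lra.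
Qed.

Lemma ln2_bounds : 0 < ln 2 :> R /\ ln 2 <= 1 :> R.
Proof.
split; first by rewrite ln_gt0// ltr1n.
by have := @le_ln1Dx R 1; rewrite -[1 + 1]/(2 : R); apply; lra.
Qed.

Lemma ln_le_log2 (x : R) : 1 <= x -> ln x <= log2 x.
Proof.
have [l0 l1] := ln2_bounds.
by move=> x1; rewrite /log2 ler_pdivlMr// ler_piMr// ln_ge0.
Qed.

Lemma log2_ge1 (x : R) : 2 <= x -> 1 <= log2 x.
Proof.
have [l0 l1] := ln2_bounds.
move=> x2; rewrite /log2 ler_pdivlMr// mul1r ler_ln// posrE//.
by rewrite (lt_le_trans _ x2).
Qed.

Lemma exists_pow2 (z : R) : 1 <= z -> exists j, z <= 2 ^+ j /\ 2 ^+ j <= 2 * z.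
Proof.
move=> z1.
have ex : exists j, z <= 2 ^+ j :> R.
  exists (Num.truncn z).+1; apply/ltW/(lt_trans (truncnS_gt z)).
  by rewrite -natrX ltr_nat ltn_expl.
case: (ex_minnP ex) => j zj jmin; exists j; split => //.
case: j zj jmin => [|j] zj jmin; first by rewrite expr0; lra.
rewrite exprS ler_wpM2l//; rewrite leNgt; apply/negP => /ltW h.
by have := jmin _ h; rewrite ltnn.
Qed.

End Powers.

Section Averages.
Variables (R : realType) (T : Type).

Lemma le_avg n (x : nat -> T) (f g : T -> R) :
  (forall t, f t <= g t) -> avg n x f <= avg n x g.
Proof. by move=> h; rewrite ler_wpM2l ?invr_ge0// ler_sum. Qed.

Lemma avg_ge0 n (x : nat -> T) (f : T -> R) : (forall t, 0 <= f t) -> 0 <= avg n x f.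
Proof. by move=> h; rewrite mulr_ge0 ?invr_ge0// sumr_ge0. Qed.

Lemma avgZ n (x : nat -> T) (k : R) (f : T -> R) :
  avg n x (fun t => k * f t) = k * avg n x f.
Proof. by rewrite /avg -mulr_sumr mulrCA. Qed.

Lemma avg_const n (x : nat -> T) (k : R) : (0 < n)%N -> avg n x (fun=> k) = k.
Proof.
move=> n0; rewrite /avg sumr_const card_ord -[k *+ n]mulr_natl mulKf//.
by rewrite pnatr_eq0 -lt0n.
Qed.

Lemma avg_dist n (x : nat -> T) (f g : T -> R) (d : R) : (0 < n)%N ->
  (forall t, `|f t - g t| <= d) -> `|avg n x f - avg n x g| <= d.
Proof.
move=> n0 h; rewrite -(avg_const x d n0) /avg -mulrBr -sumrB normrM ger0_norm ?invr_ge0//.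
by rewrite ler_wpM2l ?invr_ge0// (le_trans (ler_norm_sum _ _ _))// ler_sum.
Qed.

End Averages.

Lemma sum_weight_dist (R : realType) (T : finType) (w f g : T -> R) (d : R) :
  (forall t, 0 <= w t) -> \sum_t w t = 1 ->
  (forall t, `|f t - g t| <= d) -> `|\sum_t w t * f t - \sum_t w t * g t| <= d.
Proof.
move=> w0 w1 h; rewrite -sumrB (le_trans (ler_norm_sum _ _ _))//.
rewrite -[leRHS]mul1r -w1 mulr_suml; apply: ler_sum => t _.
by rewrite -mulrBr normrM ger0_norm// ler_wpM2l.
Qed.

Lemma norm2_dist_le (R : realType) (u v u' v' : R) :
  Num.sqrt (u ^+ 2 + v ^+ 2) <= Num.sqrt (u' ^+ 2 + v' ^+ 2) + (`|u - u'| + `|v - v'|).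
Proof.
have s0 : 0 <= Num.sqrt (u' ^+ 2 + v' ^+ 2) by exact: sqrtr_ge0.
have s2 : Num.sqrt (u' ^+ 2 + v' ^+ 2) ^+ 2 = u' ^+ 2 + v' ^+ 2.
  by rewrite sqr_sqrtr// addr_ge0// sqr_ge0.
have k (y z : R) : y ^+ 2 <= z ^+ 2 -> 0 <= z -> `|y| <= z.
  by move=> yz z0; rewrite -ler_sqr ?nnegrE// real_normK ?num_real.
have h1 : `|u'| <= Num.sqrt (u' ^+ 2 + v' ^+ 2) by apply: k => //; rewrite s2 lerDl sqr_ge0.
have h2 : `|v'| <= Num.sqrt (u' ^+ 2 + v' ^+ 2) by apply: k => //; rewrite s2 lerDr sqr_ge0.
apply: sqrt_le_of_sqr; first by rewrite !addr_ge0.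
rewrite sqrrD s2.
have h3 : u' * (u - u') <= Num.sqrt (u' ^+ 2 + v' ^+ 2) * `|u - u'|.
  by rewrite (le_trans (ler_norm _))// normrM ler_wpM2r.
have h4 : v' * (v - v') <= Num.sqrt (u' ^+ 2 + v' ^+ 2) * `|v - v'|.
  by rewrite (le_trans (ler_norm _))// normrM ler_wpM2r.
have h5 : (u - u') ^+ 2 + (v - v') ^+ 2 <= (`|u - u'| + `|v - v'|) ^+ 2.
  rewrite [leRHS]sqrrD !real_normK ?num_real// [leRHS]addrAC.
  by rewrite lerDl mulrn_wge0// mulr_ge0.
move: h3 h4 h5; rewrite mulr2n; move: (Num.sqrt _) `|u - u'| `|v - v'| => S y z.
rewrite !expr2 => *; lra.
Qed.

Section Modulus.
Variables (R : realType) (T : Type) (D : nat) (a b : T -> 'rV[R]_D).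

(** The modulus of the complex number with real part [dot c (a x)] and imaginary part
    [dot c (b x)].  Both real functions, with [b = 0], and complex functions have moduli
    of this form, with real coefficients [c]. *)
Definition modf (c : 'rV[R]_D) (x : T) : R :=
  Num.sqrt (dot c (a x) ^+ 2 + dot c (b x) ^+ 2).

Lemma modf_ge0 c x : 0 <= modf c x. Proof. exact: sqrtr_ge0. Qed.

Lemma sqr_modf c x : modf c x ^+ 2 = dot c (a x) ^+ 2 + dot c (b x) ^+ 2.
Proof. by rewrite sqr_sqrtr// addr_ge0// sqr_ge0. Qed.

Lemma modfZ k c x : 0 <= k -> modf (k *: c) x = k * modf c x.
Proof.
move=> k0; rewrite /modf !dotZl !exprMn -mulrDr sqrtrM ?sqr_ge0//.
by rewrite sqrtr_sqr ger0_norm.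
Qed.

Lemma modfN c x : modf (- c) x = modf c x.
Proof. by rewrite /modf !dotNl !sqrrN. Qed.

Lemma modf0 x : modf 0 x = 0.
Proof. by rewrite /modf !dot0l expr0n addr0 sqrtr0. Qed.

Lemma dot_le_modf c x : `|dot c (a x)| <= modf c x /\ `|dot c (b x)| <= modf c x.
Proof.
by split; rewrite -ler_sqr ?nnegrE ?modf_ge0// sqr_modf real_normK ?num_real//;
  rewrite ?lerDl ?lerDr sqr_ge0.
Qed.

Lemma modf_le_dot c x : modf c x <= `|dot c (a x)| + `|dot c (b x)|.
Proof.
rewrite -ler_sqr ?nnegrE ?modf_ge0 ?addr_ge0// sqr_modf.
rewrite -(real_normK (num_real (dot c (a x)))) -(real_normK (num_real (dot c (b x)))).
by rewrite sqrrD addrAC lerDl mulrn_wge0// mulr_ge0.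
Qed.

Lemma modfD c c' x : modf (c + c') x <= modf c x + modf c' x.
Proof.
rewrite -ler_sqr ?nnegrE ?modf_ge0 ?addr_ge0 ?modf_ge0// sqrrD !sqr_modf.
rewrite !dotDl.
set u := dot c (a x); set v := dot c (b x); set u' := dot c' (a x); set v' := dot c' (b x).
have : u * u' + v * v' <= modf c x * modf c' x.
  apply: le_trans (ler_norm _) _.
  rewrite -ler_sqr ?nnegrE ?mulr_ge0 ?modf_ge0//.
  rewrite exprMn !sqr_modf real_normK ?num_real// -/u -/v -/u' -/v' -subr_ge0.
  have -> : (u ^+ 2 + v ^+ 2) * (u' ^+ 2 + v' ^+ 2) - (u * u' + v * v') ^+ 2
    = (u * v' - v * u') ^+ 2 by ring.
  exact: sqr_ge0.
by move: (modf c x * _) => z; lra.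
Qed.

Lemma modfB c c' x : modf (c - c') x <= modf c x + modf c' x.
Proof. by rewrite -(modfN c') modfD. Qed.

Lemma modf_dist c c' x : `|modf c x - modf c' x| <= modf (c - c') x.
Proof.
have h1 : modf c x <= modf (c - c') x + modf c' x.
  by rewrite -{1}(subrK c' c) modfD.
have h2 : modf c' x <= modf (c - c') x + modf c x.
  by rewrite -(modfN (c - c')) opprB -{1}(subrK c c') modfD.
by rewrite ler_norml; apply/andP; split; lra.
Qed.

End Modulus.

(** * Coarse sampling sets *)

(** The space of functions after discretization: the coordinates [c] are orthonormal
    up to a factor 2 with respect to the weights [w], and [frame_upper] is the
    inequality between the uniform and the quadratic norm.  The positive number [D0]
    stands for the dimension; its bound by [4 * H ^+ 2] comes from
    summing [frame_lower] over an orthonormal basis. *)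
Record frame (R : realType) (T : finType) (D : nat) (a b : T -> 'rV[R]_D)
    (w : T -> R) (H : R) (D0 : nat) : Prop := {
  frame_w_ge0 : forall t, 0 <= w t ;
  frame_w_sum : \sum_t w t = 1 ;
  frame_H_ge1 : 1 <= H ;
  frame_upper : forall c x, modf a b c x ^+ 2 <= H ^+ 2 * dot c c ;
  frame_lower : forall c, dot c c <= 2 * \sum_t w t * modf a b c t ^+ 2 ;
  frame_D_le : (D <= D0)%N ;
  frame_D0_gt0 : (0 < D0)%N ;
  frame_D0_le : D0%:R <= 4 * H ^+ 2
}.

Lemma dist_le_range (R : realType) (x y k : R) :
  0 <= x <= k -> 0 <= y <= k -> `|x - y| <= k.
Proof. by move=> /andP[? ?] /andP[? ?]; rewrite ler_norml; apply/andP; split; lra. Qed.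

Lemma dist_le_four (R : realType) (x x' y y' d s : R) :
  `|x' - x| <= d -> `|y' - y| <= d -> `|x - y| <= d + s -> s <= d ->
  `|x' - y'| <= 4 * d.
Proof.
rewrite !ler_norml => /andP[? ?] /andP[? ?] /andP[? ?] ?.
by apply/andP; split; lra.
Qed.

Section CoarsePoints.
Variables (R : realType) (T : finType) (t0 : T) (D : nat) (a b : T -> 'rV[R]_D).
Variables (w : T -> R) (H : R) (D0 : nat) (r : R).
Hypothesis fr : frame a b w H D0.
Hypotheses (r1 : 1 <= r) (r2 : r <= 2).
Local Notation F := (modf a b).

Let H1 := frame_H_ge1 fr.
Let H0 : 0 < H. Proof. by apply: lt_le_trans H1. Qed.

Lemma frame_dot_le x : dot (a x) (a x) <= H ^+ 2 /\ dot (b x) (b x) <= H ^+ 2.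
Proof.
have key (u : 'rV[R]_D) : dot u u <= F u x -> dot u u <= H ^+ 2.
  move=> h; have := dot_ge0 u; rewrite le_eqVlt => /orP[/eqP <-|u0].
    by rewrite exprn_ge0// ltW.
  rewrite -(ler_pM2r u0) -expr2; apply: le_trans (frame_upper fr u x).
  by rewrite ler_sqr ?nnegrE ?modf_ge0 ?dot_ge0.
split; apply: key; apply: le_trans (ler_norm _) _.
  exact: (dot_le_modf a b _ x).1.
exact: (dot_le_modf a b _ x).2.
Qed.

Lemma frame_modf_le c x k : 0 <= k -> dot c c <= k ^+ 2 -> F c x <= H * k.
Proof.
move=> k0 h; rewrite -ler_sqr ?nnegrE ?modf_ge0 ?mulr_ge0 ?(ltW H0)//.
by rewrite (le_trans (frame_upper fr c x))// exprMn ler_wpM2l// sqr_ge0.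
Qed.

Let exponent (e : bool) : R := if e then 2 else r.

(** A sample of size polynomial in [H] on which the moments of order [r] and 2 of all
    [F c] with [dot c c <= 1] are correct up to [(4 * H)^-1].  At this size a crude union
    bound over a grid is enough: the grid has at most [expR B] points, with [B]
    of order [H ^+ 7], and the increments are at most [H ^+ 2]. *)
Lemma coarse_points_additive :
  exists (m1 : nat) (y : nat -> T), [/\ (0 < m1)%N, m1%:R <= 2 ^+ 26 * H ^+ 13 &
    forall c, dot c c <= 1 -> forall e : bool,
     `|avg m1 y (fun t => F c t `^ exponent e) -
       \sum_t w t * F c t `^ exponent e| <= (4 * H)^-1].
Proof.
have D00 : (0 < D0)%N := frame_D0_gt0 fr.
have DD : (D <= D0)%N := frame_D_le fr.
have D0H := frame_D0_le fr.
have D01 : 1 <= D0%:R :> R by rewrite ler1n.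
have w0 := frame_w_ge0 fr; have w1 := frame_w_sum fr.
have e1 e : 1 <= exponent e by case: e => //=; lra.
have e2 e : exponent e <= 2 by case: e => //=.
have e0 e : 0 <= exponent e by rewrite (le_trans _ (e1 e)).
have H31 : 1 <= H ^+ 3 by rewrite exprn_ege1.
(* Moving c by t changes the powers of F c by at most 2 * H * (H * t) = (16 * H)^-1. *)
pose t : R := (32 * H ^+ 3)^-1.
have t_gt0 : 0 < t by rewrite invr_gt0 mulr_gt0// exprn_gt0.
have t_le1 : t <= 1 by rewrite invf_le1 ?mulr_gt0 ?exprn_gt0//; lra.
pose B : R := D0%:R * ln (5 * D0%:R / t).
have B0 : 0 <= B.
  rewrite mulr_ge0// ln_ge0// ler_pdivlMr// mul1r (le_trans t_le1)//.
  lra.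
have B2 : B + 2 <= 2 ^+ 12 * H ^+ 7.
  have h1 : ln (5 * D0%:R / t) <= 640 * H ^+ 5.
    apply: (@le_trans _ _ (5 * D0%:R / t)); last first.
      rewrite invrK; have -> : 640 * H ^+ 5 = 5 * (4 * H ^+ 2) * (32 * H ^+ 3) by ring.
      by rewrite ler_wpM2r ?mulr_ge0 ?exprn_ge0 ?(ltW H0)// ler_wpM2l.
    by apply/ltW/ln_sublinear; rewrite divr_gt0// mulr_gt0// (lt_le_trans _ D01).
  have h2 : B <= 4 * H ^+ 2 * (640 * H ^+ 5).
    rewrite ler_pM// ln_ge0// ler_pdivlMr// mul1r (le_trans t_le1)//; lra.
  have h3 : 1 <= H ^+ 7 by rewrite exprn_ege1.
  move: h2; have -> : 4 * H ^+ 2 * (640 * H ^+ 5) = 2560 * H ^+ 7 by ring.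
  have -> : 2 ^+ 12 = 4096 :> R by ring.
  lra.
have [J [code [hJ hcode]]] := @codable_grid R D D0 t 1 DD D00 t_gt0 t_le1 ltr01.
rewrite -/B in hJ; rewrite mulr1 expr1n in hcode.
have /choice[rep hrep] : forall j, exists c, dot c c <= 1 /\
    ((exists2 c', dot c' c' <= 1 & code c' = j) -> code c = j).
  move=> j; have [[c hc e]|no] := pselect (exists2 c', dot c' c' <= 1 & code c' = j).
    by exists c.
  by exists 0; split; [rewrite dot0l | move=> /no].
pose G g := exists (j : J) (e : bool), g = (fun x => F (rep j) x `^ exponent e).
have FH c x : dot c c <= 1 -> F c x <= H.
  by move=> hc; rewrite -[H]mulr1 frame_modf_le// expr1n.
have GH g : G g -> forall x, 0 <= g x <= H ^+ 2.
  move=> [j [e ->]] x; rewrite powR_ge0/=.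
  have h := FH _ x (hrep j).1.
  apply: (@le_trans _ _ (H `^ exponent e)); first by rewrite powR_le_base ?modf_ge0.
  by rewrite -(powR_mulrn 2 (ltW H0)) ler_powR.
have GH' g : G g -> forall x, `|g x| <= H ^+ 2.
  by move=> Gg x; have /andP[h1 h2] := GH g Gg x; rewrite ger0_norm.
pose m1 := (Num.truncn (2 ^+ 13 * H ^+ 6 * (B + 2))).+1.
have m1B : 2 ^+ 13 * H ^+ 6 * (B + 2) <= m1%:R by exact/ltW/truncnS_gt.
have m10 : (0 < m1)%N by [].
have [s [x hx]] := @avg_approx R T t0 w G (H ^+ 2) (16 * H)^-1 m1 w0 w1 GH'
   (ltac:(rewrite invr_gt0 mulr_gt0//)) m10.
(* The true decay is 2 ^- (k / 2); the ratio 3 / 4 is a rational upper bound. *)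
pose e k : R := (64 * H)^-1 * (3 / 4) ^+ k.
have sume n : \sum_(k < n) e k <= (16 * H)^-1.
  rewrite -mulr_sumr; apply: (@le_trans _ _ ((64 * H)^-1 * 4)).
    by rewrite ler_wpM2l ?invr_ge0 ?mulr_ge0 ?(ltW H0)// sum_geometric_le4.
  by rewrite le_eqVlt; apply/orP; left; apply/eqP; field; rewrite gt_eqF.
have iH k : 1 <= k -> (k * H)^-1 <= k^-1.
  move=> k1; have k0 : 0 < k by lra.
  by rewrite lef_pV2 ?posrE ?mulr_gt0// ler_peMr// ltW.
have [|k z hz||y hy] := @halving R T G (fun g => \sum_t w t * g t) m1 e m10 _ _ s x
   (16 * H)^-1 hx.
- by move=> k; rewrite mulr_ge0// ?invr_ge0 ?mulr_ge0 ?(ltW H0)// exprn_ge0//; lra.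
- set n := (m1 * 2 ^ k)%N.
  have n0 : 0 < n%:R :> R by rewrite ltr0n muln_gt0 expn_gt0.
  pose av (i : J * bool) l := F (rep i.1) (z l.*2) `^ exponent i.2 -
      F (rep i.1) (z l.*2.+1) `^ exponent i.2.
  pose sg := Num.sqrt n%:R * H ^+ 2.
  pose th := sg * Num.sqrt (8 * (B + 2)).
  have sg0 : 0 < sg by rewrite mulr_gt0 ?sqrtr_gt0// exprn_gt0.
  have B20 : 0 <= B + 2 by rewrite addr_ge0.
  have [||||sgn hsgn] := @exists_signs R _ n av (fun=> sg) (fun=> th).
  + by [].
  + by move=> _; rewrite mulr_ge0// ltW.
  + move=> [j e']; rewrite /sg exprMn sqr_sqrtr ?ler0n// -exprM.
    rewrite -[n in n%:R * _]card_ord mulr_natl -sumr_const; apply: ler_sum => i _.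
    rewrite /av /= -real_normK ?num_real// (exprM H 2 2) lerXn2r ?nnegrE ?exprn_ge0 ?(ltW H0)//.
    have Gj : G (fun x' => F (rep j) x' `^ exponent e') by exists j, e'.
    exact: dist_le_range (GH _ Gj _) (GH _ Gj _).
  + rewrite sumr_const card_prod card_bool.
    have -> : th ^+ 2 / (8 * sg ^+ 2) = B + 2.
      rewrite /th exprMn sqr_sqrtr ?mulr_ge0//.
      by field; rewrite gt_eqF.
    rewrite -[_ *+ _]mulr_natl natrM opprD expRD.
    apply: (@le_lt_trans _ _ (2 * expR (- 2))).
      rewrite mulrA ler_wpM2r ?expR_ge0// mulrAC ler_piMl//.
      by rewrite expRN ler_pdivrMr ?expR_gt0// mul1r.
    rewrite expRN ltr_pdivrMr ?expR_gt0//.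
    have := @expR1_gt2 R; have -> : 2 = 2%:R * 1 :> R by rewrite mulr1.
    rewrite expRM_natl mulr1 => hexp.
    by rewrite expr2; nra.
  exists sgn => g [j [e' ->]]; apply: le_trans (hsgn (j, e')) _.
  rewrite -ler_sqr ?nnegrE; last 2 first.
  + by rewrite mulr_ge0// ltW.
  + by rewrite !mulr_ge0 ?invr_ge0 ?mulr_ge0 ?(ltW H0) ?exprn_ge0//; lra.
  have -> : th ^+ 2 = n%:R * (H ^+ 2) ^+ 2 * (8 * (B + 2)).
    by rewrite /th /sg !exprMn !sqr_sqrtr// mulr_ge0.
  apply: (@le_trans _ _ (n%:R * m1%:R / (2 ^+ 10 * H ^+ 2))).
    rewrite ler_pdivlMr ?mulr_gt0 ?exprn_gt0//.
    have -> : n%:R * (H ^+ 2) ^+ 2 * (8 * (B + 2)) * (2 ^+ 10 * H ^+ 2) =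
      n%:R * (2 ^+ 13 * H ^+ 6 * (B + 2)) by ring.
    by rewrite ler_pM2l.
  have hn : m1%:R <= n%:R * ((3 / 4) ^+ k) ^+ 2 :> R.
    rewrite /n natrM natrX -mulrA ler_peMr// -exprM mulnC exprM -exprMn exprn_ege1//.
    by lra.
  rewrite [leRHS](_ : _ = n%:R * (n%:R * ((3 / 4) ^+ k) ^+ 2) / (2 ^+ 10 * H ^+ 2)).
    rewrite ler_wpM2r//; last by rewrite ler_pM2l.
    by rewrite invr_ge0 mulr_ge0// ?exprn_ge0// ltW.
  rewrite /e; move: (_ ^+ k) => z'; have -> : 2 ^+ 10 = 1024 :> R by ring.
  by field; rewrite gt_eqF.
- rewrite (le_trans (lerD (lexx _) (sume s)))//.
  have := iH 16; lra.
exists m1, y; split => //.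
  have -> : m1%:R = (Num.truncn (2 ^+ 13 * H ^+ 6 * (B + 2)))%:R + 1 :> R.
    by rewrite natr1.
  apply: (@le_trans _ _ (2 ^+ 25 * H ^+ 13 + 1)).
    rewrite lerD2r (@le_trans _ _ (2 ^+ 13 * H ^+ 6 * (B + 2)))//.
      by rewrite truncn_le !mulr_ge0 ?exprn_ge0 ?addr_ge0 ?(ltW H0).
    have -> : 2 ^+ 25 * H ^+ 13 = 2 ^+ 13 * H ^+ 6 * (2 ^+ 12 * H ^+ 7).
      by rewrite [RHS]mulrACA -!exprD.
    by rewrite ler_wpM2l// mulr_ge0 ?exprn_ge0 ?(ltW H0).
  have h2 : 1 <= 2 ^+ 25 :> R by rewrite exprn_ege1// ler1n.
  have h3 : 1 <= H ^+ 13 by rewrite exprn_ege1.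
  have h4 : 1 * 1 <= 2 ^+ 25 * H ^+ 13 by rewrite ler_pM.
  rewrite [in leRHS]exprS -mulrA; move: h4; move: (_ * H ^+ 13) => z; lra.
move=> c hc e'; set q := exponent e'.
pose c' := rep (code c).
have [hc' hcc'] := hrep (code c).
have cc : code c' = code c by apply: hcc'; exists c.
have dcc : dot (c - c') (c - c') <= t ^+ 2 by apply: hcode.
have near x' : `|F c x' `^ q - F c' x' `^ q| <= (16 * H)^-1.
  apply: le_trans (powR_lipschitz (e1 e') (e2 e') H1 (modf_ge0 _ _ _ _) (FH _ _ hc')
    (modf_ge0 _ _ _ _) (FH _ _ hc)) _.
  apply: (@le_trans _ _ (2 * H * (H * t))).
    rewrite ler_wpM2l ?mulr_ge0 ?(ltW H0)// (le_trans (modf_dist _ _ _ _ _))//.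
    by rewrite frame_modf_le// ltW.
  by rewrite le_eqVlt; apply/orP; left; apply/eqP; rewrite /t; field; rewrite gt_eqF.
have Gc' : G (fun x => F c' x `^ q) by exists (code c), e'.
have h1 := hy _ Gc'; have h2 := sume s.
have h3 := avg_dist y m10 near.
have h4 := sum_weight_dist w0 w1 near.
have -> : (4 * H)^-1 = 4 * (16 * H)^-1 by field; rewrite gt_eqF.
exact: dist_le_four h3 h4 h1 h2.
Qed.

(** By homogeneity it suffices to consider [dot c c = 1].  Then the moment of order 2
    is at least 1/2, and since [F c <= H] the moment of order [r] is at least
    [(2 * H)^-1], so that an additive error [(4 * H)^-1] is a multiplicative one. *)
Lemma coarse_points : exists (m1 : nat) (y : nat -> T),
  [/\ (0 < m1)%N, m1%:R <= 2 ^+ 26 * H ^+ 13,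
     forall c, dot c c <= 4 * avg m1 y (fun t => F c t ^+ 2) &
     forall c, avg m1 y (fun t => F c t `^ r) <= 2 * \sum_t w t * F c t `^ r].
Proof.
have [m1 [y [m10 m1H hy]]] := coarse_points_additive.
have w0 := frame_w_ge0 fr.
have r0 : 0 <= r by rewrite (le_trans _ r1).
have iH : (4 * H)^-1 <= 4^-1.
  by rewrite lef_pV2 ?posrE ?mulr_gt0// ler_peMr.
have unit c : dot c c = 1 -> 4^-1 <= avg m1 y (fun t => F c t ^+ 2) /\
    avg m1 y (fun t => F c t `^ r) <= 2 * \sum_t w t * F c t `^ r.
  move=> hc.
  have hc1 : dot c c <= 1 by rewrite hc.
  have lo : 2^-1 <= \sum_t w t * F c t ^+ 2.
    by have := frame_lower fr c; rewrite hc; lra.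
  have FH t : F c t <= H by rewrite -[H]mulr1 frame_modf_le// expr1n.
  split.
    have := hy c hc1 true; rewrite /exponent.
    under eq_fun => t do rewrite powR_mulrn ?modf_ge0//.
    under eq_bigr => t _ do rewrite powR_mulrn ?modf_ge0//.
    rewrite ler_norml => /andP[+ _]; move: lo iH; move: (avg _ _ _) (\sum_t _) => *; lra.
  have lor : 2^-1 <= H * \sum_t w t * F c t `^ r.
    apply: le_trans lo _; rewrite mulr_sumr; apply: ler_sum => t _.
    rewrite [leRHS]mulrCA ler_wpM2l//.
    rewrite (le_trans (sqr_le_powR r1 r2 (modf_ge0 _ _ _ _) (FH t)))//.
    rewrite ler_wpM2r ?powR_ge0//.
    by apply: ler1_powR => //; move: r1; lra.
  have lor' : (2 * H)^-1 <= \sum_t w t * F c t `^ r.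
    by rewrite invfM ler_pdivrMr// mulrC.
  have := hy c hc1 false; rewrite /exponent ler_norml => /andP[_].
  have -> : (4 * H)^-1 = (2 * H)^-1 / 2 by field; rewrite gt_eqF.
  have := invr_ge0 (2 * H); rewrite mulr_ge0 ?(ltW H0)//.
  move: lor'; move: (2 * H)^-1 (avg _ _ _) (\sum_t _) => *; lra.
exists m1, y; split => // c; have [c0|c0] := eqVneq (dot c c) 0.
- by rewrite c0 mulr_ge0// avg_ge0// => t; rewrite sqr_ge0.
- have sq : 0 < Num.sqrt (dot c c) by rewrite sqrtr_gt0 lt0r c0 dot_ge0.
  have [|h _] := unit ((Num.sqrt (dot c c))^-1 *: c).
    by rewrite dotZl dotZr mulrA -invfM -expr2 sqr_sqrtr ?dot_ge0// mulVf.
  move: h; under eq_fun => t do rewrite modfZ ?invr_ge0 ?(ltW sq)// exprMn.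
  rewrite avgZ exprVn sqr_sqrtr ?dot_ge0// ler_pdivlMl; last by rewrite lt0r c0 dot_ge0.
  by move: (avg _ _ _) (dot c c) => *; lra.
- have F0 t : F c t = 0.
    apply/eqP; rewrite -sqrf_eq0 eq_le sqr_ge0 andbT.
    by have := frame_upper fr c t; rewrite c0 mulr0.
  under eq_fun => t do rewrite F0 powR0 ?gt_eqF ?(lt_le_trans _ r1)//.
  rewrite avg_const// mulr_ge0// sumr_ge0// => t _.
  by rewrite mulr_ge0 ?powR_ge0.
- have sq : 0 < Num.sqrt (dot c c) by rewrite sqrtr_gt0 lt0r c0 dot_ge0.
  have [|_] := unit ((Num.sqrt (dot c c))^-1 *: c).
    by rewrite dotZl dotZr mulrA -invfM -expr2 sqr_sqrtr ?dot_ge0// mulVf.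
  have E t : F ((Num.sqrt (dot c c))^-1 *: c) t `^ r =
     (Num.sqrt (dot c c))^-1 `^ r * F c t `^ r.
    by rewrite modfZ ?invr_ge0 ?(ltW sq)// powRM ?modf_ge0// invr_ge0 ltW.
  under eq_fun => t do rewrite E.
  under [X in 2 * X]eq_bigr => t _ do rewrite E mulrCA.
  rewrite avgZ -mulr_sumr [leRHS]mulrCA ler_pM2l// powR_gt0// invr_gt0//.
Qed.

End CoarsePoints.

(** * Entropy of the unit class of the modular *)

(** Growth of lower order [r] in [1, 2] and of upper order [q].  Both conditions are
    written without division, so that they include the argument 0. *)
Record power_growth (R : realType) (Phi : R -> R) (a q r t1 : R) : Prop := {
  pg_ge0 : forall t, 0 <= t -> 0 <= Phi t ;
  pg_mono : forall s t, 0 <= s -> s <= t -> Phi s <= Phi t ;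
  pg_at0 : Phi 0 = 0 ;
  pg_a_ge1 : 1 <= a ;
  pg_q_ge1 : 1 <= q ;
  pg_r_ge1 : 1 <= r ;
  pg_r_le2 : r <= 2 ;
  pg_lower : forall s t, 0 <= s -> s <= t -> Phi s * t `^ r <= a * s `^ r * Phi t ;
  pg_upper : forall s t, 0 <= s -> s <= t -> Phi t * s `^ q <= t `^ q * Phi s ;
  pg_t1_ge1 : 1 <= t1 ;
  pg_Phi_t1 : 1 <= Phi t1
}.

Section PhiFacts.
Variables (R : realType) (Phi : R -> R) (a q r t1 : R).
Hypothesis pg : power_growth Phi a q r t1.

(** A bound of the moment of order [r] of a function whose modular is at most 2,
    see [powR_le_Phi] and [unit_class_moment]. *)
Definition moment_bound : R := t1 `^ r * (1 + 2 * a).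

Lemma moment_bound_ge1 : 1 <= moment_bound.
Proof.
have h1 : 1 <= t1 `^ r.
  apply: (@le_trans _ _ t1); first exact: pg_t1_ge1 pg.
  by apply: le1r_powR; [exact: pg_t1_ge1 pg | exact: pg_r_ge1 pg].
have h2 : 1 <= 1 + 2 * a by have := pg_a_ge1 pg; lra.
by rewrite /moment_bound -[leLHS]mulr1 ler_pM.
Qed.

Lemma powR_le_Phi t : 0 <= t -> t `^ r <= t1 `^ r * (1 + a * Phi t).
Proof.
move=> t0; have a1 := pg_a_ge1 pg; have r1 := pg_r_ge1 pg.
have t11 := pg_t1_ge1 pg; have P0 := pg_ge0 pg t0.
have aP0 : 0 <= a * Phi t by rewrite mulr_ge0//; lra.
have [tt1|/ltW tt1] := leP t t1.
  apply: (@le_trans _ _ (t1 `^ r)); first by rewrite powR_le_base//; lra.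
  by rewrite ler_peMr ?powR_ge0//; lra.
have h := pg_lower pg (le_trans ler01 t11) tt1.
have h2 : t `^ r <= Phi t1 * t `^ r by rewrite ler_peMl ?powR_ge0// (pg_Phi_t1 pg).
apply: le_trans h2 (le_trans h _).
by rewrite mulrAC mulrC ler_wpM2l ?powR_ge0//; lra.
Qed.

(** The integrated form of [t * Phi^`() t <= q * Phi t], which is what the upper growth
    condition means for a differentiable [Phi]. *)
Lemma Phi_sub_le s t : 0 <= s -> s <= t ->
  t * (Phi t - Phi s) <= q * (t - s) * Phi t.
Proof.
move=> s0 st; have [t0|t0] := leP t 0.
  have -> : t = 0 by apply/eqP; rewrite eq_le t0 (le_trans s0).
  have -> : s = 0 by apply/eqP; rewrite eq_le s0 (le_trans st).
  by rewrite !subrr mul0r mulr0 mul0r.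
have tr : t != 0 by rewrite gt_eqF.
have P0 := pg_ge0 pg (ltW t0).
have h1 := powR_Bernoulli (pg_q_ge1 pg) (divr_ge0 s0 (ltW t0)).
have h2 : (s / t) `^ q * Phi t <= Phi s.
  rewrite -(ler_pM2l (powR_gt0 q t0)) mulrA -powRM ?(ltW t0) ?divr_ge0 ?(ltW t0)//.
  have -> : t * (s / t) = s by rewrite mulrC divfK.
  by rewrite [leLHS]mulrC; apply: pg_upper pg _ _ s0 st.
have h3 : (1 - q * (1 - s / t)) * Phi t <= Phi s.
  by apply: le_trans h2; rewrite ler_wpM2r.
have h4 : t * ((1 - q * (1 - s / t)) * Phi t) = t * Phi t - q * (t - s) * Phi t by field.
have := ler_wpM2l (ltW t0) h3; rewrite h4 lerBlDr => h5.
by rewrite mulrBr lerBlDl.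
Qed.

(** One factor of the square is the loss [Phi t] that the modular controls.  The other
    one combines the slope bound [Phi_sub_le] with the lower growth of order [r] between
    [t] and [B], and [r <= 2] turns the quadratic gain in [t - s] into a gain
    of order [r] which does not depend on [t]. *)
Lemma Phi_sqr_dist s t tau B : 0 <= s -> s <= t -> t <= B -> 0 <= tau ->
  t - s <= tau * B ->
  (Phi t - Phi s) ^+ 2 <= q ^+ 2 * a * tau `^ r * Phi B * Phi t.
Proof.
move=> s0 st tB tau0 ts; have t0 := le_trans s0 st; have B0 := le_trans t0 tB.
have P0 := pg_ge0 pg t0; have PB0 := pg_ge0 pg B0.
have q1 := pg_q_ge1 pg; have a1 := pg_a_ge1 pg.
have r1 := pg_r_ge1 pg; have r2 := pg_r_le2 pg.
have r0 : 0 <= r by lra.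
move: t0; rewrite le_eqVlt => /orP[/eqP te|t0].
  have -> : s = t by apply/eqP; rewrite eq_le st -te s0.
  by rewrite subrr expr0n -te (pg_at0 pg) !mulr0.
have tr : 0 < t `^ r by exact: powR_gt0.
have d0 : 0 <= t - s by rewrite subr_ge0.
have PP : 0 <= Phi t - Phi s by rewrite subr_ge0 (pg_mono pg).
have h1 : (Phi t - Phi s) ^+ 2 * t ^+ 2 <= q ^+ 2 * (t - s) ^+ 2 * Phi t ^+ 2.
  have := Phi_sub_le s0 st; rewrite -ler_sqr ?nnegrE.
  - by rewrite !exprMn [_ * t ^+ 2]mulrC.
  - by rewrite mulr_ge0// ltW.
  - by rewrite !mulr_ge0//; lra.
have h2 : (t - s) ^+ 2 * t `^ r <= (t - s) `^ r * t ^+ 2.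
  have e : t ^+ 2 = t `^ (2 - r) * t `^ r.
    by rewrite -powRD ?subrK ?powR_mulrn ?(ltW t0)// (gt_eqF t0) implybT.
  rewrite e mulrA ler_wpM2r ?powR_ge0// [leRHS]mulrC.
  by apply: sqr_le_powR => //; lra.
have h3 : (t - s) `^ r <= tau `^ r * B `^ r by rewrite -powRM// powR_le_base.
have h4 : Phi t * B `^ r <= a * t `^ r * Phi B := pg_lower pg (ltW t0) tB.
have t2 : 0 < t ^+ 2 by rewrite exprn_gt0.
rewrite -(ler_pM2r (mulr_gt0 t2 tr)).
apply: (@le_trans _ _ (q ^+ 2 * (t - s) ^+ 2 * Phi t ^+ 2 * t `^ r)).
  by rewrite mulrA ler_wpM2r// ltW.
apply: (@le_trans _ _ (q ^+ 2 * ((tau `^ r * B `^ r) * t ^+ 2) * Phi t ^+ 2)).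
  rewrite [leLHS](_ : _ = q ^+ 2 * Phi t ^+ 2 * ((t - s) ^+ 2 * t `^ r)); last by ring.
  rewrite [leRHS](_ : _ = q ^+ 2 * Phi t ^+ 2 * (tau `^ r * B `^ r * t ^+ 2)); last by ring.
  apply: ler_wpM2l; first by rewrite mulr_ge0 ?sqr_ge0.
  by apply: le_trans h2 _; rewrite ler_wpM2r// sqr_ge0.
rewrite [leLHS](_ : _ = q ^+ 2 * tau `^ r * t ^+ 2 * Phi t * (Phi t * B `^ r)); last by ring.
rewrite [leRHS](_ : _ = q ^+ 2 * tau `^ r * t ^+ 2 * Phi t * (a * t `^ r * Phi B)); last by ring.
have q0 : 0 <= q by lra.
by rewrite ler_wpM2l// !mulr_ge0 ?powR_ge0 ?(ltW t0).
Qed.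

Lemma powR_add_le x y : 0 <= x -> 0 <= y -> (x + y) `^ r <= 4 * (x `^ r + y `^ r).
Proof.
have r1 := pg_r_ge1 pg; have r2 := pg_r_le2 pg; have r0 : 0 <= r by lra.
wlog xy : x y / x <= y.
  move=> h x0 y0; have [xy|/ltW xy] := leP x y; first exact: h.
  by rewrite addrC [_ `^ _ + _]addrC; exact: h.
move=> x0 y0; apply: (@le_trans _ _ ((2 * y) `^ r)).
  by rewrite powR_le_base ?addr_ge0//; lra.
rewrite powRM// ler_pM ?powR_ge0//; last by rewrite lerDr powR_ge0.
have -> : 4 = 2 `^ 2 :> R by rewrite powR_mulrn// expr2; lra.
by rewrite ler_powR//; lra.
Qed.

End PhiFacts.

Section Entropy.
Variables (R : realType) (T : finType) (D : nat) (a b : T -> 'rV[R]_D).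
Variables (w : T -> R) (H : R) (D0 : nat).
Hypothesis fr : frame a b w H D0.
Variables (Phi : R -> R) (ca q r t1 : R).
Hypothesis pg : power_growth Phi ca q r t1.
Local Notation F := (modf a b).

(** The bound 2 instead of 1 leaves room for the error of the discretization. *)
Definition unit_class (c : 'rV[R]_D) : Prop := \sum_t w t * Phi (F c t) <= 2.

Local Notation K := unit_class.
Local Notation C1 := (moment_bound ca r t1).

(** Up to a constant this is [H `^ (2 / r)]. *)
Definition sup_bound : R := (2 * C1 * H ^+ 2) `^ r^-1.
Local Notation B := sup_bound.

Let r1 := pg_r_ge1 pg.
Let r2 := pg_r_le2 pg.
Let r0 : 0 < r. Proof. by move: r1; lra. Qed.
Let H1 := frame_H_ge1 fr.
Let H0 : 0 < H. Proof. by apply: lt_le_trans H1. Qed.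
Let C1_ge1 : 1 <= C1 := moment_bound_ge1 pg.
Let C1_gt0 : 0 < C1 := lt_le_trans ltr01 C1_ge1.
Let C1_ge0 : 0 <= C1 := ltW C1_gt0.

Lemma sup_bound_powR : B `^ r = 2 * C1 * H ^+ 2.
Proof.
rewrite -powRrM mulVf ?gt_eqF// powRr1//.
by rewrite mulr_ge0 ?sqr_ge0// mulr_ge0.
Qed.

Lemma sup_bound_gt0 : 0 < B.
Proof.
by rewrite powR_gt0// mulr_gt0 ?exprn_gt0// mulr_gt0.
Qed.
Let B0 := sup_bound_gt0.

Lemma unit_class_moment c : K c -> \sum_t w t * F c t `^ r <= C1.
Proof.
move=> Kc; apply: (@le_trans _ _ (\sum_t w t * (t1 `^ r * (1 + ca * Phi (F c t))))).
  by apply: ler_sum => t _; rewrite ler_wpM2l ?(frame_w_ge0 fr)// (powR_le_Phi pg) ?modf_ge0.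
rewrite (eq_bigr (fun t => t1 `^ r * (w t + ca * (w t * Phi (F c t))))); last first.
  by move=> t _; ring.
rewrite -mulr_sumr big_split /= (frame_w_sum fr) -mulr_sumr ler_wpM2l ?powR_ge0//.
by rewrite lerD2l mulrC ler_wpM2r// (le_trans _ (pg_a_ge1 pg)).
Qed.

(** With [N] the Euclidean norm of [c], interpolation between the moment of order [r]
    and the uniform bound [H * N] gives [N ^+ 2 <= 2 * (H * N) `^ (2 - r) * C1], and
    this inequality is solved for [N]. *)
Lemma unit_class_norm c : K c -> dot c c <= (B / H) ^+ 2.
Proof.
move=> Kc; have := dot_ge0 c; rewrite le_eqVlt => /orP[/eqP <-|c0]; first exact: sqr_ge0.
pose N := Num.sqrt (dot c c).
have N0 : 0 < N by rewrite sqrtr_gt0.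
have N2 : N ^+ 2 = dot c c by rewrite sqr_sqrtr ?ltW.
have HN : 0 < H * N by rewrite mulr_gt0.
have FN t : F c t <= H * N by rewrite (frame_modf_le fr) ?N2 ?(ltW N0).
have h : N ^+ 2 <= 2 * ((H * N) `^ (2 - r) * C1).
  rewrite N2 (le_trans (frame_lower fr c))// ler_wpM2l//.
  apply: (@le_trans _ _ (\sum_t (H * N) `^ (2 - r) * (w t * F c t `^ r))).
    apply: ler_sum => t _; rewrite [leRHS]mulrCA ler_wpM2l ?(frame_w_ge0 fr)//.
    by rewrite sqr_le_powR ?modf_ge0.
  by rewrite -mulr_sumr ler_wpM2l ?powR_ge0// unit_class_moment.
have e : (H * N) ^+ 2 = (H * N) `^ (2 - r) * (H * N) `^ r.
  by rewrite -powRD ?subrK ?powR_mulrn ?(ltW HN)// (gt_eqF HN) implybT.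
have hr : (H * N) `^ r <= B `^ r.
  rewrite sup_bound_powR -(ler_pM2l (powR_gt0 (2 - r) HN)) -e exprMn.
  rewrite [leRHS](_ : _ = H ^+ 2 * (2 * ((H * N) `^ (2 - r) * C1))); last by ring.
  by rewrite ler_wpM2l// sqr_ge0.
have hB : H * N <= B.
  rewrite leNgt; apply/negP => hlt; move: hr; rewrite leNgt => /negP; apply.
  by apply: gt0_ltr_powR => //; rewrite nnegrE ltW.
rewrite -N2 ler_sqr ?nnegrE ?(ltW N0) ?divr_ge0 ?(ltW B0) ?(ltW H0)//.
by rewrite ler_pdivlMr// mulrC.
Qed.

Lemma unit_class_sup c x : K c -> F c x <= B.
Proof.
move=> Kc; have := frame_modf_le fr x _ (unit_class_norm Kc).
rewrite divr_ge0 ?(ltW H0) ?(ltW B0)// => /(_ isT).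
by rewrite mulrC divfK// gt_eqF.
Qed.

Lemma unit_class_diff_moment c c' : K c -> K c' ->
  \sum_t w t * F (c - c') t `^ r <= 8 * C1.
Proof.
move=> Kc Kc'; apply: (@le_trans _ _
   (\sum_t 4 * (w t * F c t `^ r + w t * F c' t `^ r))).
  apply: ler_sum => t _; rewrite -mulrDr mulrCA ler_wpM2l ?(frame_w_ge0 fr)//.
  apply: le_trans (powR_add_le pg (modf_ge0 _ _ _ _) (modf_ge0 _ _ _ _)).
  by rewrite powR_le_base ?modf_ge0 ?modfB// ltW.
rewrite -mulr_sumr big_split /=.
have -> : 8 * C1 = 4 * (C1 + C1) by ring.
by rewrite ler_wpM2l// lerD// unit_class_moment.
Qed.

(** If a code is such that differences within its classes have small Euclidean norm, the
    perceptron refines it to scale [v] on [n] points; [u] is the scale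
    on the coarse points that yields the norm bound [64 * C1 * u `^ (2 - r)]. *)
Lemma codable_points (n : nat) (z : nat -> T) (P : 'rV[R]_D -> Prop) (u v beta : R) :
  0 < u -> 0 < v -> codable K P beta ->
  (forall c c', K c -> K c' -> P (c - c') ->
     dot (c - c') (c - c') <= 64 * C1 * u `^ (2 - r)) ->
  codable K (fun h => forall i, (i < n)%N -> F h (z i) <= v)
    (beta + 2 ^+ 9 * (B `^ r * u `^ (2 - r) / v ^+ 2) * ln (4 * n%:R + 1)).
Proof.
move=> u0 v0 cP hP.
pose J : finType := ('I_n * bool)%type.
pose vv (j : J) := if j.2 then a (z j.1) else b (z j.1).
have vvH j : dot (vv j) (vv j) <= H ^+ 2.
  by rewrite /vv; case: j.2; [exact: (frame_dot_le fr _).1 | exact: (frame_dot_le fr _).2].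
pose tau := v / 4; have tau0 : 0 < tau by rewrite divr_gt0.
pose X := 64 * C1 * u `^ (2 - r) * H ^+ 2 / tau ^+ 2.
have X0 : 0 <= X.
  by rewrite divr_ge0 ?sqr_ge0// mulr_ge0 ?sqr_ge0// mulr_ge0 ?powR_ge0// mulr_ge0.
have XE : X = 2 ^+ 9 * (B `^ r * u `^ (2 - r) / v ^+ 2).
  by rewrite /X /tau sup_bound_powR; field; rewrite gt_eqF.
have cp := codable_perceptron H0 tau0 vvH (Num.truncn X).
have cr := codable_refine cP _ cp.
apply: codableW (cr _) => //.
- move=> h hh i ni; apply: le_trans (modf_le_dot _ _ _ _) _.
  have := hh (Ordinal ni, true); have := hh (Ordinal ni, false); rewrite /vv /=.
  have -> : v = 2 * tau + 2 * tau by rewrite /tau; field.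
  by move=> h1 h2; rewrite lerD.
- rewrite lerD2l -XE card_prod card_ord card_bool natrM mulrA.
  have -> : 2 * n%:R * 2 = 4 * n%:R :> R by ring.
  by rewrite ler_wpM2r ?truncn_le// ln_ge0// lerDr mulr_ge0.
- move=> c c' Kc Kc' Pc; apply: le_lt_trans (_ : X * tau ^+ 2 < _).
    by rewrite /X divfK ?gt_eqF ?exprn_gt0// ler_wpM2r ?sqr_ge0// hP.
  by rewrite ltr_pM2r ?exprn_gt0// truncnS_gt.
Qed.

Section Coarse.
Variables (m1 : nat) (y : nat -> T) (Lam : R).
Hypotheses (y2 : forall c, dot c c <= 4 * avg m1 y (fun t => F c t ^+ 2))
  (yr : forall c, avg m1 y (fun t => F c t `^ r) <= 2 * \sum_t w t * F c t `^ r)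
  (Lam1 : 1 <= Lam) (LamY : ln (4 * m1%:R + 1) <= Lam).

(** On the coarse points the Euclidean norm is bounded by the second moment, hence by
    [u `^ (2 - r)] times the moment of order [r].  This improves on the norm bound that
    holds in the whole class as soon as [r < 2]. *)
Lemma coarse_norm c c' u : K c -> K c' ->
  (forall i, (i < m1)%N -> F (c - c') (y i) <= u) ->
  dot (c - c') (c - c') <= 64 * C1 * u `^ (2 - r).
Proof.
move=> Kc Kc' hu; apply: le_trans (y2 _) _.
apply: (@le_trans _ _ (4 * (u `^ (2 - r) * avg m1 y (fun t => F (c - c') t `^ r)))).
  rewrite ler_wpM2l// /avg [leRHS]mulrCA ler_wpM2l ?invr_ge0// mulr_sumr.
  by apply: ler_sum => i _; rewrite sqr_le_powR ?modf_ge0// hu.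
apply: (@le_trans _ _ (4 * (u `^ (2 - r) * (2 * (8 * C1))))); last first.
  by rewrite le_eqVlt; apply/orP; left; apply/eqP; ring.
rewrite ler_wpM2l// ler_wpM2l ?powR_ge0// (le_trans (yr _))// ler_wpM2l//.
exact: unit_class_diff_moment.
Qed.

(** Each halving of the scale on the coarse points uses [codable_points] for the coarse
    points themselves, and the costs form a geometric sum. *)
Lemma codable_coarse (j : nat) :
  codable K (fun h => forall i, (i < m1)%N -> F h (y i) <= 2 * B / 2 ^+ j)
    (2 ^+ 11 * (2 ^+ j) `^ r * Lam).
Proof.
have Lam0 : 0 <= Lam by rewrite (le_trans _ Lam1).
elim: j => [|j IH].
  apply: codable_trivial; first by rewrite mulr_ge0// mulr_ge0 ?powR_ge0 ?exprn_ge0.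
  move=> c c' Kc Kc' i _; rewrite expr0 divr1 (le_trans (modfB _ _ _ _ _))//.
  by rewrite mulr_natl mulr2n lerD ?unit_class_sup.
have p2 k : 0 < 2 ^+ k :> R by rewrite exprn_gt0.
have u0 : 0 < 2 * B / 2 ^+ j by rewrite divr_gt0// mulr_gt0.
have v0 : 0 < 2 * B / 2 ^+ j.+1 by rewrite divr_gt0// mulr_gt0.
have := @codable_points m1 y _ _ _ _ u0 v0 IH (fun c c' Kc Kc' => coarse_norm Kc Kc').
apply: codableW => //.
set u := 2 * B / 2 ^+ j in u0 *; set v := 2 * B / 2 ^+ j.+1 in v0 *.
have vE : v = u / 2 by rewrite /v /u exprS; field; rewrite gt_eqF.
have BE : B = u * 2 ^+ j / 2 by rewrite /u; field; rewrite gt_eqF.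
have e1 : B `^ r * u `^ (2 - r) / v ^+ 2 <= 4 * (2 ^+ j) `^ r.
  rewrite vE expr_div_n invf_div mulrA ler_pdivrMr ?exprn_gt0//.
  apply: (@le_trans _ _ ((u * 2 ^+ j) `^ r * u `^ (2 - r) * 2 ^+ 2)).
    rewrite ler_wpM2r// ler_wpM2r ?powR_ge0// powR_le_base ?(ltW r0) ?(ltW B0)//.
    have : 0 <= u * 2 ^+ j by rewrite mulr_ge0 ?(ltW u0) ?(ltW (p2 _)).
    by rewrite BE; move: (u * 2 ^+ j) => zz; lra.
  rewrite powRM ?(ltW u0) ?(ltW (p2 _))//.
  have -> : u ^+ 2 = u `^ r * u `^ (2 - r).
    by rewrite -powRD ?subrKC ?powR_mulrn ?(ltW u0)// (gt_eqF u0) implybT.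
  by rewrite le_eqVlt; apply/orP; left; apply/eqP; ring.
apply: (@le_trans _ _ (2 ^+ 11 * (2 ^+ j) `^ r * Lam + 2 ^+ 9 * (4 * (2 ^+ j) `^ r) * Lam)).
  rewrite lerD2l; apply: ler_pM => //.
  - rewrite mulr_ge0 ?exprn_ge0// divr_ge0 ?sqr_ge0//.
    by rewrite mulr_ge0 ?powR_ge0.
  - by rewrite ln_ge0// lerDr mulr_ge0.
  - by rewrite ler_wpM2l// exprn_ge0.
have e2 : 2 * (2 ^+ j) `^ r <= (2 ^+ j.+1) `^ r.
  rewrite exprS powRM// ?(ltW (p2 _))// ler_wpM2r ?powR_ge0//.
  by apply: le1r_powR; rewrite ?ler1n.
rewrite [leLHS](_ : _ = 2 ^+ 11 * (2 * (2 ^+ j) `^ r) * Lam); last by ring.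
by rewrite ler_wpM2r// ler_wpM2l// exprn_ge0.
Qed.

(** The geometric mean [Lam `^ (1 - r / 2) * lam `^ (r / 2)] of the logarithms of the
    numbers of coarse points and of sample points. *)
Definition entropy_rate (lam : R) : R := Lam * (lam / Lam) `^ (r / 2).

(** The class is coded on the coarse points at scale [2 * B / 2 ^+ j], at cost
    [(2 ^+ j) `^ r * Lam], and then on the sample points at scale [t * B], at cost
    [(2 ^+ j) `^ (r - 2) * t ^- 2 * lam].  The two are balanced for [2 ^+ j] close to
    [(lam / Lam) `^ 2^-1 / t], which is [z0] below. *)
Lemma codable_sample (n : nat) (z : nat -> T) (lam t : R) :
  Lam <= lam -> ln (4 * n%:R + 1) <= lam -> 0 < t -> t <= 1 ->
  codable K (fun h => forall i, (i < n)%N -> F h (z i) <= t * B)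
    (2 ^+ 14 * (t^-1 `^ r * entropy_rate lam)).
Proof.
move=> Ll hn t_gt0 t_le1.
have Lam0 : 0 < Lam by rewrite (lt_le_trans _ Lam1).
have lam0 : 0 < lam by rewrite (lt_le_trans _ Ll).
(* The ratio z0 = s / t balances the two costs. *)
pose s := (lam / Lam) `^ 2^-1.
have s1 : 1 <= s.
  apply: (@le_trans _ _ (1 `^ 2^-1)); first by rewrite powR1.
  by rewrite powR_le_base// ?invr_ge0// ler_pdivlMr// mul1r.
have s2 : s ^+ 2 = lam / Lam.
  rewrite -powR_mulrn ?powR_ge0// -powRrM mulVf// powRr1// divr_ge0 ?ltW//.
pose z0 := s / t.
have z01 : 1 <= z0 by rewrite ler_pdivlMr// mul1r (le_trans t_le1).
have z00 : 0 < z0 by rewrite (lt_le_trans _ z01).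
have zE : t^-1 `^ r * entropy_rate lam = z0 `^ r * Lam.
  have -> : z0 `^ r = s `^ r * t^-1 `^ r.
    by rewrite -powRM ?invr_ge0 ?(ltW t_gt0)// powR_ge0.
  by rewrite /entropy_rate /s -powRrM [2^-1 * r]mulrC; ring.
have [j [zj jz]] := exists_pow2 z01.
have p2 : 0 < 2 ^+ j :> R by rewrite exprn_gt0.
have u0 : 0 < 2 * B / 2 ^+ j by rewrite divr_gt0// mulr_gt0.
have v0 : 0 < t * B by rewrite mulr_gt0.
have := @codable_points n z _ _ _ _ u0 v0 (codable_coarse j)
  (fun c c' Kc Kc' => coarse_norm Kc Kc').
apply: codableW => //; rewrite zE.
have h1 : (2 ^+ j) `^ r <= 4 * z0 `^ r.
  apply: (@le_trans _ _ ((2 * z0) `^ r)); first by rewrite powR_le_base ?(ltW r0)// ltW.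
  rewrite powRM// ?(ltW z00)// ler_wpM2r ?powR_ge0//.
  have -> : 4 = 2 `^ 2 :> R by rewrite powR_mulrn// expr2; lra.
  by rewrite ler_powR// ler1n.
have h2 : B `^ r * (2 * B / 2 ^+ j) `^ (2 - r) / (t * B) ^+ 2 * lam <= 2 * (z0 `^ r * Lam).
  have -> : 2 * B / 2 ^+ j = B * (2 / 2 ^+ j) by ring.
  rewrite powRM ?(ltW B0) ?divr_ge0 ?(ltW p2)// mulrA.
  have -> : B `^ r * B `^ (2 - r) = B ^+ 2.
    by rewrite -powRD ?subrKC ?powR_mulrn ?(ltW B0)// (gt_eqF B0) implybT.
  have -> : B ^+ 2 * (2 / 2 ^+ j) `^ (2 - r) / (t * B) ^+ 2 * lam =
     (2 / 2 ^+ j) `^ (2 - r) * (lam / t ^+ 2) by field; rewrite !gt_eqF.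
  have -> : lam / t ^+ 2 = z0 ^+ 2 * Lam.
    by rewrite /z0 expr_div_n s2; field; rewrite !gt_eqF.
  apply: (@le_trans _ _ ((2 / z0) `^ (2 - r) * (z0 ^+ 2 * Lam))).
    apply: ler_wpM2r; first by rewrite mulr_ge0 ?sqr_ge0// ltW.
    apply: powR_le_base; first by rewrite subr_ge0.
      by rewrite divr_ge0// ltW.
    by rewrite ler_pM2l// lef_pV2.
  rewrite powRM ?invr_ge0 ?(ltW z00)// -powR_inv1 ?(ltW z00)// -powRrM.
  have -> : z0 ^+ 2 = z0 `^ (2 - r) * z0 `^ r.
    by rewrite -powRD ?subrK ?powR_mulrn ?(ltW z00)// (gt_eqF z00) implybT.
  rewrite mulN1r powRN.
  have -> : 2 `^ (2 - r) / z0 `^ (2 - r) * (z0 `^ (2 - r) * z0 `^ r * Lam) =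
     2 `^ (2 - r) * (z0 `^ r * Lam) by field; rewrite gt_eqF// powR_gt0.
  rewrite ler_wpM2r ?mulr_ge0 ?powR_ge0 ?(ltW Lam0)//.
  by apply: ler1_powR; rewrite ?ler1n//; move: r1; lra.
apply: (@le_trans _ _ (2 ^+ 11 * (4 * z0 `^ r) * Lam + 2 ^+ 9 * (2 * (z0 `^ r * Lam)))); last first.
  have : 0 <= z0 `^ r * Lam by rewrite mulr_ge0 ?powR_ge0// ltW.
  rewrite -mulrA -(mulrA 4); move: (z0 `^ r * Lam) => zz zz0.
  have k0 : 0 <= 2 ^+ 9 * zz by rewrite mulr_ge0// exprn_ge0.
  have -> : 2 ^+ 11 * (4 * zz) = 16 * (2 ^+ 9 * zz) by ring.
  have -> : 2 ^+ 9 * (2 * zz) = 2 * (2 ^+ 9 * zz) by ring.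
  have -> : 2 ^+ 14 * zz = 32 * (2 ^+ 9 * zz) by ring.
  by move: (2 ^+ 9 * zz) k0 => *; lra.
apply: lerD; first by rewrite ler_wpM2r ?(ltW Lam0)// ler_wpM2l.
rewrite -mulrA ler_wpM2l//; apply: le_trans h2.
rewrite ler_wpM2l// divr_ge0 ?sqr_ge0// mulr_ge0 ?powR_ge0//.
Qed.

End Coarse.

(** At scales below the inverse of the dimension a grid is cheaper. *)
Lemma codable_fine (t : R) : 0 < t -> t <= 1 ->
  codable K (fun h => forall x, F h x <= t * B) (D0%:R * ln (5 * D0%:R / t)).
Proof.
move=> t_gt0 t_le1.
have := @codable_grid R D D0 t (B / H) (frame_D_le fr) (frame_D0_gt0 fr) t_gt0 t_le1
  (divr_gt0 B0 H0).
apply: codableW => // [c Kc|h hh x]; first exact: unit_class_norm.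
have := frame_modf_le fr x _ hh; rewrite !mulr_ge0 ?invr_ge0 ?(ltW t_gt0) ?(ltW H0) ?(ltW B0)//.
by move=> /(_ isT); rewrite mulrCA [H * _]mulrC divfK// gt_eqF.
Qed.

End Entropy.

(** * Summation over the chaining levels *)

Section LevelSums.
Variable R : realType.

Lemma natr_le_pow2 k : k.+1%:R <= 2 ^+ k :> R.
Proof. by rewrite -natrX ler_nat ltn_expl. Qed.

Lemma natr_le_exp94 i : i%:R <= (9 / 4) ^+ i :> R.
Proof.
elim: i => [|i IH]; first by rewrite expr0.
have h : 1 <= (9 / 4) ^+ i :> R by rewrite exprn_ege1//; lra.
by rewrite -natr1 exprS; move: h IH; move: (_ ^+ i) => z *; lra.
Qed.

Lemma sum_levels_le (g : nat -> R) (Y : R) k0 i : 0 <= Y ->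
  (forall k, (k <= k0)%N -> g k <= Y) ->
  (forall j, g (k0 + j.+1)%N <= Y * (3 / 4) ^+ j.+1) ->
  \sum_(k < k0.+1 + i) g k <= Y * (k0%:R + 5).
Proof.
move=> Y0 h1 h2; rewrite big_split_ord /=.
have -> : Y * (k0%:R + 5) = Y * k0.+1%:R + Y * 4 by rewrite -(natr1 k0); ring.
apply: lerD.
  apply: (@le_trans _ _ (\sum_(k < k0.+1) Y)); last by rewrite sumr_const card_ord mulr_natr.
  by apply: ler_sum => k _; apply: h1; rewrite -ltnS.
apply: (@le_trans _ _ (\sum_(j < i) Y * (3 / 4) ^+ j)).
  apply: ler_sum => j _; rewrite addSnnS (le_trans (h2 _))// ler_wpM2l// exprS.
  by rewrite ler_piMl ?exprn_ge0//; lra.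
by rewrite -mulr_sumr ler_wpM2l// sum_geometric_le4.
Qed.

(** The entropy at level [k]: perceptron codes up to level [k0], where [2 ^+ k0] is about
    the dimension [D0], and grids beyond.  The scale at level [k] is the power [1 / r]
    of [4 ^- k], hence the factor [4 ^+ k]. *)
Definition level_log (A Lam D0 : R) (k0 k : nat) : R :=
  if (k <= k0)%N then 2 ^+ 14 * 4 ^+ k * A else 5 * D0 * Lam * k%:R.

(** Each of the first [k0 + 1] levels contributes the same amount, of order [Num.sqrt A];
    the levels beyond [k0], where the entropy grows only linearly, add a convergent
    geometric sum. *)
Lemma chaining_sum_le (A Lam D0 : R) (k0 k1 : nat) :
  1 <= Lam -> Lam <= A -> 1 <= D0 -> D0 <= 2 ^+ k0 ->
  \sum_(k < k0.+1 + k1) 2^-1 ^+ k * Num.sqrt (8 * (level_log A Lam D0 k0 k +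
      level_log A Lam D0 k0 k.+1 + (k%:R + 2)))
   <= 2 ^+ 10 * Num.sqrt A * (k0%:R + 5).
Proof.
move=> Lam1 LA D1 Dk; set b := level_log A Lam D0 k0.
have A1 : 1 <= A by rewrite (le_trans Lam1).
have A0 : 0 <= A by rewrite (le_trans _ A1).
have L0 : 0 <= Lam by rewrite (le_trans _ Lam1).
have D00 : 0 <= D0 by rewrite (le_trans _ D1).
have p2 k : 0 < 2 ^+ k :> R by rewrite exprn_gt0.
have p4 k : 0 < 4 ^+ k :> R by rewrite exprn_gt0.
have e4 k : 4 ^+ k = 2 ^+ k * 2 ^+ k :> R.
  by rewrite -exprMn; congr (_ ^+ k); ring.
have Y0 : 0 <= 2 ^+ 10 * Num.sqrt A by rewrite mulr_ge0 ?exprn_ge0 ?sqrtr_ge0.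
apply: (@sum_levels_le (fun k => 2^-1 ^+ k * Num.sqrt (8 * (b k + b k.+1 + (k%:R + 2)))))
  => [//|k kk|j]; cbv beta.
  rewrite exprVn mulrC ler_pdivrMr//; apply: sqrt_le_of_sqr.
    by rewrite mulr_ge0// ltW.
  have -> : (2 ^+ 10 * Num.sqrt A * 2 ^+ k) ^+ 2 = 8 * (2 ^+ 17 * (4 ^+ k * A)).
    rewrite e4 !exprMn sqr_sqrtr//.
    by move: (2 ^+ k) => z; ring.
  rewrite ler_pM2l//.
  have AA : 0 <= 4 ^+ k * A by rewrite mulr_ge0// ltW.
  have b1 : b k <= 2 ^+ 14 * (4 ^+ k * A) by rewrite /b /level_log kk mulrA.
  have b2 : b k.+1 <= 4 * (2 ^+ 14 * (4 ^+ k * A)).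
    rewrite /b /level_log; case: ifPn => hk.
      rewrite [4 ^+ k.+1]exprS le_eqVlt; apply/orP; left; apply/eqP.
      by move: (4 ^+ k) (2 ^+ 14) => *; ring.
    have ke : k = k0 by apply/eqP; rewrite eqn_leq kk leqNgt.
    apply: (@le_trans _ _ (5 * (4 ^+ k * A))).
      rewrite ke e4 -!mulrA ler_pM2l//.
      apply: (@le_trans _ _ (D0 * (A * 2 ^+ k0))).
        rewrite ler_wpM2l// ler_pM// natr_le_pow2//.
      by rewrite [A * _]mulrC ler_pM// mulr_ge0// ltW.
    have : 5 <= 4 * 2 ^+ 14 :> R.
      by have := natr_le_pow2 14; move: (2 ^+ 14) => z; lra.
    by move=> h; rewrite [leRHS]mulrA ler_wpM2r.
  have b3 : k%:R + 2 <= 2 * (4 ^+ k * A).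
    have h1 := natr_le_pow2 k; rewrite -natr1 in h1.
    have h2 : 2 ^+ k <= 4 ^+ k * A.
      apply: (@le_trans _ _ (4 ^+ k)); last by rewrite ler_peMr// ltW.
      by rewrite e4 ler_peMl ?(ltW (p2 k))// exprn_ege1// ler1n.
    have h3 : 1 <= 4 ^+ k * A.
      by apply: le_trans h2; rewrite exprn_ege1// ler1n.
    by move: h1 h2 h3; move: (2 ^+ k) (4 ^+ k * A) => *; lra.
  have E17 : 2 ^+ 17 = 8 * 2 ^+ 14 :> R by ring.
  have E14 : 2 <= 2 ^+ 14 :> R.
    by have := natr_le_pow2 14; move: (2 ^+ 14) => z; lra.
  rewrite E17 -mulrA.
  have b4 : 2 * (4 ^+ k * A) <= 2 ^+ 14 * (4 ^+ k * A) by rewrite ler_wpM2r.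
  have b5 : 0 <= 2 ^+ 14 * (4 ^+ k * A) by rewrite mulr_ge0// ltW.
  move: b1 b2 b3 b4 b5; move: (b k) (b k.+1) (2 ^+ 14 * _) (2 * _) => *; lra.
set k := (k0 + j.+1)%N; set i := j.+1.
have hk : (k <= k0)%N = false by rewrite /k addnS ltnNge leq_addr.
have hk' : (k.+1 <= k0)%N = false by rewrite /k addnS; apply/negbTE; rewrite -ltnNge ltnS (leq_trans (leq_addr j k0))// leqW.
have k1R : 1 <= k%:R :> R by rewrite ler1n /k addnS.
have D0k : 1 * 1 <= D0 * Lam by rewrite ler_pM.
rewrite exprVn mulrC ler_pdivrMr//; apply: sqrt_le_of_sqr.
  by rewrite mulr_ge0 ?(ltW (p2 _))// mulr_ge0// exprn_ge0//; lra.
have bk : b k + b k.+1 + (k%:R + 2) <= 18 * (D0 * Lam * k%:R).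
  rewrite /b /level_log hk hk' -(natr1 k).
  have : 1 * k%:R <= D0 * Lam * k%:R by rewrite ler_wpM2r// -[leLHS]mulr1.
  have : D0 * Lam * 1 <= D0 * Lam * k%:R by rewrite ler_wpM2l// mulr_ge0.
  have -> : 5 * D0 * Lam * k%:R + 5 * D0 * Lam * (k%:R + 1) + (k%:R + 2) =
    10 * (D0 * Lam * k%:R) + 5 * (D0 * Lam * 1) + k%:R + 2 by ring.
  by move: k1R; move: (D0 * Lam * k%:R) (D0 * Lam * 1) => *; lra.
have kb : D0 * Lam * k%:R <= A * (4 ^+ k0 * (9 / 4) ^+ i).
  have h1 : k%:R <= 2 ^+ k0 * (9 / 4) ^+ i :> R.
    apply: (@le_trans _ _ (k0.+1%:R * i%:R)).
      rewrite -natrM ler_nat /k mulnC mulnS addnC leq_add2l.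
      by rewrite leq_pmull.
    by rewrite ler_pM// ?natr_le_pow2// natr_le_exp94.
  have h2 : D0 * k%:R <= 2 ^+ k0 * (2 ^+ k0 * (9 / 4) ^+ i) by rewrite ler_pM.
  rewrite mulrAC mulrC ler_pM// ?mulr_ge0//.
  by rewrite e4 -mulrA.
have -> : (2 ^+ 10 * Num.sqrt A * (3 / 4) ^+ i * 2 ^+ k) ^+ 2 =
    2 ^+ 20 * (A * (4 ^+ k0 * (9 / 4) ^+ i)).
  rewrite /k -/i exprD e4.
  have -> : (9 / 4) ^+ i = ((3 / 4) ^+ i * 2 ^+ i) ^+ 2 :> R.
    by rewrite -exprMn -exprM mulnC exprM; congr (_ ^+ i); field.
  move: (2 ^+ k0) (2 ^+ i) ((3 / 4) ^+ i) => z1 z2 z3.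
  have -> : (2 ^+ 10 * Num.sqrt A * z3 * (z1 * z2)) ^+ 2 =
    (2 ^+ 10) ^+ 2 * Num.sqrt A ^+ 2 * (z3 * (z1 * z2)) ^+ 2 by ring.
  by rewrite sqr_sqrtr// -exprM; ring.
have X0 : 0 <= A * (4 ^+ k0 * (9 / 4) ^+ i).
  by rewrite mulr_ge0// mulr_ge0 ?(ltW (p4 _))// exprn_ge0//; lra.
apply: (@le_trans _ _ (144 * (A * (4 ^+ k0 * (9 / 4) ^+ i)))).
  by move: bk kb; move: (D0 * Lam * k%:R) (A * _) (b k + _ + _) => *; lra.
rewrite ler_wpM2r//.
have -> : 2 ^+ 20 = 1024 * 2 ^+ 10 :> R by ring.
by have := natr_le_pow2 10; move: (2 ^+ 10) => z; lra.
Qed.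

End LevelSums.

(** * One halving step *)

Section SignStep.
Variables (R : realType) (T : finType) (D : nat) (a b : T -> 'rV[R]_D).
Variables (w : T -> R) (H : R) (D0 : nat).
Hypothesis fr : frame a b w H D0.
Variables (Phi : R -> R) (ca q r t1 : R).
Hypothesis pg : power_growth Phi ca q r t1.
Local Notation F := (modf a b).
Local Notation K := (unit_class a b w Phi).
Local Notation B := (sup_bound H ca r t1).

Let r1 := pg_r_ge1 pg.
Let r0 : 0 < r. Proof. by move: r1; lra. Qed.
Let B0 : 0 < B := sup_bound_gt0 fr pg.
Let ca0 : 0 <= ca := le_trans ler01 (pg_a_ge1 pg).

Lemma Phi_sup_bound_ge1 : 1 <= Phi B.
Proof.
have t11 := pg_t1_ge1 pg.
apply: le_trans (pg_Phi_t1 pg) _; apply: (pg_mono pg); first by rewrite (le_trans ler01).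
have h : t1 `^ r <= B `^ r.
  rewrite (sup_bound_powR H pg) /moment_bound.
  have H2 : 1 <= H ^+ 2 by rewrite exprn_ege1// (frame_H_ge1 fr).
  have h2 : 1 <= 2 * (1 + 2 * ca) by have := ca0; lra.
  have -> : 2 * (t1 `^ r * (1 + 2 * ca)) * H ^+ 2 =
     t1 `^ r * (2 * (1 + 2 * ca) * H ^+ 2) by ring.
  by rewrite ler_peMr ?powR_ge0// -[leLHS]mulr1 ler_pM.
rewrite leNgt; apply/negP => hlt; move: h; rewrite leNgt => /negP; apply.
by apply: gt0_ltr_powR => //; rewrite nnegrE ?(ltW B0)// (le_trans ler01).
Qed.

(** The sum of the two values of [Phi] on the right makes the estimate symmetric, and
    its sum over a sample is bounded by the modulars of [c] and [c']. *)
Lemma Phi_modf_sqr_dist c c' x tau : K c -> K c' -> 0 <= tau ->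
  F (c - c') x <= tau * B ->
  (Phi (F c x) - Phi (F c' x)) ^+ 2 <=
    q ^+ 2 * ca * tau `^ r * Phi B * (Phi (F c x) + Phi (F c' x)).
Proof.
wlog h : c c' / F c x <= F c' x.
  move=> wl Kc Kc' tau0 hd; have [le|/ltW le] := leP (F c x) (F c' x).
    exact: (wl c c' le Kc Kc' tau0 hd).
  rewrite -sqrrN opprB [X in _ * X]addrC.
  by apply: (wl c' c le Kc' Kc tau0); rewrite -modfN opprB.
move=> Kc Kc' tau0 hd.
have q0 : 0 <= q by rewrite (le_trans ler01 (pg_q_ge1 pg)).
have PB : 0 <= Phi B := le_trans ler01 Phi_sup_bound_ge1.
rewrite -sqrrN opprB.
have hs := Phi_sqr_dist pg (modf_ge0 a b c x) h (unit_class_sup fr pg x Kc') tau0.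
apply: le_trans (hs _) _.
  apply: le_trans hd; apply: le_trans (modf_dist _ _ _ _ _).
  by rewrite distrC; exact: ler_norm.
rewrite ler_wpM2l//.
  by rewrite mulr_ge0// mulr_ge0 ?powR_ge0// mulr_ge0 ?sqr_ge0.
by rewrite lerDr (pg_ge0 pg) ?modf_ge0.
Qed.

Lemma unit_class0 : K 0.
Proof.
rewrite /unit_class big1 ?ler0n// => t _.
by rewrite modf0 (pg_at0 pg) mulr0.
Qed.

Variables (m1 : nat) (y : nat -> T) (Lam : R).
Hypotheses (y2 : forall c, dot c c <= 4 * avg m1 y (fun t => F c t ^+ 2))
  (yr : forall c, avg m1 y (fun t => F c t `^ r) <= 2 * \sum_t w t * F c t `^ r)
  (Lam1 : 1 <= Lam) (LamY : ln (4 * m1%:R + 1) <= Lam)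
  (LamD : ln (5 * D0%:R) <= Lam).

(* The increments of [Phi] are of order [r / 2] in the scale, so that this choice gives
   chaining distances proportional to [2 ^- k]. *)
Let scale (k : nat) : R := (4^-1 ^+ k) `^ r^-1.

Let scale_powR k : scale k `^ r = 4^-1 ^+ k.
Proof. by rewrite /scale -powRrM mulVf ?gt_eqF// powRr1// exprn_ge0. Qed.

Let scale_gt0 k : 0 < scale k.
Proof. by rewrite powR_gt0// exprn_gt0. Qed.

Let scale_le1 k : scale k <= 1.
Proof.
have e1 : 1 `^ r^-1 = 1 :> R by rewrite powR1.
rewrite -[leRHS]e1 powR_le_base ?invr_ge0 ?(ltW r0) ?exprn_ge0//.
by rewrite exprn_ile1// invf_le1// ler1n.
Qed.

Let scaleV_powR k : (scale k)^-1 `^ r = 4 ^+ k.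
Proof.
have h : (scale k)^-1 `^ r * scale k `^ r = 1.
  by rewrite -powRM ?invr_ge0 ?(ltW (scale_gt0 k))// mulVf ?gt_eqF// powR1.
move: h; rewrite scale_powR exprVn => h.
have p4 : 4 ^+ k != 0 :> R by rewrite expf_neq0// pnatr_eq0.
by rewrite -[LHS](mulfVK p4) h mul1r.
Qed.

Let ln_scale k : ln (5 * D0%:R / scale k) <= Lam + 4 * k%:R.
Proof.
have D0p : 0 < D0%:R :> R by rewrite ltr0n (frame_D0_gt0 fr).
rewrite ln_div ?posrE ?mulr_gt0//; apply: lerD => //.
rewrite /scale ln_powR exprVn lnV ?posrE ?exprn_gt0// mulrN opprK lnXn//.
have l4 : ln 4 <= 4 :> R by rewrite ltW// ln_sublinear.
have l40 : 0 <= ln 4 :> R by rewrite ln_ge0// ler1n.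
rewrite -[_ *+ k]mulr_natr mulrA ler_wpM2r//.
apply: le_trans l4; rewrite ler_piMl// invf_le1//.
Qed.

Lemma codable_level (n k0 k : nat) (x : nat -> T) (lam : R) :
  Lam <= lam -> ln (4 * n%:R + 1) <= lam ->
  codable K (fun h => forall i, (i < n)%N -> F h (x i) <= scale k * B)
    (level_log (entropy_rate r Lam lam) Lam D0%:R k0 k).
Proof.
move=> Ll hn; rewrite /level_log; case: ifPn => hk.
  have := codable_sample fr pg y2 yr Lam1 LamY x Ll hn (scale_gt0 k) (scale_le1 k).
  by apply: codableW => //; rewrite scaleV_powR mulrA.
have := codable_fine fr pg (scale_gt0 k) (scale_le1 k).
apply: codableW => //.
have k1R : 1 <= k%:R :> R.
  by rewrite ler1n lt0n; apply: contraNneq hk => ->.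
apply: (@le_trans _ _ (D0%:R * (Lam + 4 * k%:R))); first by rewrite ler_wpM2l.
rewrite -!mulrA [leRHS]mulrCA ler_wpM2l//.
have h1 : Lam * 1 <= Lam * k%:R by rewrite ler_wpM2l// (le_trans ler01).
have h2 : 1 * k%:R <= Lam * k%:R by rewrite ler_wpM2r.
by move: h1 h2; rewrite mulr1 mul1r; move: (Lam * k%:R) => *; lra.
Qed.

(** Chaining for the class [K].  At level 0 the only representative is 0, at which all
    increments vanish; the distances are [d k = Num.sqrt QQ * 2^-1 ^+ k] because the sum
    of [Phi] over the sample is bounded by hypothesis. *)
Lemma sign_step (n k0 : nat) (x : nat -> T) (lam : R) :
  (0 < n)%N -> D0%:R <= 2 ^+ k0 :> R ->
  Lam <= lam -> ln (4 * n.*2%:R + 1) <= lam ->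
  (forall c, K c -> \sum_(i < n.*2) Phi (F c (x i)) <= 3 * n.*2%:R) ->
  exists s, forall c, K c ->
    `|signed_sum s n (fun i => Phi (F c (x i.*2)) - Phi (F c (x i.*2.+1)))|
     <= 2 ^+ 14 * (k0%:R + 1) *
        Num.sqrt (24 * q ^+ 2 * ca * n%:R * Phi B * entropy_rate r Lam lam).
Proof.
move=> n0 Dk Ll hn hx.
set A := entropy_rate r Lam lam.
have Lam0 : 0 < Lam by rewrite (lt_le_trans ltr01).
have LA : Lam <= A.
  rewrite /A /entropy_rate ler_peMr ?(ltW Lam0)//.
  apply: (@le_trans _ _ (1 `^ (r / 2))); first by rewrite powR1.
  by rewrite powR_le_base// ?divr_ge0 ?(ltW r0)// ler_pdivlMr// mul1r.
have A0 : 0 <= A by rewrite (le_trans _ LA)// ltW.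
pose bb := level_log A Lam D0%:R k0.
have bb0 k : 0 <= bb k.
  by rewrite /bb /level_log; case: ifP => _;
    rewrite mulr_ge0// mulr_ge0 ?exprn_ge0// ?(ltW Lam0)// mulr_ge0.
have PB := Phi_sup_bound_ge1.
have q1 := pg_q_ge1 pg.
pose QQ := 24 * q ^+ 2 * ca * n%:R * Phi B.
have QQ1 : 0 < QQ.
  rewrite !mulr_gt0 ?ltr0n//; first by rewrite (lt_le_trans ltr01).
  - by rewrite (lt_le_trans ltr01).
  - by rewrite (lt_le_trans ltr01)// (pg_a_ge1 pg).
  - by rewrite (lt_le_trans ltr01).
pose d k := Num.sqrt QQ * 2^-1 ^+ k.
have sQ : 0 < Num.sqrt QQ by rewrite sqrtr_gt0.
have d0 k : 0 < d k by rewrite mulr_gt0// exprn_gt0// invr_gt0.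
pose V := 'rV[R]_D.
pose good k (p : {J : finType & ((V -> J) * (J -> V))%type}) : Prop :=
  [/\ #|projT1 p|%:R <= expR (bb k),
     forall c, K c -> K ((projT2 p).2 ((projT2 p).1 c)) /\
        forall i, (i < n.*2)%N -> F (c - (projT2 p).2 ((projT2 p).1 c)) (x i) <= scale k * B &
     k = 0%N -> forall j, (projT2 p).2 j = 0].
have /choice[p hp] : forall k, exists p, good k p.
  case=> [|k].
    exists (@existT finType (fun J : finType => ((V -> J) * (J -> V))%type) unit (fun=> tt, fun=> 0)); split => //=.
      by rewrite card_unit -expR0 ler_expR.
    move=> c Kc; split; first exact: unit_class0.
    move=> i _; rewrite subr0 /scale expr0 powR1 mul1r.
    exact: (unit_class_sup fr pg _ Kc).
  have [J [code [hJ hcode]]] := codable_level k0 k.+1 x Ll hn.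
  have /choice[rep hrep] : forall j, exists c, (exists2 c', K c' & code c' = j) -> K c /\ code c = j.
    move=> j; have [[c Kc e]|no] := pselect (exists2 c', K c' & code c' = j).
      by exists c.
    by exists 0 => /no.
  exists (@existT finType (fun J : finType => ((V -> J) * (J -> V))%type) J (code, rep)); split => //= c Kc.
  have [|K1 e1] := hrep (code c); first by exists c.
  by split => // i ni; apply: hcode.
pose J k := projT1 (p k).
pose code k : V -> J k := (projT2 (p k)).1.
pose rep k : J k -> V := (projT2 (p k)).2.
pose Av (c : V) i := Phi (F c (x i.*2)) - Phi (F c (x i.*2.+1)).
(* With n levels beyond k0 the remainder of the chaining is below one level. *)
pose k1 := (k0.+1 + n)%N.
have [k c _ Kc|k _|s hs] := @chaining R V K n k1 Av J code rep d bb d0 bb0.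
- have [_ h2 _] := hp k; have [K' hF] := h2 c Kc.
  set c' := rep k (code k c); rewrite -/(rep k) -/(code k) -/c' in K' hF.
  pose dP i := Phi (F c (x i)) - Phi (F c' (x i)).
  (* (x - y)^2 <= 2 * (x^2 + y^2), the two points of a pair being treated separately. *)
  apply: (@le_trans _ _ (\sum_(i < n) 2 * (dP i.*2 ^+ 2 + dP i.*2.+1 ^+ 2))).
    apply: ler_sum => i _; rewrite -subr_ge0.
    have -> : 2 * (dP i.*2 ^+ 2 + dP i.*2.+1 ^+ 2) - (Av c i - Av c' i) ^+ 2 =
       (dP i.*2 + dP i.*2.+1) ^+ 2 by rewrite /Av /dP; ring.
    exact: sqr_ge0.
  rewrite -mulr_sumr -(sum_double (fun i => dP i ^+ 2)).
  apply: (@le_trans _ _ (2 * \sum_(i < n.*2) q ^+ 2 * ca * scale k `^ r * Phi B *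
     (Phi (F c (x i)) + Phi (F c' (x i))))).
    rewrite ler_wpM2l//; apply: ler_sum => i _.
    by apply: Phi_modf_sqr_dist => //; [exact: ltW | exact: hF].
  rewrite -mulr_sumr big_split /= scale_powR.
  apply: (@le_trans _ _ (2 * (q ^+ 2 * ca * 4^-1 ^+ k * Phi B * (3 * n.*2%:R + 3 * n.*2%:R)))).
    rewrite ler_wpM2l// ler_wpM2l//; last by rewrite lerD ?hx.
    rewrite mulr_ge0 ?(le_trans ler01 PB)// mulr_ge0 ?exprn_ge0//.
    by rewrite mulr_ge0 ?sqr_ge0.
  rewrite /d exprMn sqr_sqrtr ?(ltW QQ1)// /QQ -muln2 natrM.
  have -> : (2^-1 ^+ k) ^+ 2 = 4^-1 ^+ k :> R.
    by rewrite -exprM mulnC exprM; congr (_ ^+ k); field.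
  by move: (4^-1 ^+ k) => z; rewrite le_eqVlt; apply/orP; left; apply/eqP; ring.
- by have [] := hp k.
exists s => c Kc.
have r00 : rep 0%N (code 0%N c) = 0 by have [_ _ h0] := hp 0%N; exact: (h0 erefl).
have := hs c Kc; rewrite r00.
have -> : signed_sum s n (Av 0) = 0.
  by rewrite /signed_sum big1// => i _; rewrite /Av !modf0 subrr mulr0.
rewrite subr0 => /le_trans; apply.
have -> : Num.sqrt (24 * q ^+ 2 * ca * n%:R * Phi B * A) = Num.sqrt QQ * Num.sqrt A.
  by rewrite -sqrtrM// ltW.
have sA1 : 1 <= Num.sqrt A.
  by rewrite -sqrtr1 ler_wsqrtr// (le_trans Lam1).
have h1 : \sum_(k < k1) (d k + d k.+1) * Num.sqrt (8 * (bb k + bb k.+1 + (k%:R + 2)))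
   <= 2 * Num.sqrt QQ * (2 ^+ 10 * Num.sqrt A * (k0%:R + 5)).
  have D1 : 1 <= D0%:R :> R by rewrite ler1n (frame_D0_gt0 fr).
  apply: le_trans (ler_wpM2l _ (chaining_sum_le n Lam1 LA D1 Dk)); last first.
    by rewrite mulr_ge0// ltW.
  rewrite mulr_sumr; apply: ler_sum => k _; rewrite -/bb mulrA.
  rewrite ler_wpM2r ?sqrtr_ge0// /d exprS.
  have : 0 <= Num.sqrt QQ * 2^-1 ^+ k by rewrite ltW// d0.
  by rewrite (mulrCA _ 2^-1) -(mulrA 2); move: (Num.sqrt QQ * _) => *; lra.
have h2 : Num.sqrt n%:R * d k1 <= Num.sqrt QQ * Num.sqrt A.
  rewrite /d mulrCA ler_wpM2l ?(ltW sQ)//; apply: le_trans sA1.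
  rewrite exprVn ler_pdivrMr ?exprn_gt0// mul1r.
  apply: sqrt_le_of_sqr; first by rewrite exprn_ge0.
  apply: (@le_trans _ _ (2 ^+ k1)).
    rewrite -natrX ler_nat (leq_trans _ (ltnW (ltn_expl k1 (ltnSn 1))))//.
    by rewrite /k1 leq_addl.
  by rewrite -exprM ler_weXn2l ?ler1n// muln2 -addnn leq_addr.
apply: (le_trans (lerD h1 h2)).
have SA0 : 0 <= Num.sqrt QQ * Num.sqrt A by rewrite mulr_ge0 ?sqrtr_ge0.
have -> : 2 * Num.sqrt QQ * (2 ^+ 10 * Num.sqrt A * (k0%:R + 5)) + Num.sqrt QQ * Num.sqrt A
   = (2 * 2 ^+ 10 * (k0%:R + 5) + 1) * (Num.sqrt QQ * Num.sqrt A) by ring.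
rewrite ler_wpM2r//.
have -> : 2 ^+ 14 = 16 * 2 ^+ 10 :> R by ring.
have E10 : 1 <= 2 ^+ 10 :> R by rewrite exprn_ege1// ler1n.
have k0R : 0 <= k0%:R :> R by [].
have : 0 <= 2 ^+ 10 * k0%:R :> R by rewrite mulr_ge0// exprn_ge0.
rewrite !mulrDr -!mulrA; move: (2 ^+ 10) (k0%:R) E10 => e kk.
by move: (e * kk) => *; lra.
Qed.

End SignStep.

(** * Sampling from a finite weighted set *)

Section FiniteSampling.
Variables (R : realType) (T : finType) (t0 : T) (D : nat) (a b : T -> 'rV[R]_D).
Variables (w : T -> R) (H : R) (D0 : nat).
Hypothesis fr : frame a b w H D0.
Variables (Phi : R -> R) (ca q r t1 : R).
Hypothesis pg : power_growth Phi ca q r t1.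
Local Notation F := (modf a b).
Local Notation K := (unit_class a b w Phi).
Local Notation B := (sup_bound H ca r t1).

Lemma entropy_rateM (Lam lam k : R) : 0 < Lam -> 0 <= lam -> 1 <= k ->
  entropy_rate r Lam (k * lam) <= k * entropy_rate r Lam lam.
Proof.
move=> L0 l0 k1; have r1 := pg_r_ge1 pg; have r2 := pg_r_le2 pg.
have k0 : 0 <= k by rewrite (le_trans ler01).
rewrite /entropy_rate -mulrA powRM ?divr_ge0 ?(ltW L0)// [leRHS]mulrCA.
rewrite ler_wpM2l ?(ltW L0)// ler_wpM2r ?powR_ge0//.
by apply: ler1_powR => //; move: r2; lra.
Qed.

Lemma ln_doubling (m k : nat) : (0 < m)%N ->
  ln (8 * (m * 2 ^ k)%:R + 1) <= ln (8 * m%:R + 1) + k%:R :> R.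
Proof.
move=> m0; have m1 : 0 < 8 * m%:R + 1 :> R by rewrite ltr_wpDl.
have p2 : 1 <= 2 ^+ k :> R by rewrite exprn_ege1// ler1n.
apply: (@le_trans _ _ (ln ((8 * m%:R + 1) * 2 ^+ k))).
  have q1 : 0 < 8 * (m * 2 ^ k)%:R + 1 :> R by rewrite ltr_wpDl// mulr_ge0.
  have q2 : 0 < (8 * m%:R + 1) * 2 ^+ k :> R by rewrite mulr_gt0 ?exprn_gt0.
  rewrite ler_ln ?posrE//.
  by rewrite natrM natrX [leRHS]mulrDl mul1r -mulrA lerD2l.
rewrite lnM ?posrE ?exprn_gt0// lnXn// lerD2l.
by rewrite -[ln 2 *+ k]mulr_natr ler_piMl// (ln2_bounds R).2.
Qed.

(** The halving from [m * 2 ^ k.+1] to [m * 2 ^ k] points makes an error of order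
    [2 ^- (k / 2)], up to the growth of the logarithm of the sample size, which
    [entropy_rateM] and [ln_doubling] bound by the factor [k.+1].  So the errors are
    dominated by the geometric sequence [e k], and only the last halvings
    determine the required size [m]. *)
Lemma finite_sampling (m k0 : nat) (eps Lam : R) :
  (0 < m)%N -> 0 < eps -> eps <= 1 -> D0%:R <= 2 ^+ k0 :> R -> 1 <= Lam ->
  ln (2 ^+ 29 * H ^+ 13) <= Lam -> ln (5 * D0%:R) <= Lam ->
  2 ^+ 39 * (24 * q ^+ 2 * ca * Phi B * entropy_rate r Lam (ln (8 * m%:R + 1) + Lam)
     * (k0%:R + 1) ^+ 2) <= eps ^+ 2 * m%:R ->
  exists y : nat -> T, forall c, K c ->
    `|avg m y (fun t => Phi (F c t)) - \sum_t w t * Phi (F c t)| <= eps.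
Proof.
move=> m0 eps0 eps1 Dk Lam1 LamH LamD big.
have H1 := frame_H_ge1 fr.
have [m1 [y [m10 m1H y2 yr]]] := coarse_points t0 fr (pg_r_ge1 pg) (pg_r_le2 pg).
have LamY : ln (4 * m1%:R + 1) <= Lam.
  apply: le_trans LamH; have H13 : 1 <= H ^+ 13 by rewrite exprn_ege1.
  have p26 : 1 <= 2 ^+ 26 * H ^+ 13.
    by rewrite -[leLHS]mulr1 ler_pM// exprn_ege1// ler1n.
  have -> : 2 ^+ 29 * H ^+ 13 = 8 * (2 ^+ 26 * H ^+ 13) by ring.
  have q1 : 0 < 4 * m1%:R + 1 :> R by rewrite ltr_wpDl// mulr_ge0.
  have q2 : 0 < 8 * (2 ^+ 26 * H ^+ 13) by rewrite mulr_gt0// (lt_le_trans ltr01).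
  rewrite ler_ln ?posrE//.
  by move: p26 m1H; move: (2 ^+ 26 * _) => *; lra.
set lam := ln (8 * m%:R + 1) + Lam in big *.
have Lam0 : 0 < Lam by rewrite (lt_le_trans ltr01).
have Llam : Lam <= lam by rewrite lerDr ln_ge0// lerDr mulr_ge0.
have lam1 : 1 <= lam by rewrite (le_trans Lam1).
have PB := Phi_sup_bound_ge1 fr pg.
have mR : 0 < m%:R :> R by rewrite ltr0n.
pose X := 24 * q ^+ 2 * ca * Phi B * entropy_rate r Lam lam * (k0%:R + 1) ^+ 2.
pose e k : R := eps / 32 * (3 / 4) ^+ k.
have e0 k : 0 <= e k by rewrite mulr_ge0 ?exprn_ge0 ?divr_ge0 ?(ltW eps0)//; lra.
have sume n : \sum_(k < n) e k <= eps / 2.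
  rewrite -mulr_sumr; apply: (@le_trans _ _ (eps / 32 * 4)).
    by rewrite ler_wpM2l ?sum_geometric_le4// divr_ge0 ?(ltW eps0).
  by move: eps0; lra.
pose G g := exists2 c, K c & g = (fun t => Phi (F c t)).
have GB g : G g -> forall t, `|g t| <= Phi B.
  move=> [c Kc ->] t; rewrite ger0_norm ?(pg_ge0 pg) ?modf_ge0//.
  by rewrite (pg_mono pg) ?modf_ge0// (unit_class_sup fr pg).
have [s [x hx]] := @avg_approx R T t0 w G (Phi B) (eps / 2) m (frame_w_ge0 fr)
   (frame_w_sum fr) GB (divr_gt0 eps0 (ltr0n _ 2)) m0.
have [k z hz||y' hy'] := @halving R T G (fun g => \sum_t w t * g t) m e m0 e0 _ s x
   (eps / 2) hx.
- set n := (m * 2 ^ k)%N in hz *.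
  have n0 : (0 < n)%N by rewrite muln_gt0 m0 expn_gt0.
  have nR : 0 < n%:R :> R by rewrite ltr0n.
  have k1 : 1 <= k.+1%:R :> R by rewrite ler1n.
  have L1 : Lam <= k.+1%:R * lam.
    by apply: le_trans Llam _; rewrite ler_peMl// (le_trans ler01).
  have L2 : ln (4 * n.*2%:R + 1) <= k.+1%:R * lam.
    rewrite -muln2 natrM; have -> : 4 * (n%:R * 2) = 8 * n%:R :> R by ring.
    apply: le_trans (ln_doubling k m0) _.
    have : k%:R * 1 <= k%:R * lam by rewrite ler_wpM2l.
    have : ln (8 * m%:R + 1) <= lam by rewrite lerDl ltW.
    by rewrite -(natr1 k) [(_ + 1) * lam]mulrDl mul1r mulr1; move: (k%:R * lam) => *; lra.
  have [|sg hsg] := @sign_step R T D a b w H D0 fr Phi ca q r t1 pg m1 y Lam y2 yr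
    Lam1 LamY LamD n k0 z (k.+1%:R * lam) n0 Dk L1 L2.
    move=> c Kc; have Gc : G (fun t => Phi (F c t)) by exists c.
    have n20 : (0 < n.*2)%N by rewrite double_gt0.
    have := hz _ Gc; rewrite ler_norml => /andP[_ h].
    have {}h : avg n.*2 z (fun t => Phi (F c t)) <= 3.
      by move: Kc h; rewrite /unit_class; move: (avg _ _ _) (\sum_t _) => *; lra.
    by move: h; rewrite /avg ler_pdivrMl ?ltr0n// mulrC.
  exists sg => g [c Kc ->]; apply: le_trans (hsg c Kc) _.
  have -> : 2 ^+ 14 * (k0%:R + 1) *
     Num.sqrt (24 * q ^+ 2 * ca * n%:R * Phi B * entropy_rate r Lam (k.+1%:R * lam)) =
     Num.sqrt ((2 ^+ 14 * (k0%:R + 1)) ^+ 2 * (24 * q ^+ 2 * ca * n%:R * Phi B *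
       entropy_rate r Lam (k.+1%:R * lam))).
    rewrite [RHS]sqrtrM ?sqr_ge0// sqrtr_sqr ger0_norm//.
  apply: sqrt_le_of_sqr; first by rewrite mulr_ge0// mulr_ge0// ltW.
  (* The linear factor is absorbed by the gap between 1 / 2 and (3 / 4)^2 = 9 / 16. *)
  have h9 : k.+1%:R <= 8 * (9 / 8) ^+ k :> R.
    elim: (k) => [|j IH]; first by rewrite expr0; lra.
    have h : 1 <= (9 / 8) ^+ j :> R by rewrite exprn_ege1//; lra.
    by rewrite -[j.+2%:R]natr1 exprS; move: h IH; move: (_ ^+ j) => *; lra.
  have QP : 0 <= 24 * q ^+ 2 * ca * n%:R * Phi B.
    rewrite mulr_ge0 ?(le_trans ler01 PB)// mulr_ge0// mulr_ge0 ?(le_trans ler01 (pg_a_ge1 pg))//.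
    by rewrite mulr_ge0 ?sqr_ge0.
  apply: (@le_trans _ _ (2 ^+ 28 * n%:R * X * k.+1%:R)).
    apply: (@le_trans _ _ ((2 ^+ 14 * (k0%:R + 1)) ^+ 2 * (24 * q ^+ 2 * ca * n%:R * Phi B *
       (k.+1%:R * entropy_rate r Lam lam)))).
      rewrite ler_wpM2l ?sqr_ge0// ler_wpM2l// entropy_rateM//.
      by rewrite (le_trans ler01).
    have -> : 2 ^+ 28 = (2 ^+ 14) ^+ 2 :> R by rewrite -exprM.
    by rewrite /X le_eqVlt; apply/orP; left; apply/eqP; move: (2 ^+ 14) => *; ring.
  have X0 : 0 <= X.
    rewrite mulr_ge0 ?sqr_ge0// mulr_ge0//.
      rewrite mulr_ge0 ?(le_trans ler01 PB)// mulr_ge0 ?(le_trans ler01 (pg_a_ge1 pg))//.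
      by rewrite mulr_ge0 ?sqr_ge0.
    by rewrite /entropy_rate mulr_ge0 ?powR_ge0 ?(ltW Lam0).
  have h3 : 2 ^+ 36 * X * k.+1%:R <= n%:R * (eps ^+ 2 * (9 / 16) ^+ k).
    apply: (@le_trans _ _ (2 ^+ 36 * X * (8 * (9 / 8) ^+ k))).
      by rewrite ler_wpM2l// mulr_ge0 ?exprn_ge0.
    have -> : 2 ^+ 36 * X * (8 * (9 / 8) ^+ k) = 2 ^+ 39 * X * (9 / 8) ^+ k.
      rewrite -[39%N]/(36 + 3)%N exprD; move: (2 ^+ 36) ((9 / 8) ^+ k) => *; ring.
    apply: (@le_trans _ _ (eps ^+ 2 * m%:R * (9 / 8) ^+ k)).
      by rewrite ler_wpM2r// exprn_ge0//; lra.
    rewrite /n natrM natrX.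
    have -> : (9 / 8) ^+ k = 2 ^+ k * (9 / 16) ^+ k :> R.
      by rewrite -exprMn; congr (_ ^+ k); field.
    by rewrite le_eqVlt; apply/orP; left; apply/eqP; move: (2 ^+ k) ((9 / 16) ^+ k) => *; ring.
  have -> : (2 * n%:R * e k) ^+ 2 = n%:R * (n%:R * (eps ^+ 2 * (9 / 16) ^+ k)) / 2 ^+ 8.
    rewrite /e; have -> : (9 / 16) ^+ k = ((3 / 4) ^+ k) ^+ 2 :> R.
      by rewrite -exprM mulnC exprM; congr (_ ^+ k); field.
    by move: (_ ^+ k) => u; field.
  rewrite ler_pdivlMr ?exprn_gt0//.
  have -> : 2 ^+ 28 * n%:R * X * k.+1%:R * 2 ^+ 8 = n%:R * (2 ^+ 36 * X * k.+1%:R).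
    by rewrite -[36%N]/(28 + 8)%N exprD; move: (2 ^+ 28) (2 ^+ 8) => *; ring.
  by rewrite ler_pM2l.
- by have := sume s; move: eps1; move: (\sum_(_ < s) _) => *; lra.
exists y' => c Kc; have Gc : G (fun t => Phi (F c t)) by exists c.
apply: le_trans (hy' _ Gc) _.
by have := sume s; move: (\sum_(_ < s) _) => *; lra.
Qed.

End FiniteSampling.

(** * Bounded measurable functions and orthonormalization *)

Section BoundedMeasurable.
Context (R : realType) (d : measure_display) (T : measurableType d).
Variable mu : probability T R.
Implicit Types f g : T -> R.

Definition bounded_measurable (f : T -> R) : Prop :=
  measurable_fun setT f /\ exists M, forall x, `|f x| <= M.

Lemma bounded_measurable_integrable f : bounded_measurable f ->
  mu.-integrable setT (EFin \o f).
Proof.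
move=> [mf [M hM]]; apply: measurable_bounded_integrable => //.
  by apply: (le_lt_trans (probability_le1 mu measurableT)); rewrite ltry.
exists M; split; first exact: num_real.
by move=> x Mx y _; exact: (le_trans (hM y) (ltW Mx)).
Qed.

Lemma bounded_measurable_cst (k : R) : bounded_measurable (fun=> k).
Proof. by split; [exact: measurable_cst | exists `|k|]. Qed.

Lemma bounded_measurableD f g : bounded_measurable f -> bounded_measurable g ->
  bounded_measurable (fun x => f x + g x).
Proof.
move=> [mf [M hM]] [mg [N hN]]; split; first exact: measurable_funD.
by exists (M + N) => x; rewrite (le_trans (ler_normD _ _))// lerD.
Qed.

Lemma bounded_measurableM f g : bounded_measurable f -> bounded_measurable g ->
  bounded_measurable (fun x => f x * g x).
Proof.
move=> [mf [M hM]] [mg [N hN]]; split; first exact: measurable_funM.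
by exists (M * N) => x; rewrite normrM ler_pM.
Qed.

Lemma bounded_measurableZ (k : R) f : bounded_measurable f ->
  bounded_measurable (fun x => k * f x).
Proof. exact/bounded_measurableM/bounded_measurable_cst. Qed.

Lemma bounded_measurable_sum (I : Type) (s : seq I) (f : I -> T -> R) :
  (forall i, bounded_measurable (f i)) ->
  bounded_measurable (fun x => \sum_(i <- s) f i x).
Proof.
move=> h; elim: s => [|i s IH].
  rewrite (_ : (fun x => _) = fun=> 0); last by apply/funext => x; rewrite big_nil.
  exact: bounded_measurable_cst.
rewrite (_ : (fun x => _) = fun x => f i x + \sum_(j <- s) f j x).
  exact: bounded_measurableD.
by apply/funext => x; rewrite big_cons.
Qed.

Lemma Rintegral_sum (I : Type) (s : seq I) (f : I -> T -> R) :
  (forall i, bounded_measurable (f i)) ->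
  \int[mu]_x (\sum_(i <- s) f i x) = \sum_(i <- s) \int[mu]_x f i x.
Proof.
move=> h; elim: s => [|i s IH].
  rewrite big_nil; under eq_Rintegral => x _ do rewrite big_nil.
  by rewrite Rintegral_cst// mul0r.
rewrite big_cons -IH; under eq_Rintegral => x _ do rewrite big_cons.
rewrite RintegralD//; first exact: bounded_measurable_integrable.
exact/bounded_measurable_integrable/bounded_measurable_sum.
Qed.

Lemma Rintegral_scale (k : R) f : bounded_measurable f ->
  \int[mu]_x (k * f x) = k * \int[mu]_x f x.
Proof. by move=> h; rewrite RintegralZl//; exact: bounded_measurable_integrable. Qed.

Lemma Rintegral_dist f g (e : R) : bounded_measurable f -> bounded_measurable g ->
  (forall x, `|f x - g x| <= e) -> `|\int[mu]_x f x - \int[mu]_x g x| <= e.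
Proof.
move=> hf hg h; have inf := bounded_measurable_integrable hf.
have ing := bounded_measurable_integrable hg.
have ie k := bounded_measurable_integrable (bounded_measurable_cst k).
have Ee k : \int[mu]_x k = k :> R.
  rewrite Rintegral_cst//; have := @probability_setT _ _ _ mu.
  by move=> /= ->; rewrite mulr1.
rewrite ler_norml; apply/andP; split.
- rewrite lerBrDr -(Ee (- e)) -RintegralD//; apply: le_Rintegral => //.
    exact/bounded_measurable_integrable/bounded_measurableD/hg/bounded_measurable_cst.
  by move=> x _; have := h x; rewrite ler_norml => /andP[] *; lra.
- rewrite lerBlDr -(Ee e) -RintegralD//; apply: le_Rintegral => //.
    exact/bounded_measurable_integrable/bounded_measurableD/hg/bounded_measurable_cst.
  by move=> x _; have := h x; rewrite ler_norml => /andP[] *; lra.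
Qed.

Lemma integral_Rintegral f : bounded_measurable f ->
  (\int[mu]_x (f x)%:E)%E = (\int[mu]_x f x)%:E.
Proof.
move=> hf; rewrite /Rintegral fineK//.
exact: integrable_fin_num (bounded_measurable_integrable hf).
Qed.

Lemma Rintegral_finite_range (J : finType) (code : T -> J) (h : J -> R) :
  (forall j, measurable [set x | code x = j]) ->
  bounded_measurable (fun x => h (code x)) /\
  \int[mu]_x h (code x) = \sum_j h j * fine (mu [set x | code x = j]).
Proof.
move=> mc.
have hE : (fun x => h (code x)) = fun x => \sum_j h j * \1_[set x | code x = j] x.
  apply/funext => x; rewrite (bigD1 (code x))//= big1 ?addr0.
    by rewrite indicE mem_set//= mulr1.
  move=> j jx; rewrite indicE memNset ?mulr0//=.
  by move=> e; rewrite e eqxx in jx.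
have bi j : bounded_measurable (\1_[set x | code x = j] : T -> R).
  split; first exact: measurable_indic.
  by exists 1 => x; rewrite indicE; case: (_ \in _); rewrite /= ?normr1 ?normr0.
rewrite hE; split.
  by apply: bounded_measurable_sum => j; exact: bounded_measurableZ.
rewrite Rintegral_sum; last by move=> j; exact: bounded_measurableZ.
apply: eq_bigr => j _; rewrite Rintegral_scale//; congr (_ * _).
by rewrite /Rintegral integral_indic// setIT.
Qed.

Lemma finite_code_1 f (e : R) : bounded_measurable f -> 0 < e ->
  exists (m : nat) (code : T -> 'I_m.+1),
   (forall j, measurable [set x | code x = j]) /\
   forall x y, code x = code y -> `|f x - f y| <= e.
Proof.
move=> [mf [M hM]] e0.
have f0 x : 0 <= (f x + M) / e.
  by rewrite divr_ge0 ?(ltW e0)//; have := hM x; rewrite ler_norml => /andP[] *; lra.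
pose m := Num.truncn (2 * M / e).
have tm x : (Num.truncn ((f x + M) / e) < m.+1)%N.
  rewrite ltnS; apply: le_truncn; rewrite ler_pM2r ?invr_gt0//.
  by have := hM x; rewrite ler_norml => /andP[] *; lra.
pose code x : 'I_m.+1 := inord (Num.truncn ((f x + M) / e)).
have codeE x j : code x = j <-> j%:R * e - M <= f x < j.+1%:R * e - M.
  have -> : (j%:R * e - M <= f x < j.+1%:R * e - M) =
            (j%:R <= (f x + M) / e < j.+1%:R).
    by rewrite lerBlDr ltrBrDr ler_pdivlMr// ltr_pdivrMr.
  rewrite -truncn_eq//; split => [<-|/eqP h]; first by rewrite inordK.
  by apply: val_inj; rewrite /= inordK.
exists m, code; split => [j|x y exy].
  rewrite (_ : [set x | _] = setT `&` f @^-1` [set` `[j%:R * e - M, j.+1%:R * e - M[]).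
    by apply: mf => //; exact: measurable_itv.
  apply/seteqP; split => x /=; first by rewrite in_itv/= => /codeE.
  by rewrite in_itv/= => -[_ /codeE].
have /codeE/andP[x1 x2] := exy; have /codeE/andP[y1 y2] := erefl (code y).
move: x1 x2 y1 y2; rewrite -(natr1 (code y)) mulrDl mul1r.
by move: (_ * e) => z *; rewrite ler_norml; apply/andP; split; lra.
Qed.

(** A partition into measurable cells on each of which all the functions [f i] oscillate
    by at most [e]. *)
Lemma finite_code (I : finType) (f : I -> T -> R) (e : R) :
  (forall i, bounded_measurable (f i)) -> 0 < e ->
  exists (J : finType) (code : T -> J),
   (forall j, measurable [set x | code x = j]) /\
   forall x y, code x = code y -> forall i, `|f i x - f i y| <= e.
Proof.
move=> hf e0.
have /choice[m hm] : forall i, exists m : nat, exists code : T -> 'I_m.+1,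
   (forall j, measurable [set x | code x = j]) /\
   forall x y, code x = code y -> `|f i x - f i y| <= e.
  by move=> i; exact: finite_code_1.
pose M := \max_i m i.
have /choice[code hcode] : forall i, exists code : T -> 'I_M.+1,
   (forall j, measurable [set x | code x = j]) /\
   forall x y, code x = code y -> `|f i x - f i y| <= e.
  move=> i; have [c [h1 h2]] := hm i.
  have iM : (m i <= M)%N by exact: leq_bigmax.
  exists (fun x => widen_ord (iM : (m i < M.+1)%N) (c x)); split => [j|x y exy].
    have [jm|jm] := ltnP j (m i).+1.
      rewrite (_ : [set x | _] = [set x | c x = Ordinal jm])//.
      apply/seteqP; split => x /= h; first by apply: val_inj; rewrite /= -h.
      by apply: val_inj; rewrite /= h.
    rewrite (_ : [set x | _] = set0)//; apply/seteqP; split => x //= h.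
    by move: jm; rewrite -h /= leqNgt ltn_ord.
  by apply: h2; apply: val_inj; have /(congr1 val) := exy.
exists {ffun I -> 'I_M.+1}, (fun x => [ffun i => code i x]); split => [j|x y exy i].
  rewrite (_ : [set x | _] = \bigcap_(i in [set: I]) [set x | code i x = j i]).
    by apply: fin_bigcap_measurable => // i _; exact: (hcode i).1.
  apply/seteqP; split => x /=; first by move=> <- i _ /=; rewrite ffunE.
  by move=> h; apply/ffunP => i; rewrite ffunE; exact: h.
by apply: (hcode i).2; have /ffunP/(_ i) := exy; rewrite !ffunE.
Qed.

End BoundedMeasurable.

Section Orthonormalization.
Variable R : realType.

(** A maximal orthonormal family for a semidefinite form [G]: the residual of the
    orthogonal projection onto its span is isotropic, since otherwise it could
    be normalized and added to the family. *)
Lemma exists_orthonormal (n : nat) (G : 'M[R]_n) : G^T = G ->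
  (forall c : 'rV_n, 0 <= (c *m G *m c^T) 0 0) ->
  exists (D : nat) (P : 'M[R]_(D, n)), [/\ (D <= n)%N, P *m G *m P^T = 1%:M &
    forall c : 'rV_n, exists c' : 'rV_D,
      ((c - c' *m P) *m G *m (c - c' *m P)^T) 0 0 = 0].
Proof.
move=> Gs G0.
(* Orthonormality bounds D by the rank, so that a maximal D exists. *)
pose ok D := `[< exists P : 'M[R]_(D, n), P *m G *m P^T = 1%:M >].
have ok0 : exists D, ok D by exists 0%N; apply/asboolP; exists 0; apply/matrixP => -[].
have okn D : ok D -> (D <= n)%N.
  move=> /asboolP[P hP]; have := mxrank1 R D; rewrite -hP => <-.
  by rewrite -mulmxA (leq_trans (mxrankM_maxl _ _))// rank_leq_col.
case: (ex_maxnP ok0 okn) => D /asboolP[P hP] Dmax.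
exists D, P; split => //; first by apply: okn; apply/asboolP; exists P.
move=> c; exists (c *m G *m P^T); set c' := c *m G *m P^T.
set u := c - c' *m P; have uP : u *m G *m P^T = 0.
  have e : c' *m P *m G *m P^T = c'.
    by rewrite -[RHS]mulmx1 -hP !mulmxA.
  by rewrite /u 2!mulmxBl e subrr.
apply/eqP; case: ltrgtP (G0 u) => // u0 _; exfalso.
suff /Dmax : ok D.+1 by rewrite ltnn.
apply/asboolP.
set s := (u *m G *m u^T) 0 0 in u0; pose v := (Num.sqrt s)^-1 *: u.
have vP : v *m G *m P^T = 0 by rewrite /v -!scalemxAl uP scaler0.
have Pv : P *m G *m v^T = 0.
  by apply: trmx_inj; rewrite !trmx_mul trmxK Gs mulmxA vP trmx0.
have vv : v *m G *m v^T = 1%:M.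
  apply/matrixP => i j; rewrite !ord1 /v linearZ /= -!scalemxAl -scalemxAr !mxE eqxx.
  have -> : \sum_j (u *m G) 0 j * u^T j 0 = s by rewrite /s mxE.
  by rewrite mulrA -invfM -expr2 sqr_sqrtr ?ltW// mulVf// gt_eqF.
have hQ : col_mx v P *m G *m (col_mx v P)^T = 1%:M.
  by rewrite mul_col_mx tr_col_mx mul_col_row vv vP Pv hP -scalar_mx_block.
by exists (col_mx v P : 'M[R]_(1 + D, n)); exact: hQ.
Qed.

End Orthonormalization.

(** * Orthonormal coordinates *)

Section Discretization.
Context (R : realType) (d : measure_display) (Om : measurableType d).
Variables (mu : probability Om R) (n : nat) (al be : Om -> 'rV[R]_n) (H : R).
Hypotheses (mal : forall i, measurable_fun setT (fun x => al x 0 i))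
  (mbe : forall i, measurable_fun setT (fun x => be x 0 i))
  (H1 : 1 <= H)
  (NI : forall c x, modf al be c x <=
     H * Num.sqrt (\int[mu]_y (modf al be c y ^+ 2))).
Local Notation F := (modf al be).
Let H0 : 0 < H. Proof. exact: lt_le_trans H1. Qed.

Lemma bounded_measurable_dot c :
  bounded_measurable (fun x => dot c (al x)) /\
  bounded_measurable (fun x => dot c (be x)).
Proof.
split; apply: bounded_measurable_sum => i; apply: bounded_measurableZ.
- split; first exact: mal.
  exists (H * Num.sqrt (\int[mu]_y (F (delta_mx 0 i) y ^+ 2))) => x.
  by apply: le_trans (NI _ x); rewrite -dot_delta; exact: (dot_le_modf al be _ x).1.
- split; first exact: mbe.
  exists (H * Num.sqrt (\int[mu]_y (F (delta_mx 0 i) y ^+ 2))) => x.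
  by apply: le_trans (NI _ x); rewrite -dot_delta; exact: (dot_le_modf al be _ x).2.
Qed.

Lemma bounded_measurable_modf c : bounded_measurable (F c).
Proof.
have [[m1 _] [m2 _]] := bounded_measurable_dot c; split; last first.
  exists (H * Num.sqrt (\int[mu]_y (F c y ^+ 2))) => x.
  by rewrite ger0_norm ?modf_ge0.
rewrite (_ : F c = (fun y : R => y `^ 2^-1) \o
   (fun x => dot c (al x) ^+ 2 + dot c (be x) ^+ 2)).
  apply: measurableT_comp; first exact: measurable_powR.
  by apply: measurable_funD; exact: measurable_funX.
by apply/funext => x /=; rewrite powR12_sqrt// addr_ge0// sqr_ge0.
Qed.

Definition gram : 'M[R]_n :=
  \matrix_(i, j) \int[mu]_x (al x 0 i * al x 0 j + be x 0 i * be x 0 j).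

Lemma gramE c : \int[mu]_x (F c x ^+ 2) = (c *m gram *m c^T) 0 0.
Proof.
have bal i : bounded_measurable (fun x => al x 0 i).
  rewrite (_ : (fun x => _) = fun x => dot (delta_mx 0 i) (al x)).
    exact: (bounded_measurable_dot _).1.
  by apply/funext => x; rewrite dot_delta.
have bbe i : bounded_measurable (fun x => be x 0 i).
  rewrite (_ : (fun x => _) = fun x => dot (delta_mx 0 i) (be x)).
    exact: (bounded_measurable_dot _).2.
  by apply/funext => x; rewrite dot_delta.
have bg i j : bounded_measurable (fun x => al x 0 i * al x 0 j + be x 0 i * be x 0 j).
  by apply: bounded_measurableD; exact: bounded_measurableM.
have E x : F c x ^+ 2 = \sum_j \sum_i (c 0 j * c 0 i) *
    (al x 0 i * al x 0 j + be x 0 i * be x 0 j).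
  rewrite sqr_modf /dot !expr2 !big_distrlr/= -big_split/=; apply: eq_bigr => j _.
  by rewrite -big_split/=; apply: eq_bigr => i _; ring.
under eq_Rintegral => x _ do rewrite E.
rewrite Rintegral_sum; last first.
  by move=> j; apply: bounded_measurable_sum => i; exact: bounded_measurableZ.
rewrite mxE; apply: eq_bigr => j _; rewrite Rintegral_sum; last first.
  by move=> i; exact: bounded_measurableZ.
rewrite !mxE mulr_suml; apply: eq_bigr => i _.
by rewrite Rintegral_scale// !mxE; ring.
Qed.

Lemma gram_sym : gram^T = gram.
Proof.
apply/matrixP => i j; rewrite !mxE; apply: eq_Rintegral => x _.
by rewrite mulrC [be x 0 j * _]mulrC.
Qed.

(** The Gram form may be degenerate.  A vector in its kernel defines a function which
    vanishes everywhere and not only almost everywhere, by the inequality between the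
    uniform and the quadratic norm; so discarding the kernel loses no function. *)
Lemma orthonormal_coordinates : exists (D : nat) (P : 'M[R]_(D, n)),
  [/\ (D <= n)%N,
    forall c', \int[mu]_x (F (c' *m P) x ^+ 2) = dot c' c' &
    forall c, exists c' : 'rV_D, forall x, F c x = F (c' *m P) x].
Proof.
have [|D [P [Dn PP hP]]] := exists_orthonormal gram_sym.
  by move=> c; rewrite -gramE; apply: Rintegral_ge0 => x _; exact: sqr_ge0.
exists D, P; split => // [c'|c].
  rewrite gramE trmx_mul !mulmxA -(mulmxA c' P) -(mulmxA c' (P *m _)) PP mulmx1 mxE.
  by apply: eq_bigr => i _; rewrite mxE.
have [c' hc'] := hP c; exists c' => x.
rewrite -gramE in hc'.
have := NI (c - c' *m P) x; rewrite hc' sqrtr0 mulr0 => h.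
apply/eqP; rewrite -subr_eq0 -normr_eq0 eq_le normr_ge0 andbT.
by apply: le_trans h; exact: modf_dist.
Qed.

Variables (Phi : R -> R) (ca q r t1 : R).
Hypothesis pg : power_growth Phi ca q r t1.

Lemma bounded_measurable_Phi_modf c : bounded_measurable (fun x => Phi (F c x)).
Proof.
have [mF [M hM]] := bounded_measurable_modf c; split; last first.
  exists (Phi M) => x.
  have FM : F c x <= M by apply: le_trans (hM x); exact: ler_norm.
  by rewrite ger0_norm ?(pg_ge0 pg) ?modf_ge0// (pg_mono pg) ?modf_ge0.
rewrite (_ : (fun x => _) = (fun y => Phi (Num.max y 0)) \o F c).
  apply: measurableT_comp => //; apply: nondecreasing_measurable => //.
  move=> x y xy; apply: (pg_mono pg); first by rewrite le_max lexx orbT.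
  by rewrite ge_max !le_max xy lexx !orbT.
by apply/funext => x /=; rewrite max_l// modf_ge0.
Qed.

(** The uniform bound for the functions of modular at most 1. *)
Definition modular_bound : R := (H ^+ 2 * moment_bound ca r t1) `^ r^-1.

(** The argument of [unit_class_norm], for integrals. *)
Lemma modular_class_bound (D : nat) (P : 'M[R]_(D, n)) (c' : 'rV_D) :
  \int[mu]_x (F (c' *m P) x ^+ 2) = dot c' c' ->
  \int[mu]_x Phi (F (c' *m P) x) <= 1 ->
  H * Num.sqrt (dot c' c') <= modular_bound.
Proof.
move=> hc hPhi; set c := c' *m P in hc hPhi *.
have r1 := pg_r_ge1 pg; have r2 := pg_r_le2 pg; have r0 : 0 < r by lra.
have C1 := moment_bound_ge1 pg.
have C10 : 0 <= moment_bound ca r t1 by rewrite (le_trans ler01).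
have := dot_ge0 c'; rewrite le_eqVlt => /orP[/eqP <-|c0].
  by rewrite sqrtr0 mulr0 powR_ge0.
set N := Num.sqrt (dot c' c').
have N0 : 0 < N by rewrite sqrtr_gt0.
have N2 : N ^+ 2 = dot c' c' by rewrite sqr_sqrtr ?ltW.
have HN : 0 < H * N by rewrite mulr_gt0.
have FN x : F c x <= H * N by rewrite /N -hc.
have bP := bounded_measurable_Phi_modf c.
have bF := bounded_measurable_modf c.
have h : N ^+ 2 <= (H * N) `^ (2 - r) * moment_bound ca r t1.
  rewrite N2 -hc.
  apply: (@le_trans _ _ (\int[mu]_x ((H * N) `^ (2 - r) * (t1 `^ r * (1 + ca * Phi (F c x)))))).
    apply: le_Rintegral => //.
    - apply: bounded_measurable_integrable; rewrite (_ : (fun x => _) = fun x => F c x * F c x).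
        exact: bounded_measurableM.
      by apply/funext => x; rewrite expr2.
    - apply: bounded_measurable_integrable; do 2 apply: bounded_measurableZ.
      by apply: bounded_measurableD; [exact: bounded_measurable_cst | exact: bounded_measurableZ].
    move=> x _; apply: le_trans (sqr_le_powR r1 r2 (modf_ge0 _ _ _ _) (FN x)) _.
    by rewrite ler_wpM2l ?powR_ge0// (powR_le_Phi pg) ?modf_ge0.
  have b1 : bounded_measurable (fun x => 1 + ca * Phi (F c x)).
    by apply: bounded_measurableD; [exact: bounded_measurable_cst | exact: bounded_measurableZ].
  rewrite Rintegral_scale; last exact: bounded_measurableZ.
  rewrite ler_wpM2l ?powR_ge0// Rintegral_scale// ler_wpM2l ?powR_ge0//.
  rewrite RintegralD//; last 2 first.
  - exact/bounded_measurable_integrable/bounded_measurable_cst.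
  - exact/bounded_measurable_integrable/bounded_measurableZ.
  rewrite Rintegral_scale// Rintegral_cst//; have := @probability_setT _ _ _ mu.
  move=> /= ->; rewrite mulr1 lerD2l.
  have ca0 : 0 <= ca by rewrite (le_trans ler01 (pg_a_ge1 pg)).
  have := ler_wpM2l ca0 hPhi; rewrite mulr1; move: (ca * _) => *; lra.
have hr : (H * N) `^ r <= modular_bound `^ r.
  rewrite /modular_bound -powRrM mulVf ?gt_eqF// powRr1; last first.
    by rewrite mulr_ge0// sqr_ge0.
  rewrite -(ler_pM2l (powR_gt0 (2 - r) HN)).
  have <- : (H * N) ^+ 2 = (H * N) `^ (2 - r) * (H * N) `^ r.
    by rewrite -powRD ?subrK ?powR_mulrn ?(ltW HN)// (gt_eqF HN) implybT.
  by rewrite exprMn [leRHS]mulrCA ler_wpM2l ?sqr_ge0.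
rewrite leNgt; apply/negP => hlt; move: hr; rewrite leNgt => /negP; apply.
by apply: gt0_ltr_powR => //; rewrite nnegrE ?powR_ge0// ltW.
Qed.

End Discretization.

(** * Discretization of the measure *)

Section Cells.
Context (R : realType) (d : measure_display) (Om : measurableType d).
Variables (mu : probability Om R) (n : nat) (al be : Om -> 'rV[R]_n) (H : R).
Hypotheses (mal : forall i, measurable_fun setT (fun x => al x 0 i))
  (mbe : forall i, measurable_fun setT (fun x => be x 0 i))
  (H1 : 1 <= H)
  (NI : forall c x, modf al be c x <=
     H * Num.sqrt (\int[mu]_y (modf al be c y ^+ 2))).
Variables (Phi : R -> R) (ca q r t1 : R).
Hypothesis pg : power_growth Phi ca q r t1.
Local Notation F := (modf al be).
Let H0 : 0 < H. Proof. exact: lt_le_trans H1. Qed.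

Lemma cell_average (J : finType) (code : Om -> J) (z : J -> Om) (g : Om -> R) (e : R) :
  (forall j, measurable [set x | code x = j]) -> bounded_measurable g ->
  (forall x, `|g x - g (z (code x))| <= e) ->
  `|\sum_j fine (mu [set x | code x = j]) * g (z j) - \int[mu]_x g x| <= e.
Proof.
move=> mc bg hg.
have [bh hE] := @Rintegral_finite_range R _ Om mu J code (fun j => g (z j)) mc.
rewrite (eq_bigr (fun j => g (z j) * fine (mu [set x | code x = j]))); last first.
  by move=> j _; rewrite mulrC.
rewrite -hE distrC; exact: Rintegral_dist.
Qed.

Lemma sum_cell_weights (J : finType) (code : Om -> J) :
  (forall j, measurable [set x | code x = j]) ->
  \sum_j fine (mu [set x | code x = j]) = 1.
Proof.
move=> mc; have [_] := @Rintegral_finite_range R _ Om mu J code (fun=> 1) mc.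
rewrite Rintegral_cst//; have := @probability_setT _ _ _ mu.
move=> /= ->; rewrite mulr1 => ->.
by apply: eq_bigr => j _; rewrite mul1r.
Qed.

(** Uniform continuity of [Phi] on bounded intervals follows from [Phi_sqr_dist]. *)
Lemma Phi_uniform (M e : R) : 0 < M -> 0 < e -> exists2 tau, 0 < tau &
  forall s t, 0 <= s -> s <= M -> 0 <= t -> t <= M -> `|s - t| <= tau ->
   `|Phi s - Phi t| <= e.
Proof.
move=> M0 e0; have r1 := pg_r_ge1 pg; have r0 : 0 < r by lra.
have ca1 := pg_a_ge1 pg; have q1 := pg_q_ge1 pg.
have PM := pg_ge0 pg (ltW M0).
pose Y := q ^+ 2 * ca * (Phi M ^+ 2 + 1).
have Y0 : 0 < Y.
  rewrite mulr_gt0//; last by rewrite ltr_wpDl// sqr_ge0.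
  by rewrite mulr_gt0 ?exprn_gt0// (lt_le_trans ltr01).
pose sg := (e ^+ 2 / Y) `^ r^-1.
have sg0 : 0 < sg by rewrite powR_gt0// divr_gt0// exprn_gt0.
have sgr : sg `^ r = e ^+ 2 / Y.
  by rewrite /sg -powRrM mulVf ?gt_eqF// powRr1// divr_ge0 ?sqr_ge0// ltW.
exists (sg * M); first by rewrite mulr_gt0.
move=> s t; wlog st : s t / s <= t.
  move=> wl s0 sM t0 tM h; have [st|/ltW ts] := leP s t; first exact: wl.
  by rewrite distrC; apply: wl => //; rewrite distrC.
move=> s0 sM t0 tM h.
rewrite -ler_sqr ?nnegrE ?(ltW e0)// real_normK ?num_real// -sqrrN opprB.
have h' : t - s <= sg * M.
  by apply: le_trans h; rewrite distrC ler_norm.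
apply: le_trans (Phi_sqr_dist pg s0 st tM (ltW sg0) h') _.
have Pt0 := pg_ge0 pg t0; have PtM := pg_mono pg t0 tM.
rewrite sgr; apply: (@le_trans _ _ (q ^+ 2 * ca * (e ^+ 2 / Y) * (Phi M ^+ 2 + 1))).
  rewrite -[leLHS]mulrA ler_wpM2l//.
    by rewrite mulr_ge0 ?divr_ge0 ?sqr_ge0 ?(ltW Y0)// mulr_ge0 ?sqr_ge0// (le_trans ler01).
  by rewrite (@le_trans _ _ (Phi M * Phi M)) ?ler_wpM2l// -expr2 lerDl.
have -> : q ^+ 2 * ca * (e ^+ 2 / Y) * (Phi M ^+ 2 + 1) = e ^+ 2 / Y * Y by rewrite /Y; ring.
by rewrite divfK// gt_eqF.
Qed.

(** The measure is concentrated on one point of each cell of a partition on which the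
    orthonormal basis oscillates by at most [delta].  For the lower frame bound, [delta]
    of order [(D * H)^-1] is enough; for the modulars, the uniform bound
    [modular_bound] makes the continuity of [Phi] uniform. *)
Lemma discretization (eta : R) : 0 < eta ->
  exists (D : nat) (P : 'M[R]_(D, n)) (T : finType) (t0 : T) (z : T -> Om) (w : T -> R),
  [/\ (D <= n)%N,
    forall c, exists c' : 'rV_D, forall x, F c x = F (c' *m P) x,
    frame (fun t => al (z t) *m P^T) (fun t => be (z t) *m P^T) w H (maxn D 1) &
    forall c' : 'rV_D, \int[mu]_x Phi (F (c' *m P) x) <= 1 ->
      `|\sum_t w t * Phi (F (c' *m P) (z t)) - \int[mu]_x Phi (F (c' *m P) x)| <= eta].
Proof.
move=> eta0.
have r1 := pg_r_ge1 pg; have r0 : 0 < r by lra.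
have C10 : 0 < moment_bound ca r t1 := lt_le_trans ltr01 (moment_bound_ge1 pg).
have [D [P [Dn hE hP]]] := orthonormal_coordinates mal mbe NI.
pose M := modular_bound H ca r t1.
have M0 : 0 < M by rewrite powR_gt0// mulr_gt0// exprn_gt0.
have [tau tau0 htau] := Phi_uniform M0 eta0.
pose D1 : R := (maxn D 1)%:R.
have D11 : 1 <= D1 by rewrite ler1n leq_maxr.
have D10 : 0 < D1 by rewrite (lt_le_trans ltr01).
have DD1 : D%:R <= D1 by rewrite ler_nat leq_maxl.
have FH c' x : F (c' *m P) x <= H * Num.sqrt (dot c' c') by rewrite -hE.
(* The first bound serves the quadratic forms, the second one the modulars. *)
pose delta := Num.min (8 * D1 * H)^-1 (tau * H / (2 * D1 * M)).
have delta0 : 0 < delta.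
  rewrite lt_min invr_gt0; apply/andP; split; first by rewrite mulr_gt0// mulr_gt0.
  by rewrite divr_gt0// mulr_gt0// mulr_gt0.
have dd1 : delta <= (8 * D1 * H)^-1 by rewrite ge_min lexx.
have dd2 : delta <= tau * H / (2 * D1 * M) by rewrite ge_min lexx orbT.
pose f (i : 'I_D * bool) (x : Om) : R :=
  if i.2 then dot (row i.1 P) (al x) else dot (row i.1 P) (be x).
have bf i : bounded_measurable (f i).
  have [h1 h2] := bounded_measurable_dot mal mbe NI (row i.1 P).
  by rewrite /f; case: (i.2).
have [T [code [mcode hcode]]] := finite_code bf delta0.
have /choice[z hz] : forall t, exists x, (exists y, code y = t) -> code x = t.
  move=> t; have [[y hy]|no] := pselect (exists y, code y = t); first by exists y.
  by exists point => /no.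
have codez x : code (z (code x)) = code x by apply: hz; exists x.
have osc c' x : `|F (c' *m P) x - F (c' *m P) (z (code x))| <=
    2 * D1 * delta * Num.sqrt (dot c' c').
  have key (g : Om -> 'rV[R]_n) y x' : (forall i, `|dot (row i P) (g y) - dot (row i P) (g x')| <= delta) ->
     `|dot (c' *m P) (g y) - dot (c' *m P) (g x')| <= D1 * delta * Num.sqrt (dot c' c').
    move=> hg; have dE v : dot (c' *m P) v = \sum_i c' 0 i * dot (row i P) v.
      rewrite -dot_mulmx; apply: eq_bigr => i _; congr (_ * _); rewrite mxE.
      by apply: eq_bigr => j _; rewrite !mxE mulrC.
    rewrite !dE -sumrB (le_trans (ler_norm_sum _ _ _))//.
    apply: (@le_trans _ _ (\sum_(i < D) delta * Num.sqrt (dot c' c'))).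
      apply: ler_sum => i _; rewrite -mulrBr normrM mulrC ler_pM//.
      rewrite -sqrtr_sqr ler_wsqrtr// /dot (bigD1 i)//= -expr2 lerDl sumr_ge0// => j _.
      by rewrite -expr2 sqr_ge0.
    rewrite sumr_const card_ord -[leLHS]mulr_natl mulrA ler_wpM2r ?sqrtr_ge0//.
    by rewrite ler_wpM2r// ltW.
  have h (y x' : Om) : code y = code x' ->
      F (c' *m P) y <= F (c' *m P) x' + 2 * D1 * delta * Num.sqrt (dot c' c').
    move=> e; apply: le_trans (norm2_dist_le (dot (c' *m P) (al y)) (dot (c' *m P) (be y))
      (dot (c' *m P) (al x')) (dot (c' *m P) (be x'))) _.
    apply: lerD; first exact: lexx.
    rewrite (_ : 2 * D1 * delta * _ = D1 * delta * Num.sqrt (dot c' c') +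
       D1 * delta * Num.sqrt (dot c' c')); last by ring.
    rewrite lerD//; apply: key => i.
      exact: (hcode _ _ e (i, true)).
    exact: (hcode _ _ e (i, false)).
  have h1 := h _ _ (codez x); have h2 := h _ _ (esym (codez x)).
  by rewrite ler_norml; apply/andP; split; lra.
pose w t := fine (mu [set x | code x = t]).
have modE c' t : modf (fun t => al (z t) *m P^T) (fun t => be (z t) *m P^T) c' t =
   F (c' *m P) (z t) by rewrite /modf !dot_mulmx.
have lower c' : dot c' c' <= 2 * \sum_t w t * F (c' *m P) (z t) ^+ 2.
  have bF := bounded_measurable_modf mal mbe NI (c' *m P).
  have bF2 : bounded_measurable (fun x => F (c' *m P) x ^+ 2).
    rewrite (_ : (fun x => _) = fun x => F (c' *m P) x * F (c' *m P) x).
      exact: bounded_measurableM.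
    by apply/funext => x; rewrite expr2.
  have := @cell_average T code z _ (dot c' c' / 2) mcode bF2.
  rewrite hE => h; have {}h := h _.
  suff /h : forall x, `|F (c' *m P) x ^+ 2 - F (c' *m P) (z (code x)) ^+ 2| <= dot c' c' / 2.
    by rewrite ler_norml => /andP[+ _]; rewrite -/w; move: (\sum_t _) (dot _ _) => *; lra.
  move=> x; rewrite subr_sqr normrM.
  have N2 : dot c' c' = Num.sqrt (dot c' c') ^+ 2 by rewrite sqr_sqrtr// dot_ge0.
  rewrite [leRHS](_ : _ = (4 * H)^-1 * Num.sqrt (dot c' c') * (2 * H * Num.sqrt (dot c' c'))).
    rewrite ler_pM//.
      apply: le_trans (osc c' x) _; rewrite ler_wpM2r ?sqrtr_ge0//.
      rewrite mulrC -ler_pdivlMr ?mulr_gt0//; apply: le_trans dd1 _.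
      by rewrite le_eqVlt; apply/orP; left; apply/eqP; field; rewrite !gt_eqF.
    rewrite ger0_norm ?addr_ge0 ?modf_ge0// -mulrA [leRHS]mulr_natl mulr2n.
    by rewrite lerD.
  by rewrite {1}N2; field; rewrite gt_eqF.
have upper c' t : F (c' *m P) (z t) ^+ 2 <= H ^+ 2 * dot c' c'.
  have N2 : dot c' c' = Num.sqrt (dot c' c') ^+ 2 by rewrite sqr_sqrtr// dot_ge0.
  by rewrite N2 -exprMn ler_sqr ?nnegrE ?modf_ge0 ?mulr_ge0 ?sqrtr_ge0 ?(ltW H0).
have w0 t : 0 <= w t by rewrite fine_ge0.
exists D, P, T, (code point), z, w; split => //.
- split => //.
  + exact: sum_cell_weights.
  + by move=> c x; rewrite modE.
  + by move=> c; under eq_bigr => t _ do rewrite modE.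
  + by rewrite leq_maxl.
  + by rewrite leq_maxr.
  + have H2 : 1 <= H ^+ 2 by rewrite exprn_ege1.
    rewrite /maxn; case: ifP => _; first by lra.
    (* This sum is the sum of the squared norms of the two evaluation vectors at t, which
       the upper bound, applied to these vectors themselves, estimates. *)
    have tr t : \sum_i F (delta_mx 0 i *m P) (z t) ^+ 2 <= 2 * H ^+ 2.
      pose v (g : Om -> 'rV[R]_n) : 'rV[R]_D := g (z t) *m P^T.
      have Ei i : F (delta_mx 0 i *m P) (z t) ^+ 2 = v al 0 i ^+ 2 + v be 0 i ^+ 2.
        by rewrite sqr_modf -!dot_mulmx !dot_delta.
      rewrite (eq_bigr _ (fun i _ => Ei i)) big_split /= mulr_natl mulr2n.
      have bound g : (forall c', `|dot (c' *m P) (g (z t))| <= F (c' *m P) (z t)) ->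
         \sum_i v g 0 i ^+ 2 <= H ^+ 2.
        move=> hg; rewrite (eq_bigr (fun i => v g 0 i * v g 0 i)); last first.
          by move=> i _; rewrite expr2.
        rewrite -/(dot (v g) (v g)).
        have := dot_ge0 (v g); rewrite le_eqVlt => /orP[/eqP <-|v0]; first exact: sqr_ge0.
        rewrite -(ler_pM2r v0) -expr2; apply: le_trans (upper (v g) t).
        rewrite ler_sqr ?nnegrE ?modf_ge0 ?dot_ge0//.
        apply: le_trans (hg _); rewrite -dot_mulmx; exact: ler_norm.
      apply: lerD; apply: bound => c'.
        exact: (dot_le_modf al be _ (z t)).1.
      exact: (dot_le_modf al be _ (z t)).2.
    have sD : \sum_(i < D) dot (delta_mx 0 i : 'rV[R]_D) (delta_mx 0 i) = D%:R.
      rewrite (eq_bigr (fun=> 1)) ?sumr_const ?card_ord// => i _.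
      by rewrite dot_delta mxE !eqxx.
    rewrite -sD; apply: (@le_trans _ _ (\sum_(i < D) 2 * \sum_t w t * F (delta_mx 0 i *m P) (z t) ^+ 2)).
      by apply: ler_sum => i _; exact: lower.
    rewrite -mulr_sumr exchange_big /=.
    apply: (@le_trans _ _ (2 * \sum_t w t * (2 * H ^+ 2))).
      rewrite ler_wpM2l//; apply: ler_sum => t _; rewrite -mulr_sumr ler_wpM2l//.
    rewrite -mulr_suml sum_cell_weights// mul1r; lra.
- move=> c' hc'; apply: cell_average => //.
    exact (bounded_measurable_Phi_modf mal mbe NI pg _).
  have hM := modular_class_bound mal mbe H1 NI pg (hE c') hc'.
  move=> x; apply: htau; rewrite ?modf_ge0 ?(le_trans (FH _ _))//.
  apply: le_trans (osc c' x) _.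
  apply: (@le_trans _ _ (2 * D1 * delta * (M / H))).
    rewrite ler_wpM2l ?mulr_ge0 ?(ltW delta0) ?(ltW D10)//.
    by rewrite ler_pdivlMr// mulrC.
  rewrite mulrAC -ler_pdivlMl ?mulr_gt0 ?invr_gt0//; apply: le_trans dd2 _.
  by rewrite le_eqVlt; apply/orP; left; apply/eqP; field; rewrite !gt_eqF.
Qed.

End Cells.

(** * From modulars to Luxemburg norms *)

Section Comparison.
Variable R : realType.

(** [M] and [A] are the modulars of [f / l] for the measure and for the sample, and the
    two infima are the Luxemburg norms.  Above the first norm the sample modular is at
    most [1 + eps], and the almost monotonicity of [Phi t / t] brings it below 1 when [l]
    is multiplied by [a1 * (1 + eps)].  For the lower bound, [M] is greater than 1 just
    below the first norm, and the polynomial growth gives [M l >= 1 - eps / 2] just above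
    it, where the comparison of [A] and [M] is available; then
    [A l >= 1 - eps] is incompatible with [A ly <= 1] for a much smaller [ly]. *)
Lemma inf_ratio_bounds (M A : R -> R) (q a1 eps : R) :
  1 <= q -> 1 <= a1 -> 0 < eps -> eps <= 2^-1 ->
  (exists l, 0 < l /\ M l <= 1) ->
  (forall l, 0 < l -> M l <= 1 -> `|A l - M l| <= eps / 2) ->
  (forall l' l, 0 < l' -> l' <= l -> M l' <= (l / l') `^ q * M l) ->
  (forall l' l, 0 < l' -> l' <= l -> A l <= a1 * (l' / l) * A l') ->
  (forall l, 0 < l -> 0 <= M l) ->
  a1^-1 * (1 - eps) * inf [set l | 0 < l /\ M l <= 1] <= inf [set l | 0 < l /\ A l <= 1] /\
  inf [set l | 0 < l /\ A l <= 1] <= a1 * (1 + eps) * inf [set l | 0 < l /\ M l <= 1].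
Proof.
move=> q1 a11 eps0 eps1 [l0 [l00 Ml0]] AM hM hA M0.
have a10 : 0 < a1 by rewrite (lt_le_trans ltr01).
set S := [set l | _ /\ M l <= 1]; set SA := [set l | _ /\ A l <= 1].
have S0 : S !=set0 by exists l0.
have lbS : has_lbound S by exists 0 => l [/ltW].
have lbSA : has_lbound SA by exists 0 => l [/ltW].
have up l : S l -> SA (a1 * (1 + eps) * l).
  move=> [lp Ml]; have k1 : 1 <= a1 * (1 + eps) by rewrite -[leLHS]mulr1 ler_pM//; lra.
  have kl : 0 < a1 * (1 + eps) * l by rewrite !mulr_gt0//; lra.
  split => //.
  have h1 : A l <= 1 + eps by have := AM l lp Ml; rewrite ler_norml => /andP[_]; lra.
  have ll : l <= a1 * (1 + eps) * l by rewrite ler_peMl// ltW.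
  apply: (le_trans (hA _ _ lp ll)).
  have -> : a1 * (l / (a1 * (1 + eps) * l)) * A l = A l / (1 + eps).
    by field; rewrite !gt_eqF//; lra.
  by rewrite ler_pdivrMr ?mul1r//; lra.
have SA0 : SA !=set0 by exists (a1 * (1 + eps) * l0); apply: up.
have infS0 : 0 <= inf S by apply: lb_le_inf => // l [/ltW].
have infSA0 : 0 <= inf SA by apply: lb_le_inf => // l [/ltW].
split; last first.
  have k0 : 0 < a1 * (1 + eps) by rewrite mulr_gt0//; lra.
  rewrite mulrC -ler_pdivrMr//; apply: lb_le_inf => // l Sl.
  by rewrite ler_pdivrMr// mulrC; apply: ge_inf => //; exact: up.
move: infS0; rewrite le_eqVlt => /orP[/eqP <-|i0]; first by rewrite mulr0.
apply: lb_le_inf => // ly [ly0 Aly]; rewrite leNgt; apply/negP => hly.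
have e1 : 0 < 1 - eps by lra.
(* The q-th power of (1 - dl) / (1 + dl) is at least 1 - eps / 2. *)
pose dl := eps / (4 * q).
have q0 : 0 < q by rewrite (lt_le_trans ltr01).
have dl0 : 0 < dl by rewrite divr_gt0// mulr_gt0.
have dl1 : dl <= 1 / 8 by rewrite /dl ler_pdivrMr ?mulr_gt0//; nra.
have [l Sl lt_l] : exists2 l, S l & l < inf S * (1 + dl).
  have := @inf_adherent R S (inf S * dl) (mulr_gt0 i0 dl0) (conj S0 lbS).
  by move=> [l Sl hl]; exists l => //; rewrite mulrDr mulr1.
have [lp Ml] := Sl.
have il : inf S <= l by apply: ge_inf.
pose l1 := inf S * (1 - dl).
have l10 : 0 < l1 by rewrite mulr_gt0//; lra.
have l1i : l1 < inf S by rewrite /l1 gtr_pMr//; lra.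
have Ml1 : 1 < M l1.
  rewrite ltNge; apply/negP => h; have : S l1 by [].
  by move=> /(ge_inf lbS); rewrite leNgt l1i.
have l1l : l1 <= l by rewrite (le_trans (ltW l1i)).
have h1 := hM _ _ l10 l1l.
have B1 : 1 - eps / 2 <= (l1 / l) `^ q.
  apply: le_trans (powR_Bernoulli q1 (divr_ge0 (ltW l10) (ltW lp))).
  rewrite lerD2l lerN2.
  have : 1 - 2 * dl <= l1 / l.
    rewrite ler_pdivlMr// /l1; apply: (@le_trans _ _ ((1 - 2 * dl) * (inf S * (1 + dl)))).
      by rewrite ler_wpM2l ?ltW//; lra.
    by rewrite mulrCA ler_pM2l//; nra.
  move=> h; have h2 : q * (1 - l1 / l) <= q * (2 * dl) by rewrite ler_pM2l//; lra.
  apply: le_trans h2 _; rewrite /dl le_eqVlt; apply/orP; left; apply/eqP.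
  by field; rewrite gt_eqF.
have Mlow : 1 - eps / 2 <= M l.
  apply: le_trans B1 _.
  have pq : 0 < (l / l1) `^ q by rewrite powR_gt0// divr_gt0.
  have inv : (l1 / l) `^ q * (l / l1) `^ q = 1.
    rewrite -powRM ?divr_ge0 ?(ltW l10) ?(ltW lp)//.
    have -> : l1 / l * (l / l1) = 1 by field; rewrite !gt_eqF.
    by rewrite powR1.
  rewrite -(ler_pM2r pq) inv mulrC; exact: le_trans (ltW Ml1) h1.
have Alow : 1 - eps <= A l by have := AM l lp Ml; rewrite ler_norml => /andP[+ _]; lra.
have hly' : a1 * ly < (1 - eps) * l.
  rewrite -ltr_pdivlMl//; apply: lt_le_trans hly _.
  by rewrite mulrA ler_wpM2l// ltW// mulr_gt0 ?invr_gt0.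
have lyl : ly <= l.
  have : a1 * ly <= a1 * l; last by rewrite ler_pM2l.
  apply: (le_trans (ltW hly')); rewrite ler_wpM2r ?(ltW lp)//; lra.
have h2 := hA _ _ ly0 lyl.
have h3 : a1 * (ly / l) * A ly <= a1 * (ly / l).
  by rewrite ler_piMr// mulr_ge0 ?(ltW a10)// divr_ge0 ?ltW.
have h4 : a1 * (ly / l) < 1 - eps by rewrite mulrA ltr_pdivrMr.
by move: (le_lt_trans (le_trans (le_trans Alow h2) h3) h4); rewrite ltxx.
Qed.

End Comparison.

Section Growth.
Variables (R : realType).

Lemma powR_div (s t x : R) : 0 <= s -> 0 < t -> (s / t) `^ x = s `^ x / t `^ x.
Proof.
move=> s0 t0; rewrite powRM ?invr_ge0 ?(ltW t0)//; congr (_ * _).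
by rewrite -(powR_inv1 (ltW t0)) -powRrM mulN1r powRN.
Qed.

Lemma Phi_power_growth (Phi : R -> R) (p : R) : 1 < p -> Phi_function Phi ->
  aInc p Phi -> Dec Phi ->
  exists ca q t1, power_growth Phi ca q (Num.min p 2) t1.
Proof.
move=> p1 [P0 Pm Pz _ Py _] [ca [ca1 hca]] [q [q1 hq]].
set r := Num.min p 2.
have r1 : 1 < r by rewrite /r lt_min p1 ltr1n.
have rp : r <= p by rewrite /r ge_min lexx.
have r2 : r <= 2 by rewrite /r ge_min lexx orbT.
have [t1 t11 Pt1] : exists2 t1, 1 <= t1 & 1 <= Phi t1.
  have : \forall t \near +oo, 1 <= Phi t by move/cvgryPge : Py; apply.
  move=> [M [_ hM]]; exists (`|M| + 1); first by rewrite lerDr.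
  by apply: hM; rewrite (le_lt_trans (ler_norm _))// ltrDl.
exists ca, q, t1; split => //; first exact: ltW.
- move=> s t s0; rewrite le_eqVlt => /orP[/eqP <-|st].
    by rewrite mulrC -mulrA ler_peMl// mulr_ge0 ?powR_ge0 ?P0.
  move: s0; rewrite le_eqVlt => /orP[/eqP <-|s0].
    by rewrite Pz mul0r powR0 ?mulr0 ?mul0r// gt_eqF// (lt_trans ltr01).
  have t0 : 0 < t by rewrite (lt_trans s0).
  have h := hca s t s0 st; rewrite !powRN in h.
  have hs : Phi s <= ca * (s / t) `^ p * Phi t.
    rewrite (powR_div _ (ltW s0) t0).
    rewrite ler_pdivrMr ?powR_gt0// in h; apply: le_trans h _.
    by rewrite le_eqVlt; apply/orP; left; apply/eqP; ring.
  have tr : 0 < t `^ r by rewrite powR_gt0.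
  rewrite -ler_pdivlMr//; apply: le_trans hs _.
  have -> : ca * s `^ r * Phi t / t `^ r = ca * (s / t) `^ r * Phi t.
    by rewrite (powR_div _ (ltW s0) t0); ring.
  rewrite ler_wpM2r ?P0 ?(ltW t0)// ler_wpM2l ?(le_trans ler01)//.
  by apply: ger_powR => //; rewrite divr_gt0//= ler_pdivrMr// mul1r ltW.
- move=> s t s0; rewrite le_eqVlt => /orP[/eqP <-|st]; first by rewrite mulrC.
  move: s0; rewrite le_eqVlt => /orP[/eqP <-|s0].
    by rewrite Pz powR0 ?mulr0// gt_eqF// (lt_le_trans ltr01).
  have t0 : 0 < t by rewrite (lt_trans s0).
  have := hq s t s0 st; rewrite !powRN ler_pdivrMr ?powR_gt0// mulrAC ler_pdivlMr ?powR_gt0//.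
  by rewrite (mulrC (t `^ q)).
Qed.

End Growth.

(** * Borel functions and the two scalar fields *)

Section Borel.
Variables (R : realType) (T : topologicalType) (A : set T) (x0 : A).

Lemma borel_measurable_fun (g : pointed_subset x0 -> R) :
  (forall r, open [set x | r < g x]) ->
  measurable_fun (setT : set (borel x0)) (g : borel x0 -> R).
Proof.
move=> og; apply: (measurability _ (RGenOInfty.measurableE R)) => //.
move=> _ [_ [r ->] <-]; rewrite setTI; apply: sub_sigma_algebra => /=.
rewrite (_ : _ @^-1` _ = [set x | r < g x])//.
by apply/seteqP; split => x /=; rewrite in_itv/= andbT.
Qed.

Lemma borel_continuous (g : pointed_subset x0 -> R) : continuous g ->
  measurable_fun (setT : set (borel x0)) (g : borel x0 -> R).
Proof.
move=> cg; apply: borel_measurable_fun => r.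
rewrite (_ : [set x | r < g x] = g @^-1` `]r, +oo[%classic).
  by apply: open_comp; [move=> x _; exact: cg | exact: interval_open].
by apply/seteqP; split => x /=; rewrite in_itv/= andbT.
Qed.

(** One-sided continuity makes the superlevel sets open, and these generate the Borel
    sets of the line. *)
Lemma borel_continuous_comp (K : numFieldType) (e : pointed_subset x0 -> K) (h : K -> R) :
  (forall eps : R, 0 < eps -> exists2 dl : K, 0 < dl &
     forall z z', `|z - z'| < dl -> h z - h z' < eps) ->
  continuous e ->
  measurable_fun (setT : set (borel x0)) ((fun x => h (e x)) : borel x0 -> R).
Proof.
move=> hh ce; apply: borel_measurable_fun => r.
rewrite (_ : [set x | r < h (e x)] = e @^-1` [set z | r < h z])//.
apply: open_comp; first by move=> x _; exact: ce.
rewrite openE => z /= rz; apply/nbhs_ballP.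
have [dl dl0 hdl] := hh (h z - r) (ltac:(by rewrite subr_gt0)).
exists dl => // z'; rewrite -ball_normE /= => /hdl; lra.
Qed.

End Borel.

Section ScalarForm.
Variables (R : realType) (T : topologicalType) (A : set T) (x0 : A).

Lemma real_scalar_form (N : nat) (X : set (pointed_subset x0 -> R)) :
  fin_dim_subspace N X ->
  exists (n : nat) (al be : borel x0 -> 'rV[R]_n), [/\ (n <= N + N)%N,
    (forall i, measurable_fun setT (fun x => al x 0 i)) /\
    (forall i, measurable_fun setT (fun x => be x 0 i)),
    forall f, X f -> exists c, forall x, `|f x| = modf al be c x &
    forall c, exists2 f, X f & forall x, `|f x| = modf al be c x].
Proof.
move=> [cX [e [_ XE]]].
have eX i : X (e i).
  rewrite XE; exists (fun j => (j == i)%:R) => x.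
  rewrite (bigD1 i)//= eqxx mul1r big1 ?addr0// => j /negbTE ->.
  by rewrite mul0r.
exists N, (fun x => \row_i e i x), (fun=> 0).
have mE c x : modf (fun x => \row_i e i x) (fun=> 0) c x = `|\sum_i c 0 i * e i x|.
  rewrite /modf [dot c 0]dotC dot0l expr0n addr0 sqrtr_sqr; congr `|_|.
  by apply: eq_bigr => i _; rewrite mxE.
split; [exact: leq_addr | split => i | move=> f | move=> c].
- under eq_fun => x do rewrite mxE.
  by apply: borel_continuous; exact/cX/eX.
- under eq_fun => x do rewrite mxE.
  exact: measurable_cst.
- rewrite XE => -[c hc]; exists (\row_i c i) => x.
  by rewrite mE hc; congr `|_|; apply: eq_bigr => i _; rewrite mxE.
- exists (fun x => \sum_i c 0 i * e i x) => [|x]; last by rewrite mE.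
  by rewrite XE; exists (fun i => c 0 i).
Qed.

Lemma Re_sum (I : Type) (s : seq I) (f : I -> R[i]) :
  Re (\sum_(i <- s) f i) = \sum_(i <- s) Re (f i).
Proof. by apply: (big_morph (@Re R)) => // -[? ?] [? ?]. Qed.

Lemma Im_sum (I : Type) (s : seq I) (f : I -> R[i]) :
  Im (\sum_(i <- s) f i) = \sum_(i <- s) Im (f i).
Proof. by apply: (big_morph (@Im R)) => // -[? ?] [? ?]. Qed.

Lemma Re_le_normc (z : R[i]) : Re z <= Normc.normc z.
Proof.
case: z => u v /=; apply: le_trans (ler_norm _) _.
by rewrite -sqrtr_sqr ler_wsqrtr// lerDl sqr_ge0.
Qed.

Lemma Im_le_normc (z : R[i]) : Im z <= Normc.normc z.
Proof.
case: z => u v /=; apply: le_trans (ler_norm _) _.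
by rewrite -sqrtr_sqr ler_wsqrtr// lerDr sqr_ge0.
Qed.

(** A complex coefficient [s + i * t] is the pair of real coefficients [s] and [t], and
    the rows [al], [be] are those of the real and imaginary part of the product. *)
Lemma complex_scalar_form (N : nat) (X : set (pointed_subset x0 -> R[i])) :
  fin_dim_subspace N X ->
  exists (n : nat) (al be : borel x0 -> 'rV[R]_n), [/\ (n <= N + N)%N,
    (forall i, measurable_fun setT (fun x => al x 0 i)) /\
    (forall i, measurable_fun setT (fun x => be x 0 i)),
    forall f, X f -> exists c, forall x, Normc.normc (f x) = modf al be c x &
    forall c, exists2 f, X f & forall x, Normc.normc (f x) = modf al be c x].
Proof.
move=> [cX [e [_ XE]]].
have eX i : X (e i).
  rewrite XE; exists (fun j => (j == i)%:R) => x.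
  rewrite (bigD1 i)//= eqxx mul1r big1 ?addr0// => j /negbTE ->.
  by rewrite mul0r.
pose al (x : borel x0) : 'rV[R]_(N + N) :=
  row_mx (\row_i Re (e i x)) (\row_i (- Im (e i x))).
pose be (x : borel x0) : 'rV[R]_(N + N) := row_mx (\row_i Im (e i x)) (\row_i Re (e i x)).
have small (h : R[i] -> R) : (forall z z', h z - h z' <= Normc.normc (z - z')) ->
   forall eps : R, 0 < eps -> exists2 dl : R[i], 0 < dl &
     forall z z', `|z - z'| < dl -> h z - h z' < eps.
  move=> hh eps eps0; exists (eps%:C)%C; first by rewrite ltcR.
  move=> z z'; rewrite normc_def ltcR => hb; apply: le_lt_trans (hh z z') _.
  by move: hb; case: (z - z').
have mRe i : measurable_fun setT ((fun x => Re (e i x)) : borel x0 -> R).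
  apply: borel_continuous_comp; last exact/cX/eX.
  apply: small => z z'; have -> : Re z - Re z' = Re (z - z') by case: z; case: z'.
  exact: Re_le_normc.
have mIm i : measurable_fun setT ((fun x => Im (e i x)) : borel x0 -> R).
  apply: borel_continuous_comp; last exact/cX/eX.
  apply: small => z z'; have -> : Im z - Im z' = Im (z - z') by case: z; case: z'.
  exact: Im_le_normc.
have mE (s t : 'rV[R]_N) x :
    Normc.normc (\sum_i (s 0 i +i* t 0 i)%C * e i x) = modf al be (row_mx s t) x.
  rewrite /modf /dot !big_split_ord /=.
  have -> z : Normc.normc z = Num.sqrt (Re z ^+ 2 + Im z ^+ 2) :> R by case: z.
  rewrite Re_sum Im_sum -!big_split /=; congr (Num.sqrt (_ ^+ 2 + _ ^+ 2)).
    apply: eq_bigr => i _; rewrite !row_mxEl !row_mxEr !mxE.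
    by case: (e i x) => u v /=; rewrite mulrN.
  apply: eq_bigr => i _; rewrite !row_mxEl !row_mxEr !mxE.
  by case: (e i x) => u v /=.
exists (N + N)%N, al, be; split => //.
- split => i; rewrite /al /be.
    case: (splitP i) => j ij.
      rewrite (_ : i = lshift N j); last exact: val_inj.
      under eq_fun => x do rewrite row_mxEl mxE.
      exact: mRe.
    rewrite (_ : i = rshift N j); last exact: val_inj.
    under eq_fun => x do rewrite row_mxEr mxE.
    exact: (measurable_funN (mIm j)).
  case: (splitP i) => j ij.
    rewrite (_ : i = lshift N j); last exact: val_inj.
    under eq_fun => x do rewrite row_mxEl mxE.
    exact: mIm.
  rewrite (_ : i = rshift N j); last exact: val_inj.
  under eq_fun => x do rewrite row_mxEr mxE.
  exact: mRe.
- move=> f; rewrite XE => -[c hc].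
  exists (row_mx (\row_i Re (c i)) (\row_i Im (c i))) => x.
  rewrite -mE hc; congr Normc.normc; apply: eq_bigr => i _; congr (_ * _).
  by rewrite !mxE; case: (c i).
- move=> c; exists (fun x => \sum_i ((lsubmx c) 0 i +i* (rsubmx c) 0 i)%C * e i x).
    by rewrite XE; exists (fun i => ((lsubmx c) 0 i +i* (rsubmx c) 0 i)%C).
  by move=> x; rewrite mE hsubmxK.
Qed.

Lemma scalar_form (K : numFieldType) (modulus : K -> R) (N : nat)
    (X : set (pointed_subset x0 -> K)) :
  scalar_modulus modulus -> fin_dim_subspace N X ->
  exists (n : nat) (al be : borel x0 -> 'rV[R]_n), [/\ (n <= N + N)%N,
    (forall i, measurable_fun setT (fun x => al x 0 i)) /\
    (forall i, measurable_fun setT (fun x => be x 0 i)),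
    forall f, X f -> exists c, forall x, modulus (f x) = modf al be c x &
    forall c, exists2 f, X f & forall x, modulus (f x) = modf al be c x].
Proof.
move=> hm; case: hm X => X; first exact: real_scalar_form.
exact: complex_scalar_form.
Qed.

End ScalarForm.

Section Empirical.
Context (R : realType) (d : measure_display) (T : measurableType d).

Lemma integral_empirical (m : nat) (y : nat -> T) (h : T -> R) :
  measurable_fun setT h -> (forall x, 0 <= h x) ->
  (\int[empirical R (fun j : 'I_m => y j)]_x (h x)%:E)%E = (avg m y h)%:E.
Proof.
move=> mh h0.
have mhE : measurable_fun setT (EFin \o h) by exact/measurable_EFinP.
pose dm (k : nat) : {measure set T -> \bar R} := \d_(y k).
have iE : (m%:R^-1 : R) = ((m%:R^-1)%:nng : {nonneg R})%:num by [].
rewrite (@eq_measure_integral _ _ _ setT (mscale (m%:R^-1)%:nng (msum dm m))).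
  rewrite ge0_integral_mscale//=; last by move=> x _; rewrite lee_fin.
  rewrite ge0_integral_measure_sum//; last by move=> x _; rewrite lee_fin.
  rewrite /avg EFinM -sumEFin; congr (_ * _)%E; apply: eq_bigr => k _.
  by rewrite integral_dirac//= diracE mem_set// mul1e.
by move=> B mB _; rewrite /= /empirical /mscale /msum /=.
Qed.

End Empirical.

(** * The sample size *)

(** The sum of the estimates of the five logarithms that make up [ln W] below. *)
Lemma sum_log_bounds (R : realType) (x1 x2 x3 x4 x5 e L c qL z cz qz : R) :
  x1 <= 2 * e -> x2 <= e -> x3 <= c + qL -> x4 <= 6 * L -> x5 <= L ->
  c <= cz -> qL <= qz -> e <= z -> L <= z ->
  x1 + x2 + x3 + x4 + x5 <= 10 * z + cz + qz.
Proof. by move=> *; lra. Qed.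

Section SampleSize.
Variables (R : realType) (Phi : R -> R) (ca q r t1 : R).
Hypothesis pg : power_growth Phi ca q r t1.

Let r1 := pg_r_ge1 pg.
Let r2 := pg_r_le2 pg.
Let q1 := pg_q_ge1 pg.
Let ca1 := pg_a_ge1 pg.
Let r0 : 0 < r. Proof. by move: r1; lra. Qed.

(** The loss in replacing [sup_bound] by [H `^ (2 / r)] inside [Phi]. *)
Definition scale_ratio : R := (2 * moment_bound ca r t1) `^ (q / r).

Lemma scale_ratio_ge1 : 1 <= scale_ratio.
Proof.
have C1 := moment_bound_ge1 pg.
have e : 1 `^ (q / r) = 1 :> R by rewrite powR1.
rewrite /scale_ratio -[leLHS]e powR_le_base ?divr_ge0 ?(ltW r0)//.
  by rewrite (le_trans ler01).
by move: C1; lra.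
Qed.

Lemma Phi_sup_bound_le (H : R) : 1 <= H ->
  Phi (sup_bound H ca r t1) <= scale_ratio * Phi (H `^ (2 / r)).
Proof.
move=> H1; have C1 := moment_bound_ge1 pg.
have C10 : 0 < 2 * moment_bound ca r t1 by move: C1; lra.
have H0 : 0 < H by rewrite (lt_le_trans ltr01).
pose L := H `^ (2 / r).
have L0 : 0 < L by rewrite powR_gt0.
pose s := (2 * moment_bound ca r t1) `^ r^-1.
have s1 : 1 <= s.
  have e : 1 `^ r^-1 = 1 :> R by rewrite powR1.
  rewrite /s -[leLHS]e powR_le_base ?invr_ge0 ?(ltW r0)//.
  by move: C1; lra.
have BE : sup_bound H ca r t1 = s * L.
  rewrite /sup_bound powRM ?(ltW C10) ?sqr_ge0//; congr (_ * _).
  by rewrite /L powRrM powR_mulrn// ltW.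
have LB : L <= sup_bound H ca r t1 by rewrite BE ler_peMl// ltW.
have := pg_upper pg (ltW L0) LB.
rewrite -ler_pdivlMr ?powR_gt0// => /le_trans; apply.
rewrite BE powRM ?(ltW L0)// ?(le_trans ler01)// /scale_ratio /s -powRrM.
rewrite (mulrC r^-1) -/L le_eqVlt; apply/orP; left; apply/eqP.
by field; rewrite gt_eqF// powR_gt0.
Qed.

Lemma Phi1_gt0 : 0 < Phi 1.
Proof.
rewrite lt0r (pg_ge0 pg)// andbT; apply/eqP => h.
have := pg_upper pg ler01 (pg_t1_ge1 pg); rewrite h mulr0 powR1 mulr1.
by rewrite leNgt (lt_le_trans ltr01 (pg_Phi_t1 pg)).
Qed.

Lemma ln_Phi_le (H : R) : 1 <= H ->
  0 < Phi (H `^ (2 / r)) /\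
  ln (Phi (H `^ (2 / r))) <= `|ln (Phi 1)| + q * log2 (2 * H ^+ 2).
Proof.
move=> H1; have H0 : 0 < H by rewrite (lt_le_trans ltr01).
have P1 := Phi1_gt0.
have L1 : 1 <= H `^ (2 / r).
  have e : 1 `^ (2 / r) = 1 :> R by rewrite powR1.
  by rewrite -[leLHS]e powR_le_base// divr_ge0// ltW.
have PL : 0 < Phi (H `^ (2 / r)) by rewrite (lt_le_trans P1)// (pg_mono pg).
split => //.
have h := pg_upper pg ler01 L1; rewrite powR1 mulr1 in h.
have H2 : 1 <= H ^+ 2 by rewrite exprn_ege1.
apply: (@le_trans _ _ (ln ((H `^ (2 / r)) `^ q * Phi 1))).
  by rewrite ler_ln ?posrE// mulr_gt0// !powR_gt0.
rewrite lnM ?posrE ?powR_gt0// addrC lerD ?ler_norm// !ln_powR.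
rewrite ler_wpM2l ?(le_trans ler01 q1)//.
apply: (@le_trans _ _ (ln (2 * H ^+ 2))); last by apply: ln_le_log2; move: H2; lra.
rewrite lnM ?posrE ?exprn_gt0// lnXn// mulrC.
have l0 := (ln2_bounds R).1; have lH : 0 <= ln H by rewrite ln_ge0.
have h2 : ln H * (2 / r) <= ln H * 2.
  by rewrite ler_wpM2l// ler_pdivrMr//; move: r1; lra.
by rewrite mulr2n; move: h2; move: (ln H * (2 / r)) => *; lra.
Qed.

Definition size_slope : R := 2 ^+ 39 * 24 * 29 * q ^+ 2 * ca * scale_ratio.
Definition size_shift : R := 20 + `|ln (Phi 1)| + q.
Definition size_constant : R := 9 * (16 * size_slope * (size_shift + 2)) ^+ 2.

Lemma size_slope_ge1 : 1 <= size_slope.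
Proof.
rewrite /size_slope -[leLHS]mulr1 ler_pM ?scale_ratio_ge1//.
rewrite -[leLHS]mulr1 ler_pM//.
rewrite -[leLHS]mulr1 ler_pM ?exprn_ege1//.
rewrite -[leLHS]mulr1 ler_pM ?ler1n//.
by rewrite -[leLHS]mulr1 ler_pM ?ler1n// exprn_ege1// ler1n.
Qed.

Lemma size_shift_ge1 : 1 <= size_shift.
Proof. by rewrite /size_shift; have := normr_ge0 (ln (Phi 1)); move: q1; move: `|_| => *; lra. Qed.

Lemma size_constant_gt0 : 0 < size_constant.
Proof.
rewrite /size_constant mulr_gt0// exprn_gt0// mulr_gt0//.
  by rewrite mulr_gt0// (lt_le_trans ltr01 size_slope_ge1).
by have := size_shift_ge1; lra.
Qed.

(** The required sample size depends on its own logarithm; the square root of [y]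
    dominates [ln y / 2], so that a quadratic threshold suffices. *)
Lemma log_absorb (y : R) : (16 * size_slope * (size_shift + 2)) ^+ 2 <= y ->
  1 <= y /\ 16 * size_slope * (size_shift + ln y) <= y.
Proof.
move=> hy; have K1 := size_slope_ge1; have Z1 := size_shift_ge1.
have Y1 : 1 <= 16 * size_slope * (size_shift + 2).
  by rewrite -[leLHS]mulr1 ler_pM//; lra.
have Y0 : 0 <= 16 * size_slope * (size_shift + 2) by rewrite (le_trans ler01).
have y1 : 1 <= y by apply: le_trans hy; rewrite exprn_ege1.
have y0 : 0 < y by rewrite (lt_le_trans ltr01).
split => //.
have sy : 16 * size_slope * (size_shift + 2) <= Num.sqrt y.
  by rewrite -[leLHS]ger0_norm// -sqrtr_sqr ler_wsqrtr.
have s1 : 1 <= Num.sqrt y by rewrite -sqrtr1 ler_wsqrtr.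
have s0 : 0 < Num.sqrt y by rewrite (lt_le_trans ltr01).
have yE : y = Num.sqrt y * Num.sqrt y by rewrite -expr2 sqr_sqrtr// ltW.
have lny : ln y <= 2 * Num.sqrt y.
  rewrite {1}yE lnM ?posrE//.
  by have := ln_sublinear s0; lra.
have h : size_shift + ln y <= (size_shift + 2) * Num.sqrt y.
  rewrite mulrDl lerD// ler_peMr//; lra.
apply: (@le_trans _ _ (16 * size_slope * ((size_shift + 2) * Num.sqrt y))).
  by rewrite ler_wpM2l// mulr_ge0//; lra.
by rewrite mulrA [leRHS]yE ler_wpM2r// ltW.
Qed.

(** Let [W] be the left-hand side of the assumption without its constant and with
    [k0 + 1] in place of [log2 (2 * nn)], and let [y = m / W].  The logarithm of [m] is at most
    [(size_shift + ln y) * log2 eps^-1 * log2 (2 * H ^+ 2)].  Hence the ratio of the logarithms in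
    [entropy_rate] is of order [log2 eps^-1], up to a factor that [log_absorb] removes,
    and its power [r / 2] is the exponent of [log2 eps^-1] in the sample size. *)
Lemma sample_size_suffices (H eps D0 nn Lam : R) (k0 m : nat) :
  Lam = 29 * log2 (2 * H ^+ 2) ->
  1 <= H -> 0 < eps -> eps <= 2^-1 -> (0 < m)%N ->
  1 <= D0 -> D0 <= 4 * H ^+ 2 -> D0 <= 2 * nn -> 1 <= nn -> 2 ^+ k0 <= 2 * D0 ->
  size_constant * eps ^- 2 * log2 eps^-1 `^ (r / 2) * Phi (H `^ (2 / r))
    * log2 (2 * nn) ^+ 2 * log2 (2 * H ^+ 2) <= m%:R ->
  2 ^+ 39 * (24 * q ^+ 2 * ca * Phi (sup_bound H ca r t1)
    * entropy_rate r Lam (ln (8 * m%:R + 1) + Lam) * (k0%:R + 1) ^+ 2)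
   <= (eps / 4) ^+ 2 * m%:R.
Proof.
move=> LamE H1 eps0 eps1 m0 D1 DH Dn n1 kD hm.
have H0 : 0 < H by rewrite (lt_le_trans ltr01).
have H2 : 1 <= H ^+ 2 by rewrite exprn_ege1.
set La := log2 (2 * H ^+ 2) in hm LamE *.
have La1 : 1 <= La by apply: log2_ge1; move: H2; lra.
set el := log2 eps^-1 in hm *.
have ie2 : 2 <= eps^-1 by rewrite -[leLHS]invrK lef_pV2// posrE invr_gt0.
have el1 : 1 <= el by exact: log2_ge1.
have [PL lnPL] := ln_Phi_le H1; set P := Phi (H `^ (2 / r)) in PL lnPL hm *.
pose u : R := k0%:R + 1.
have u1 : 1 <= u by rewrite lerDr.
have uk : u <= 2 ^+ k0 by rewrite /u natr1 natr_le_pow2.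
have n2 : 2 <= 2 * nn by lra.
have ln2n : 1 <= log2 (2 * nn) by exact: log2_ge1.
have [l20 l21] := ln2_bounds R.
have u3 : u <= 3 * log2 (2 * nn).
  have : k0%:R <= 1 + log2 (2 * nn).
    have kn : ln (2 ^+ k0) <= ln (2 * (2 * nn)).
      rewrite ler_ln ?posrE ?exprn_gt0//; last by move: n1; lra.
      by apply: le_trans kD _; lra.
    rewrite lnXn// lnM ?posrE// in kn; last by move: n1; lra.
    rewrite /log2 -(ler_pM2r l20) mulrDl mul1r divfK ?gt_eqF//.
    by rewrite [k0%:R * _]mulr_natl.
  by rewrite /u; lra.
have el0 : 0 < el `^ (r / 2) by rewrite powR_gt0// (lt_le_trans ltr01).
pose W := eps ^- 2 * el `^ (r / 2) * P * u ^+ 2 * La.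
have e20 : 0 < eps ^- 2 by rewrite invr_gt0 exprn_gt0.
have u0 : 0 < u by rewrite (lt_le_trans ltr01).
have La0 : 0 < La by rewrite (lt_le_trans ltr01).
have W0 : 0 < W by rewrite mulr_gt0// mulr_gt0 ?exprn_gt0// mulr_gt0// mulr_gt0.
pose y := m%:R / W.
have mE : m%:R = y * W by rewrite /y divfK// gt_eqF.
have mR : 1 <= m%:R :> R by rewrite ler1n.
have yC : (16 * size_slope * (size_shift + 2)) ^+ 2 <= y.
  rewrite /y ler_pdivlMr//; apply: le_trans hm.
  rewrite /size_constant /W.
  set Z := (16 * _ * _) ^+ 2.
  have Z0 : 0 <= Z by rewrite sqr_ge0.
  have uu : u ^+ 2 <= 9 * log2 (2 * nn) ^+ 2.
    have -> : 9 * log2 (2 * nn) ^+ 2 = (3 * log2 (2 * nn)) ^+ 2 by ring.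
    by rewrite ler_sqr ?nnegrE ?(ltW u0)//; lra.
  rewrite [leLHS](_ : _ = Z * (eps ^- 2 * el `^ (r / 2) * P * La) * u ^+ 2); last by ring.
  rewrite [leRHS](_ : _ = Z * (eps ^- 2 * el `^ (r / 2) * P * La) * (9 * log2 (2 * nn) ^+ 2));
    last by ring.
  rewrite ler_wpM2l// mulr_ge0// ltW// mulr_gt0// mulr_gt0// mulr_gt0//.
have [y1 hy] := log_absorb yC.
have y0 : 0 < y by rewrite (lt_le_trans ltr01).
have lny : 0 <= ln y by rewrite ln_ge0.
set cP := `|ln (Phi 1)| in lnPL.
have cP0 : 0 <= cP by exact: normr_ge0.
have LL : 1 <= el * La by rewrite -[leLHS]mulr1 ler_pM.
have elLa : el <= el * La by rewrite ler_peMr// (le_trans ler01).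
have Lael : La <= el * La by rewrite ler_peMl// (le_trans ler01).
have lnW : ln W <= (10 + cP + q) * (el * La).
  have l1 : ln (eps ^- 2) <= 2 * el.
    rewrite -exprVn lnXn ?invr_gt0// -[leLHS]mulr_natl ler_wpM2l// ln_le_log2//.
    by move: ie2; lra.
  have l2 : ln (el `^ (r / 2)) <= el.
    rewrite ln_powR; apply: (@le_trans _ _ (1 * ln el)).
      by rewrite ler_wpM2r ?ln_ge0//; move: r2; lra.
    by rewrite mul1r ltW// ln_sublinear// (lt_le_trans ltr01).
  have l3 : ln (u ^+ 2) <= 6 * La.
    rewrite lnXn//.
    have : ln u <= 3 * La.
      apply: (@le_trans _ _ (ln ((2 * H ^+ 2) ^+ 3))).
        rewrite ler_ln ?posrE ?exprn_gt0 ?mulr_gt0 ?exprn_gt0//.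
        apply: le_trans uk (le_trans kD _).
        have h3 : 8 * H ^+ 2 <= (2 * H ^+ 2) ^+ 3.
          have -> : (2 * H ^+ 2) ^+ 3 = 8 * H ^+ 2 * (H ^+ 2) ^+ 2 by ring.
          by rewrite ler_peMr ?exprn_ege1// mulr_ge0// sqr_ge0.
        by apply: le_trans h3; move: DH; lra.
      have h20 : 0 < 2 * H ^+ 2 by rewrite mulr_gt0// exprn_gt0.
      rewrite lnXn// -[leLHS]mulr_natl ler_wpM2l//.
      by apply: ln_le_log2; move: H2; lra.
    by rewrite mulr2n; lra.
  have l4 : ln La <= La by rewrite ltW// ln_sublinear.
  have -> : ln W = ln (eps ^- 2) + ln (el `^ (r / 2)) + ln P + ln (u ^+ 2) + ln La.
    have pu : 0 < u ^+ 2 by rewrite exprn_gt0.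
    have p1 : 0 < eps ^- 2 * el `^ (r / 2) by rewrite mulr_gt0.
    have p2 : 0 < eps ^- 2 * el `^ (r / 2) * P by rewrite mulr_gt0.
    have p3 : 0 < eps ^- 2 * el `^ (r / 2) * P * u ^+ 2 by rewrite mulr_gt0.
    by rewrite /W lnM// lnM// lnM// lnM.
  have q0 : 0 <= q by rewrite (le_trans ler01).
  have h1 : cP * 1 <= cP * (el * La) by rewrite ler_wpM2l.
  have h2 : q * La <= q * (el * La) by rewrite ler_wpM2l.
  have -> : (10 + cP + q) * (el * La) = 10 * (el * La) + cP * (el * La) + q * (el * La) by ring.
  move: l1 l2 lnPL l3 l4 h1 h2 elLa Lael; rewrite mulr1.
  exact: sum_log_bounds.
have lnm : ln (8 * m%:R + 1) <= (19 + cP + q + ln y) * (el * La).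
  apply: (@le_trans _ _ (ln (9 * m%:R))).
    have q1' : 0 < 8 * m%:R + 1 :> R by rewrite ltr_wpDl// mulr_ge0.
    have q2' : 0 < 9 * m%:R :> R by rewrite mulr_gt0// (lt_le_trans ltr01).
    by rewrite ler_ln ?posrE//; move: mR; lra.
  have yW0 : 0 < y * W by rewrite mulr_gt0.
  have -> : ln (9 * m%:R) = ln 9 + (ln y + ln W) :> R.
    by rewrite [in LHS]mE (@lnM _ 9) ?posrE// (@lnM _ y).
  have l9 : ln 9 <= 9 * (el * La).
    apply: (@le_trans _ _ 9); first by rewrite ltW// ln_sublinear.
    by rewrite ler_peMr.
  have ly : ln y <= ln y * (el * La) by rewrite ler_peMr.
  have -> : (19 + cP + q + ln y) * (el * La) =
    9 * (el * La) + (10 + cP + q) * (el * La) + ln y * (el * La) by ring.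
  by move: lnW l9 ly; move: (ln 9) (ln W) (_ * (el * La)) (9 * _) (ln y * _) => *; lra.
pose Z0 := size_shift + ln y.
have Z01 : 1 <= Z0 by have := size_shift_ge1; rewrite /Z0; lra.
have hratio : (ln (8 * m%:R + 1) + Lam) / Lam <= Z0 * el.
  have L290 : 0 < 29 * La by rewrite mulr_gt0.
  rewrite LamE ler_pdivrMr//.
  have h1 : 29 * La <= 29 * (el * La) by rewrite ler_wpM2l.
  apply: (@le_trans _ _ ((19 + cP + q + ln y) * (el * La) + 29 * (el * La))); first by rewrite lerD.
  have -> : Z0 * el * (29 * La) = 29 * Z0 * (el * La) by ring.
  rewrite -mulrDl ler_wpM2r ?(le_trans ler01 LL)//.
  have q0 := le_trans ler01 q1.
  have -> : 19 + cP + q + ln y + 29 = 48 + (cP + q + ln y) by ring.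
  have -> : 29 * Z0 = 580 + 29 * (cP + q + ln y) by rewrite /Z0 /size_shift -/cP; ring.
  have : 0 <= cP + q + ln y by rewrite !addr_ge0.
  by move: (cP + q + ln y) => *; lra.
have Z00 : 0 <= Z0 by rewrite (le_trans ler01).
have rate : entropy_rate r Lam (ln (8 * m%:R + 1) + Lam) <= 29 * La * (Z0 * el `^ (r / 2)).
  have Lam0 : 0 < Lam by rewrite LamE mulr_gt0.
  have lnm0 : 0 <= ln (8 * m%:R + 1) :> R by rewrite ln_ge0// lerDr mulr_ge0.
  rewrite /entropy_rate -LamE ler_wpM2l ?(ltW Lam0)//.
  apply: (@le_trans _ _ ((Z0 * el) `^ (r / 2))).
    apply: (powR_le_base _ _ hratio); first by rewrite divr_ge0// ltW.
    by rewrite divr_ge0 ?(ltW Lam0)// addr_ge0// ltW.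
  rewrite powRM//; last by rewrite (le_trans ler01).
  rewrite ler_wpM2r ?(ltW el0)//; apply: ler1_powR => //.
  by move: r2; lra.
have PB := Phi_sup_bound_le H1; rewrite -/P in PB.
have q20 : 0 <= 24 * q ^+ 2 * ca.
  by rewrite mulr_ge0 ?(le_trans ler01 ca1)// mulr_ge0// sqr_ge0.
have PBr : Phi (sup_bound H ca r t1) * entropy_rate r Lam (ln (8 * m%:R + 1) + Lam)
   <= scale_ratio * P * (29 * La * (Z0 * el `^ (r / 2))).
  have B0 : 0 <= Phi (sup_bound H ca r t1) by rewrite (pg_ge0 pg) ?powR_ge0.
  apply: ler_pM => //.
  rewrite /entropy_rate mulr_ge0 ?powR_ge0//.
  by rewrite LamE mulr_ge0// ltW.
apply: (@le_trans _ _ (2 ^+ 39 * (24 * q ^+ 2 * ca *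
   (scale_ratio * P * (29 * La * (Z0 * el `^ (r / 2)))) * u ^+ 2))).
  rewrite ler_wpM2l ?exprn_ge0// ler_wpM2r ?sqr_ge0//.
  by rewrite -mulrA ler_wpM2l.
rewrite [leLHS](_ : _ = size_slope * Z0 * (eps ^+ 2 * W)); last first.
  rewrite /size_slope /W; have ee : eps ^+ 2 * eps ^- 2 = 1 by rewrite divff// expf_neq0// gt_eqF.
  rewrite [RHS](_ : _ = size_slope * Z0 * ((eps ^+ 2 * eps ^- 2) * (el `^ (r / 2) * P * u ^+ 2 * La))).
    by rewrite ee mul1r /size_slope; move: (2 ^+ 39) => *; ring.
  by rewrite /size_slope; ring.
rewrite mE; have -> : (eps / 4) ^+ 2 * (y * W) = y / 16 * (eps ^+ 2 * W) by field.
apply: ler_wpM2r; first by rewrite mulr_ge0 ?sqr_ge0// ltW.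
rewrite ler_pdivlMr//; apply: le_trans hy.
by rewrite -/Z0 le_eqVlt; apply/orP; left; apply/eqP; ring.
Qed.

End SampleSize.

(** * The sampling theorem *)

Lemma luxemburgE (R : realType) (d : measure_display) (T : measurableType d)
    (nu : {measure set T -> \bar R}) (Phi : R -> R) (K : numFieldType)
    (modulus : K -> R) (f : T -> K) (G : T -> R) (M : R -> R) :
  (forall x, modulus (f x) = G x) ->
  (forall l, 0 < l -> (\int[nu]_x (Phi (G x / l))%:E)%E = (M l)%:E) ->
  luxemburg nu Phi modulus f = inf [set l | 0 < l /\ M l <= 1].
Proof.
move=> fG hM; rewrite /luxemburg; congr inf; apply/seteqP.
by split => l /= [l0]; (under eq_integral => x _ do rewrite fG); rewrite hM// lee_fin.
Qed.

Section Dilations.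
Variables (R : realType) (Phi : R -> R) (ca q r t1 : R).
Hypothesis pg : power_growth Phi ca q r t1.

Lemma Phi_dilation_upper (g l' l : R) : 0 <= g -> 0 < l' -> l' <= l ->
  Phi (g / l') <= (l / l') `^ q * Phi (g / l).
Proof.
move=> g0 l'0 l'l; have l0 := lt_le_trans l'0 l'l.
move: g0; rewrite le_eqVlt => /orP[/eqP <-|g0]; first by rewrite !mul0r (pg_at0 pg) mulr0.
have gl : 0 < g / l by rewrite divr_gt0.
have le : g / l <= g / l' by rewrite ler_pM2l// lef_pV2.
have e : (g / l') `^ q = (l / l') `^ q * (g / l) `^ q.
  have -> : g / l' = l / l' * (g / l) by field; rewrite !gt_eqF.
  by rewrite powRM ?divr_ge0// ltW.
have := pg_upper pg (ltW gl) le.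
by rewrite e -mulrA [X in _ <= X]mulrCA mulrC ler_pM2l// ?powR_gt0.
Qed.

Lemma Phi_dilation_lower (a1 g l' l : R) : aInc_const Phi 1 a1 ->
  0 <= g -> 0 < l' -> l' <= l -> Phi (g / l) <= a1 * (l' / l) * Phi (g / l').
Proof.
move=> [a11 ha] g0 l'0; rewrite le_eqVlt => /orP[/eqP <-|l'l].
  by rewrite divff ?gt_eqF// mulr1 ler_peMl// (pg_ge0 pg)// divr_ge0// ltW.
have l0 := lt_trans l'0 l'l.
move: g0; rewrite le_eqVlt => /orP[/eqP <-|g0]; first by rewrite !mul0r (pg_at0 pg) mulr0.
have gl : 0 < g / l by rewrite divr_gt0.
have lt : g / l < g / l' by rewrite ltr_pM2l// ltf_pV2.
have gl' : 0 < g / l' by rewrite divr_gt0.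
have := ha _ _ gl lt; rewrite (powR_inv1 (ltW gl)) (powR_inv1 (ltW gl')).
rewrite -(ler_pM2r gl) divfK ?gt_eqF// => /le_trans; apply.
by rewrite le_eqVlt; apply/orP; left; apply/eqP; field; rewrite !gt_eqF.
Qed.

Lemma exists_small_Phi : exists2 s, 0 < s & Phi s <= 1.
Proof.
have P1 := Phi1_gt0 pg; have ca1 := pg_a_ge1 pg; have r1 := pg_r_ge1 pg.
have c0 : 0 < 1 + ca * Phi 1 by rewrite ltr_pwDl// mulr_ge0 ?ltW// (lt_le_trans ltr01).
pose s := (1 + ca * Phi 1)^-1.
have s0 : 0 < s by rewrite invr_gt0.
have s1 : s <= 1.
  by rewrite invf_le1// lerDl mulr_ge0 ?ltW// (lt_le_trans ltr01).
exists s => //; have := pg_lower pg (ltW s0) s1; rewrite powR1 mulr1 => /le_trans; apply.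
have sr : s `^ r <= s by apply: ge1r_powR => //; rewrite s0.
apply: (@le_trans _ _ (s * (ca * Phi 1))).
  by rewrite mulrAC mulrC ler_wpM2r// mulr_ge0 ?(ltW P1)// (le_trans ler01).
by rewrite /s ler_pdivrMl// mulr1 lerDr.
Qed.

End Dilations.

Section ModularSampling.
Context (R : realType) (d : measure_display) (Om : measurableType d).
Variables (mu : probability Om R) (n : nat) (al be : Om -> 'rV[R]_n) (H : R).
Hypotheses (mal : forall i, measurable_fun setT (fun x => al x 0 i))
  (mbe : forall i, measurable_fun setT (fun x => be x 0 i))
  (H1 : 1 <= H)
  (NI : forall c x, modf al be c x <=
     H * Num.sqrt (\int[mu]_y (modf al be c y ^+ 2))).
Variables (Phi : R -> R) (ca q r t1 : R).
Hypothesis pg : power_growth Phi ca q r t1.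
Local Notation F := (modf al be).

(** The logarithm of the number of coarse points, and that of the dimension, are of the
    order of [log2 (2 * H ^+ 2)]. *)
Lemma chaining_logs (D0 : R) : 1 <= D0 -> D0 <= 4 * H ^+ 2 ->
  [/\ 1 <= 29 * log2 (2 * H ^+ 2), ln (2 ^+ 29 * H ^+ 13) <= 29 * log2 (2 * H ^+ 2) &
    ln (5 * D0) <= 29 * log2 (2 * H ^+ 2)].
Proof.
move=> D1 DH; have H0 : 0 < H by rewrite (lt_le_trans ltr01).
have H2 : 1 <= H ^+ 2 by rewrite exprn_ege1.
have HH : 2 <= 2 * H ^+ 2 by rewrite ler_peMr.
have La1 := log2_ge1 HH; have lnLa := ln_le_log2 (le_trans (ler1n R 2) HH).
have [l20 l21] := ln2_bounds R.
have lnH : 0 <= ln H by rewrite ln_ge0.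
rewrite lnM ?posrE ?exprn_gt0// lnXn// -[ln H *+ _]mulr_natl in lnLa.
split.
- by move: La1; move: (log2 _) => *; lra.
- rewrite lnM ?posrE ?exprn_gt0// !lnXn// -[ln 2 *+ _]mulr_natl -[ln H *+ _]mulr_natl.
  by move: lnLa lnH; move: (log2 _) (ln 2) (ln H) => *; lra.
- apply: (@le_trans _ _ (ln (2 ^+ 5 * H ^+ 2))).
    have D0p : 0 < 5 * D0 by rewrite mulr_gt0// (lt_le_trans ltr01).
    have D3 : 0 < 2 ^+ 5 * H ^+ 2 by rewrite mulr_gt0 ?exprn_gt0.
    rewrite ler_ln ?posrE//; have -> : 2 ^+ 5 = 32 :> R by ring.
    by move: DH H2; move: (H ^+ 2) => *; lra.
  rewrite lnM ?posrE ?exprn_gt0// !lnXn// -[ln 2 *+ _]mulr_natl -[ln H *+ _]mulr_natl.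
  by move: lnLa lnH l20; move: (log2 _) (ln 2) (ln H) => *; lra.
Qed.

Lemma modular_sampling (N m : nat) (eps : R) : (n <= N + N)%N -> (1 <= N)%N ->
  0 < eps -> eps <= 2^-1 -> (0 < m)%N ->
  size_constant Phi ca q r t1 * eps ^- 2 * log2 eps^-1 `^ (r / 2) * Phi (H `^ (2 / r))
    * log2 (2 * N%:R) ^+ 2 * log2 (2 * H ^+ 2) <= m%:R ->
  exists y : nat -> Om, forall c, \int[mu]_x Phi (F c x) <= 1 ->
    `|avg m y (fun x => Phi (F c x)) - \int[mu]_x Phi (F c x)| <= eps / 2.
Proof.
move=> n2N N1 eps0 eps1 m0 hm.
have e40 : 0 < eps / 4 by rewrite divr_gt0.
have e41 : eps / 4 <= 1 by move: eps1; lra.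
have [D [P [T [t0 [z [w [Dn hP fr disc]]]]]]] := discretization mal mbe H1 NI pg e40.
have D1 : 1 <= (maxn D 1)%:R :> R by rewrite ler1n leq_maxr.
have [k0 [Dk kD]] := exists_pow2 D1.
have N1R : 1 <= N%:R :> R by rewrite ler1n.
have DN : (maxn D 1)%:R <= 2 * N%:R :> R.
  rewrite -natrM ler_nat mul2n -addnn geq_max (leq_trans Dn n2N)/=.
  by rewrite (leq_trans N1)// leq_addr.
have DH := frame_D0_le fr.
have [Lam1 LamH LamD] := chaining_logs D1 DH.
have big := sample_size_suffices pg (erefl _) H1 eps0 eps1 m0 D1 DH DN N1R kD hm.
have [y hy] := finite_sampling t0 fr pg m0 e40 e41 Dk Lam1 LamH LamD big.
exists (fun j => z (y j)) => c Mc; have [c' hc'] := hP c.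
have FE : (fun x => Phi (F c x)) = (fun x => Phi (F (c' *m P) x)).
  by apply/funext => x; rewrite hc'.
rewrite FE in Mc *; have h1 := disc _ Mc.
have modE t : modf (fun t => al (z t) *m P^T) (fun t => be (z t) *m P^T) c' t =
   F (c' *m P) (z t) by rewrite /modf !dot_mulmx.
have SE : \sum_t w t * Phi (modf (fun t => al (z t) *m P^T) (fun t => be (z t) *m P^T) c' t)
   = \sum_t w t * Phi (F (c' *m P) (z t)) by apply: eq_bigr => t _; rewrite modE.
have Kc : unit_class (fun t => al (z t) *m P^T) (fun t => be (z t) *m P^T) w Phi c'.
  rewrite /unit_class SE; move: h1 Mc e41; rewrite ler_norml => /andP[_].
  by move: (\sum_t _) (Rintegral _ _ _) => *; lra.
have := hy _ Kc; rewrite SE.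
have -> : avg m y (fun t => Phi (modf (fun t => al (z t) *m P^T) (fun t => be (z t) *m P^T)
   c' t)) = avg m (fun j => z (y j)) (fun x => Phi (F (c' *m P) x)).
  by rewrite /avg; congr (_ * _); apply: eq_bigr => j _; rewrite modE.
move: h1; rewrite !ler_norml => /andP[h1 h2] /andP[h3 h4].
move: h1 h2 h3 h4; move: (\sum_t _) (Rintegral _ _ _) (avg _ _ _) => *.
by apply/andP; split; lra.
Qed.

(** Bounded functions have finite Luxemburg norm. *)
Lemma modular_le1 c : exists2 l, 0 < l & \int[mu]_x Phi (F c x / l) <= 1.
Proof.
have [s s0 Ps] := exists_small_Phi pg.
have [_ [B hB]] := bounded_measurable_modf mal mbe NI c.
have B0 : 0 <= B by apply: le_trans (hB point).
have l0 : 0 < (B + 1) / s by rewrite divr_gt0// ltr_wpDl.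
exists ((B + 1) / s) => //.
have mu1 : \int[mu]_x 1 = 1 :> R.
  by rewrite Rintegral_cst//; have := @probability_setT _ _ _ mu; move=> /= ->; rewrite mulr1.
have FE x : F c x / ((B + 1) / s) = F (((B + 1) / s)^-1 *: c) x.
  by rewrite modfZ ?invr_ge0 ?(ltW l0)// mulrC.
rewrite -[leRHS]mu1; apply: le_Rintegral => //.
- apply: bounded_measurable_integrable; under eq_fun => x do rewrite FE.
  exact (bounded_measurable_Phi_modf mal mbe NI pg _).
- exact: bounded_measurable_integrable (bounded_measurable_cst _ _).
move=> x _; apply: le_trans Ps; apply: (pg_mono pg); first by rewrite divr_ge0 ?modf_ge0// ltW.
rewrite ler_pdivrMr// mulrC divfK ?gt_eqF//.
by have := hB x; rewrite ger0_norm ?modf_ge0// => h; rewrite (le_trans h)// lerDl.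
Qed.

End ModularSampling.

Theorem theorem3p1 (R : realType) (p : R) (hp : 1 < p) (Phi : R -> R)
    (hPhi : Phi_function Phi) (haInc : aInc p Phi) (hDec : Dec Phi) :
  exists C : R, 0 < C /\
  forall a1 : R, aInc_const Phi 1 a1 ->
  forall (K : numFieldType) (modulus : K -> R), scalar_modulus modulus ->
  forall (d : nat) (Omega : set 'rV[R]_d), compact Omega ->
  forall (x0 : Omega) (mu : probability (borel x0) R),
  forall (N : nat) (H : R), (1 <= N)%N -> 1 <= H ->
  forall X : set (pointed_subset x0 -> K),
  fin_dim_subspace N X -> NI_2_infty mu modulus H X ->
  forall eps : R, 0 < eps -> eps <= 2^-1 ->
  forall m : nat, (0 < m)%N ->
  C * eps ^- 2 * log2 eps^-1 `^ (Num.min p 2 / 2)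
    * Phi (H `^ (2 / Num.min p 2)) * log2 (2 * N%:R) ^+ 2 * log2 (2 * H ^+ 2)
    <= m%:R ->
  exists x : 'I_m -> borel x0,
  forall f, X f ->
    a1^-1 * (1 - eps) * luxemburg mu Phi modulus f
      <= luxemburg (empirical R x) Phi modulus f /\
    luxemburg (empirical R x) Phi modulus f
      <= a1 * (1 + eps) * luxemburg mu Phi modulus f.
Proof.
have [ca [q [t1 pg]]] := Phi_power_growth hp hPhi haInc hDec.
set r := Num.min p 2 in pg *.
exists (size_constant Phi ca q r t1); split; first exact: size_constant_gt0 pg.
move=> a1 ha1 K modulus hmod d Omega _ x0 mu N H N1 H1 X hX hNI eps eps0 eps1 m m0 hm.
have [n [al [be [n2N [mal mbe] fc cf]]]] := scalar_form hmod hX.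
have NI c x : modf al be c x <= H * Num.sqrt (\int[mu]_y (modf al be c y ^+ 2)).
  have [f Xf fE] := cf c; rewrite -fE; apply: le_trans (hNI f Xf x) _.
  by under eq_Rintegral => y _ do rewrite fE.
have [y hy] := modular_sampling mal mbe H1 NI pg n2N N1 eps0 eps1 m0 hm.
exists (fun j : 'I_m => y j) => f Xf; have [c hc] := fc f Xf.
pose G x := modf al be c x.
have GE l x : 0 < l -> G x / l = modf al be (l^-1 *: c) x.
  by move=> l0; rewrite modfZ ?invr_ge0 ?(ltW l0)// mulrC.
have bG l : 0 < l -> bounded_measurable (fun x => Phi (G x / l)).
  move=> l0; under eq_fun => x do rewrite (GE l x l0).
  exact (bounded_measurable_Phi_modf mal mbe NI pg _).
have PG0 l x : 0 < l -> 0 <= Phi (G x / l).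
  by move=> l0; rewrite (pg_ge0 pg)// divr_ge0 ?modf_ge0// ltW.
pose M l := \int[mu]_x Phi (G x / l).
pose A l := avg m y (fun x => Phi (G x / l)).
have muE l : 0 < l -> (\int[mu]_x (Phi (G x / l))%:E)%E = (M l)%:E.
  by move=> l0; rewrite integral_Rintegral//; exact: bG.
have nuE l : 0 < l ->
    (\int[empirical R (fun j : 'I_m => y j)]_x (Phi (G x / l))%:E)%E = (A l)%:E.
  by move=> l0; rewrite integral_empirical//; [exact: (bG l l0).1 | move=> x; exact: PG0].
rewrite (@luxemburgE _ _ _ mu Phi K modulus f G M hc muE).
rewrite (@luxemburgE _ _ _ (empirical R (fun j : 'I_m => y j)) Phi K modulus f G A hc nuE).
apply: (inf_ratio_bounds (pg_q_ge1 pg) ha1.1 eps0 eps1).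
- by have [l l0 Ml] := modular_le1 mal mbe NI pg c; exists l.
- move=> l l0; rewrite /A /M; under [fun x : borel x0 => _]eq_fun => x do rewrite (GE l x l0).
  exact: hy.
- move=> l' l l'0 l'l; have l0 := lt_le_trans l'0 l'l.
  rewrite /M -Rintegral_scale; last exact: bG.
  apply: le_Rintegral => //.
  + exact: bounded_measurable_integrable (bG _ l'0).
  + exact/bounded_measurable_integrable/bounded_measurableZ/bG.
  by move=> x _; apply: (Phi_dilation_upper pg) => //; exact: modf_ge0.
- move=> l' l l'0 l'l; rewrite /A -avgZ; apply: le_avg => x.
  by apply: (Phi_dilation_lower pg ha1) => //; exact: modf_ge0.
- by move=> l l0; apply: Rintegral_ge0 => x _; exact: PG0.
Qed.
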